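(* Let $A$, $G$, $G_k$ ($k\ge 2$), $\beta_1,\dots,\beta_N$, $E_{\mathfrak c}$, $E_{\mathfrak s}$, $\Pi_{\mathfrak c}$, $\Pi_{\mathfrak s}$, $A_{\mathfrak c}$, $A_{\mathfrak s}$ be as in the context, with $m=\dim E_{\mathfrak c}$ and $\mathrm{Re}(\beta_m)>\mathrm{Re}(\beta_{m+1})$. Assume furthermore that $$\mathrm{Re}(\beta_{m+1})<k\,\mathrm{Re}(\beta_m).$$ Then the Lyapunov–Perron integral $$\mathfrak I(\xi)=\int_{-\infty}^0 e^{-sA_{\mathfrak s}}\,\Pi_{\mathfrak s}G_k(e^{sA_{\mathfrak c}}\xi)\,\mathrm ds,\qquad \xi\in E_{\mathfrak c},$$ is well defined, and $h_k=\mathfrak I$ is a solution $h_k:E_{\mathfrak c}\to E_{\mathfrak s}$ of the equation $$Dh_k(\xi)A_{\mathfrak c}\xi-A_{\mathfrak s}h_k(\xi)=\Pi_{\mathfrak s}G_k(\xi),\qquad \xi\in E_{\mathfrak c}.$$ Moreover, for every $\xi\in E_{\mathfrak c}$, $$\mathfrak I(\xi)=\lim_{\tau\to\infty}y^{(1)}_{\mathfrak s}[\xi](0;-\tau),$$ where, for $\tau>0$, $y^{(1)}_{\mathfrak s}[\xi](0;-\tau)$ denotes the value at $s=0$ of the component $y^{(1)}_{\mathfrak s}$ of the solution to the backward–forward system $$\frac{\mathrm dy^{(1)}_{\mathfrak c}}{\mathrm ds}=A_{\mathfrak c}y^{(1)}_{\mathfrak c},\qquad \frac{\mathrm dy^{(1)}_{\mathfrak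 s}}{\mathrm ds}=A_{\mathfrak s}y^{(1)}_{\mathfrak s}+\Pi_{\mathfrak s}G_k\big(y^{(1)}_{\mathfrak c}\big),\qquad s\in[-\tau,0],$$ $$y^{(1)}_{\mathfrak c}(0)=\xi,\qquad y^{(1)}_{\mathfrak s}(-\tau)=0.$$ Finally, if in addition $$\mathrm{Re}(\beta_{m+1})<\min\{2k\,\mathrm{Re}(\beta_m),0\},$$ then $\mathfrak I$ provides the leading-order approximation of the local invariant manifold function $h$ (defined in the context), in the sense that $$\|\mathfrak I(\xi)-h(\xi)\|_{E_{\mathfrak s}}=o\big(\|\xi\|_{E_{\mathfrak c}}^k\big)\qquad\text{as }\xi\to0,\ \xi\in E_{\mathfrak c}.$$
   Context: Consider the ODE system $\frac{\mathrm dy}{\mathrm dt}=Ay+G(y)$ in $\mathbb R^N$, where $A$ is an $N\times N$ real matrix and $G:\mathbb R^N\to\mathbb R^N$ is a sufficiently smooth (say $C^{k+1}$) map with $G(0)=0$, $DG(0)=0$, and, near the origin, $G(y)=G_k(y,\dots,y)+O(\|y\|^{k+1})$. Here $k\ge2$ and $G_k:\mathbb R^N\times\cdots\times\mathbb R^N\to\mathbb R^N$ ($k$ factors) is the leading-order homogeneous term of order $k$ (a $k$-linear map; it is extended multilinearly to $\mathbb C^N$). $G_k(y)$ is shorthand for $G_k(y,\dots,y)$. The eigenvalues of $A$ counted with algebraic multiplicity are $\beta_1,\dots,\beta_N\in\mathbb C$, with corresponding generalized eigenvectors $\boldsymbol e_1,\dots,\boldsymbol e_N\in\mathbb C^N$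 forming a basis of $\mathbb C^N$. They are ordered lexicographically: real parts decrease as the index increases and, for equal real parts, imaginary parts decrease. Fix $1\le m<N$ and assume $\mathrm{Re}(\beta_m)>\mathrm{Re}(\beta_{m+1})$. Set $E_{\mathfrak c}=\mathrm{span}\{\boldsymbol e_1,\dots,\boldsymbol e_m\}$ and $E_{\mathfrak s}=\mathrm{span}\{\boldsymbol e_{m+1},\dots,\boldsymbol e_N\}$, so that $\mathbb C^N=E_{\mathfrak c}\oplus E_{\mathfrak s}$. $\Pi_{\mathfrak c},\Pi_{\mathfrak s}$ are the associated canonical projectors, and $A_{\mathfrak c}=\Pi_{\mathfrak c}A$, $A_{\mathfrak s}=\Pi_{\mathfrak s}A$, regarded as operators on $E_{\mathfrak c}$ and $E_{\mathfrak s}$ respectively (both subspaces are invariant under $A$). Local invariant manifold function: $h:E_{\mathfrak c}\to E_{\mathfrak s}$ is a $C^1$ function, with $h(0)=0$ and $Dh(0)=0$, such that for some open ball $\mathfrak B\subset E_{\mathfrak c}$ centered at the origin the graph $\mathfrak M=\{\xi+h(\xi):\xi\in\mathfrak B\}$ is locally invariant: any solution $y(t)$ of the ODE with $y(t_0)\in\mathfrak M$ for some $t_0$ stays on $\mathfrak M$ over an interval $[t_0,t_0+\alpha)$, $\alpha>0$, i.e. $y(t)=\Pi_{\mathfrak c}y(t)+h(\Pi_{\mathfrak c}y(t))$ there. (The ODE being real, for this notion points of $E_{\mathfrak c}$ and $E_{\mathfrak s}$ are understood as real points, i.e. in $\mathbb R^N\subset\mathbb C^N$.) *)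

(* Defs.v *)
From HB Require Import structures.
From mathcomp Require Import all_boot all_order all_algebra.
From mathcomp Require Export complex.
From mathcomp Require Import all_classical all_reals all_analysis.

Set Implicit Arguments.
Unset Strict Implicit.
Unset Printing Implicit Defensive.

Import Order.TTheory GRing.Theory Num.Theory.
Import numFieldNormedType.Exports.

Local Open Scope classical_set_scope.
Local Open Scope ring_scope.
Local Open Scope complex_scope.

(* The usual topology of the modulus on R[i]; 'cV[R[i]]_N and 'M[R[i]]_N then
   inherit the max norm, which is equivalent to any other norm on them. *)
HB.instance Definition _ (R : rcfType) := PseudoPointedMetric.copy R[i] R[i]^o.
HB.instance Definition _ (R : rcfType) := NormedModule.copy R[i] R[i]^o.

Section Calculus.

(* In finite dimension this is the usual class C^n: f is C^(n+1) iff it is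
   differentiable and x |-> Df(x)v is C^n for every fixed direction v. *)
Fixpoint smooth (R : realType) (V W : normedModType R) (n : nat) (f : V -> W)
    : Prop :=
  match n with
  | 0 => continuous f
  | n'.+1 => (forall x, differentiable f x) /\
             (forall v, smooth n' (fun x => 'd f x v))
  end.

(* Frechet differentiability at x of a map defined on the linear subspace E;
   values of f off E are irrelevant, and the derivative, a linear map on E, is
   represented by a matrix L of which only the restriction to E matters (and
   is determined by f, E and x). *)
Definition derive_on (K : numFieldType) (N : nat) (E : set 'cV[K]_N)
    (f : 'cV[K]_N -> 'cV[K]_N) (x : 'cV[K]_N) (L : 'M[K]_N) : Prop :=
  (fun y => f y - f x - L *m (y - x)) =o_ (within E (nbhs x)) (fun y => y - x).

Variables (R : realType) (N : nat).

(* Derivative l at s, relative to J, of a C^N-valued curve in a real variable;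
   one-sided at an endpoint of an interval J. *)
Definition curve_deriv (J : set R) (y : R -> 'cV[R[i]]_N) (s : R)
    (l : 'cV[R[i]]_N) : Prop :=
  (fun t => ((t - s)^-1)%:C *: (y t - y s)) @ within J s^' --> l.

Definition cvec_integrable (D : set R) (f : R -> 'cV[R[i]]_N) : Prop :=
  forall i,
    (@lebesgue_measure R).-integrable D (fun s => (complex.Re (f s i 0))%:E) /\
    (@lebesgue_measure R).-integrable D (fun s => (complex.Im (f s i 0))%:E).

Definition cvec_integral (D : set R) (f : R -> 'cV[R[i]]_N) : 'cV[R[i]]_N :=
  \col_i (Rintegral (@lebesgue_measure R) D (fun s => complex.Re (f s i 0)) +i*
          Rintegral (@lebesgue_measure R) D (fun s => complex.Im (f s i 0))).

Definition expmx (B : 'M[R[i]]_N) : 'M[R[i]]_N :=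
  limn (series (fun j => (j`!%:R)^-1 *: B ^+ j)).

End Calculus.

Section Setting.
Variables (R : realType) (N : nat).

Definition cplx (p q : nat) (M : 'M[R]_(p, q)) : 'M[R[i]]_(p, q) :=
  map_mx (real_complex R) M.

Definition multilinear (k : nat) (F : ('I_k -> 'cV[R]_N) -> 'cV[R]_N) : Prop :=
  forall (v : 'I_k -> 'cV[R]_N) (i : 'I_k) (a : R) (u w : 'cV[R]_N),
    F [eta v with i |-> a *: u + w] =
    a *: F [eta v with i |-> u] + F [eta v with i |-> w].

(* The C-multilinear extension of F, expanded over the standard basis. *)
Definition cplx_multilinear (k : nat) (F : ('I_k -> 'cV[R]_N) -> 'cV[R]_N)
    (z : 'I_k -> 'cV[R[i]]_N) : 'cV[R[i]]_N :=
  \sum_(s : {ffun 'I_k -> 'I_N})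
    (\prod_(i < k) z i (s i) 0) *: cplx (F (fun i => delta_mx (s i) 0)).

(* The families beta and e are indexed from 1: only beta 1, ..., beta N and
   e 1, ..., e N are relevant. *)
Definition basis_mx (e : nat -> 'cV[R[i]]_N) : 'M[R[i]]_N :=
  \matrix_(i, j) e j.+1 i 0.

Record spectral_data (A : 'M[R]_N) (beta : nat -> R[i])
    (e : nat -> 'cV[R[i]]_N) : Prop := SpectralData {
  spectral_eigenvalues :
    char_poly (cplx A) = \prod_(1 <= j < N.+1) ('X - (beta j)%:P);
  spectral_gen_eigenvectors : forall j, (1 <= j <= N)%N ->
    exists p : nat, (cplx A - (beta j)%:M) ^+ p *m e j = 0;
  spectral_basis : basis_mx e \in unitmx;
  spectral_order : forall i j, (1 <= i)%N -> (i < j)%N -> (j <= N)%N ->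
    complex.Re (beta j) < complex.Re (beta i) \/
    (complex.Re (beta j) = complex.Re (beta i) /\
     complex.Im (beta j) <= complex.Im (beta i))
}.

Variables (A : 'M[R]_N) (e : nat -> 'cV[R[i]]_N) (m : nat).

Definition Ec : set 'cV[R[i]]_N :=
  [set z | exists c : nat -> R[i], z = \sum_(1 <= j < m.+1) c j *: e j].
Definition Es : set 'cV[R[i]]_N :=
  [set z | exists c : nat -> R[i], z = \sum_(m.+1 <= j < N.+1) c j *: e j].

Definition EcR : set 'cV[R]_N := [set x | Ec (cplx x)].
Definition EsR : set 'cV[R]_N := [set x | Es (cplx x)].

(* The matrix with e_j |-> e_j for j <= m and e_j |-> 0 for j > m. *)
Definition Pic : 'M[R[i]]_N := basis_mx e *m pid_mx m *m invmx (basis_mx e).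
Definition Pis : 'M[R[i]]_N := 1%:M - Pic.

(* As matrices on C^N these preserve Ec and Es respectively; they and their
   exponentials are only ever applied to vectors of Ec, resp. Es. *)
Definition Ac : 'M[R[i]]_N := Pic *m cplx A.
Definition As : 'M[R[i]]_N := Pis *m cplx A.

Definition solution_on (G : 'cV[R]_N -> 'cV[R]_N) (a b : R)
    (y : R -> 'cV[R]_N) : Prop :=
  forall t, a < t < b -> is_derive t 1 y (A *m y t + G (y t)).

Definition locally_invariant (G : 'cV[R]_N -> 'cV[R]_N) (M : set 'cV[R]_N)
    : Prop :=
  forall (a b t0 : R) (y : R -> 'cV[R]_N),
    a < t0 < b -> solution_on G a b y -> M (y t0) ->
    exists2 alpha : R, 0 < alpha & t0 + alpha <= b /\
      forall t, t0 <= t < t0 + alpha -> M (y t).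

Record local_invariant_manifold_function (G h : 'cV[R]_N -> 'cV[R]_N) : Prop :=
  LocalInvariantManifoldFunction {
  limf_range : forall xi, EcR xi -> EsR (h xi);
  limf_0 : h 0 = 0;
  limf_C1 : exists Dh : 'cV[R]_N -> 'M[R]_N,
    [/\ forall xi, EcR xi -> derive_on EcR h xi (Dh xi),
        forall v, EcR v -> {within EcR, continuous (fun xi => Dh xi *m v)} &
        forall v, EcR v -> Dh 0 *m v = 0];
  limf_invariant : exists2 r : R, 0 < r &
    locally_invariant G [set xi + h xi | xi in EcR `&` ball 0 r]
}.

Variables (k : nat) (Gk : ('I_k -> 'cV[R]_N) -> 'cV[R]_N).

Definition GkC (z : 'cV[R[i]]_N) : 'cV[R[i]]_N :=
  cplx_multilinear Gk (fun=> z).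

Definition LP_integrand (xi : 'cV[R[i]]_N) (s : R) : 'cV[R[i]]_N :=
  expmx ((- s)%:C *: As) *m (Pis *m GkC (expmx (s%:C *: Ac) *m xi)).

Definition LP_integral (xi : 'cV[R[i]]_N) : 'cV[R[i]]_N :=
  cvec_integral `]-oo, 0] (LP_integrand xi).

Record backward_forward_solution (xi : 'cV[R[i]]_N) (tau : R)
    (yc ys : R -> 'cV[R[i]]_N) : Prop := BackwardForwardSolution {
  bf_spaces : forall s, - tau <= s <= 0 -> Ec (yc s) /\ Es (ys s);
  bf_backward : forall s, - tau <= s <= 0 ->
    curve_deriv `[- tau, 0] yc s (Ac *m yc s);
  bf_forward : forall s, - tau <= s <= 0 ->
    curve_deriv `[- tau, 0] ys s (As *m ys s + Pis *m GkC (yc s));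
  bf_final : yc 0 = xi;
  bf_initial : ys (- tau) = 0
}.

End Setting.

(* Main.v *)
Require Import Defs.
From HB Require Import structures.
From mathcomp Require Import all_boot all_order all_algebra.
From mathcomp Require Import all_classical all_reals all_analysis.
From mathcomp Require Import measurable_realfun ring lra.

Set Implicit Arguments.
Unset Strict Implicit.
Unset Printing Implicit Defensive.

Import Order.TTheory GRing.Theory Num.Theory.
Import numFieldNormedType.Exports.

Local Open Scope classical_set_scope.
Local Open Scope ring_scope.
Local Open Scope complex_scope.

(** Let I be the Lyapunov-Perron integral, f_xi its integrand, and e^(tAc), e^(tAs) the flows on
Ec and Es.

The splitting is invariant under A and under complex conjugation because Ec and Es are the kernels
of two polynomials in A, the roots of which are separated by the spectral gap
([shift_prod_coprime], [splitting_commute], [conj_Pic]). An energy estimate in each generalized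
eigenspace shows that, for t >= 0, e^(-tAc) is O(e^(at)) for each a > - Re (beta m) and e^(tAs) is
O(e^(-bt)) for each b < - Re (beta m.+1) ([gen_eigen_growth], [Ec_backward_bound],
[Es_forward_bound]). The condition Re (beta m.+1) < k Re (beta m) leaves room for ka < b, and then
the integrand f_xi is O(e^((b - ka)s)) at -oo. It therefore has exactly one primitive F_xi that
decays exponentially at -oo, and I(xi) = F_xi(0) ([tail_primitive_exists],
[tail_primitive_unique], [LP_primitives]). By multilinearity F_xi(0) is a polynomial in xi, so I is
differentiable.

Everything about I is read off from F. The identity f_(e^(tAc) xi)(s) = e^(tAs) f_xi(s + t) and
uniqueness give F_(e^(tAc) xi)(s) = e^(tAs) F_xi(s + t); at s = 0 this is
I(e^(tAc) xi) = e^(tAs) F_xi(t), whose derivative at t = 0 is the equation for I ([LP_equation]).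
By variation of constants the backward-forward system has the value F_xi(0) - F_xi(-tau) at 0,
which tends to F_xi(0) ([bf_value], [bf_limit]).

For a manifold function h, Picard's theorem provides solutions starting on the graph, and local
invariance makes the vector field tangent to it ([picard], [invariance_equation]). Along the linear
orbit x(s) = e^(sAc) xi this tangency turns the derivative of F_xi(s) - e^(-sAs) h(x(s)) into
e^(-sAs) applied to a defect that is o(|x(s)|^k) ([difference_deriv], [defect_small]). Take
a > 0, as Re (beta m.+1) < 0 allows, and integrate this derivative over [-tau, 0], where tau is the
time at which the backward bound, a multiple of e^(a tau) |xi|, reaches a small delta: the
integral is a small multiple of |xi|^k since ka < b, and the value at -tau is
e^(tau As) (I - h)(x(-tau)), of size e^(-b tau) = o(e^(-ka tau)) = o(|xi|^k)
([leading_order]). *)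

Notation Re := complex.Re.
Notation Im := complex.Im.

(** * Complex numbers and matrices in the l^1 norm *)

Section ReIm.
Variable R : realType.
Implicit Types x y : R[i].

Lemma ReD x y : Re (x + y) = Re x + Re y. Proof. by case: x; case: y. Qed.
Lemma ImD x y : Im (x + y) = Im x + Im y. Proof. by case: x; case: y. Qed.
Lemma ReN x : Re (- x) = - Re x. Proof. by case: x. Qed.
Lemma ImN x : Im (- x) = - Im x. Proof. by case: x. Qed.
Lemma ReB x y : Re (x - y) = Re x - Re y. Proof. by case: x; case: y. Qed.
Lemma ImB x y : Im (x - y) = Im x - Im y. Proof. by case: x; case: y. Qed.
Lemma ReM x y : Re (x * y) = Re x * Re y - Im x * Im y.
Proof. by case: x; case: y. Qed.
Lemma ImM x y : Im (x * y) = Re x * Im y + Im x * Re y.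
Proof. by case: x => a b; case: y => c d /=; rewrite [b * _]mulrC. Qed.
Lemma ReZ (a : R) x : Re (a%:C * x) = a * Re x.
Proof. by rewrite ReM /= mul0r subr0. Qed.
Lemma ImZ (a : R) x : Im (a%:C * x) = a * Im x.
Proof. by rewrite ImM /= mul0r addr0. Qed.
Lemma Re_sum (I : Type) (r : seq I) (P : pred I) (F : I -> R[i]) :
  Re (\sum_(i <- r | P i) F i) = \sum_(i <- r | P i) Re (F i).
Proof. by elim/big_rec2: _ => // i y1 y2 _ <-; rewrite ReD. Qed.
Lemma Im_sum (I : Type) (r : seq I) (P : pred I) (F : I -> R[i]) :
  Im (\sum_(i <- r | P i) F i) = \sum_(i <- r | P i) Im (F i).
Proof. by elim/big_rec2: _ => // i y1 y2 _ <-; rewrite ImD. Qed.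
Lemma complex_eq x y : Re x = Re y -> Im x = Im y -> x = y.
Proof. by case: x => a b; case: y => c d /= -> ->. Qed.
Definition ReImE := (ReD, ImD, ReN, ImN, ReZ, ImZ, ReM, ImM).

(** The moduli of R[i] take their values in R[i]; this norm, equivalent to the modulus, is
R-valued and bounds real and imaginary parts with constant 1. *)
Definition cnorm x : R := `|Re x| + `|Im x|.

Lemma cnorm_ge0 x : 0 <= cnorm x.
Proof. by rewrite addr_ge0. Qed.
Lemma cnorm0 : cnorm 0 = 0.
Proof. by rewrite /cnorm /= !normr0 addr0. Qed.
Lemma cnormN x : cnorm (- x) = cnorm x.
Proof. by rewrite /cnorm ReN ImN !normrN. Qed.
Lemma cnormD x y : cnorm (x + y) <= cnorm x + cnorm y.
Proof.
rewrite /cnorm ReD ImD; have := ler_normD (Re x) (Re y).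
by have := ler_normD (Im x) (Im y); lra.
Qed.
Lemma cnormM x y : cnorm (x * y) <= cnorm x * cnorm y.
Proof.
rewrite /cnorm ReM ImM.
have := ler_normD (Re x * Re y) (- (Im x * Im y)).
have := ler_normD (Re x * Im y) (Im x * Re y).
by rewrite normrN !normrM; nra.
Qed.
Lemma cnormZ (a : R) x : cnorm (a%:C * x) = `|a| * cnorm x.
Proof. by rewrite /cnorm ReZ ImZ !normrM mulrDr. Qed.
Lemma cnormC (a : R) : cnorm a%:C = `|a|.
Proof. by rewrite /cnorm /= normr0 addr0. Qed.
Lemma cnorm_eq0 x : cnorm x = 0 -> x = 0.
Proof.
move=> /eqP; rewrite paddr_eq0 // !normr_eq0 => /andP[/eqP r0 /eqP i0].
exact: complex_eq.
Qed.
Lemma cnorm_sum (I : Type) (r : seq I) (P : pred I) (F : I -> R[i]) :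
  cnorm (\sum_(i <- r | P i) F i) <= \sum_(i <- r | P i) cnorm (F i).
Proof.
elim/big_rec2: _ => [|i y1 y2 _ h]; first by rewrite cnorm0.
by apply: le_trans (cnormD _ _) _; rewrite lerD2l.
Qed.
Lemma Re_le_cnorm x : `|Re x| <= cnorm x.
Proof. by rewrite lerDl. Qed.
Lemma Im_le_cnorm x : `|Im x| <= cnorm x.
Proof. by rewrite lerDr. Qed.

End ReIm.

Section Mnorm.
Variable R : realType.

Definition mnorm p q (M : 'M[R[i]]_(p, q)) : R := \sum_i \sum_j cnorm (M i j).

Variables p q : nat.
Implicit Types M : 'M[R[i]]_(p, q).

Lemma mnorm_ge0 M : 0 <= mnorm M.
Proof. by do 2![apply: sumr_ge0 => ? _]; exact: cnorm_ge0. Qed.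
Lemma mnorm0 : mnorm (0 : 'M[R[i]]_(p, q)) = 0.
Proof. by rewrite /mnorm big1 // => i _; rewrite big1 // => j _; rewrite mxE cnorm0. Qed.
Lemma mnormN M : mnorm (- M) = mnorm M.
Proof. by apply: eq_bigr => i _; apply: eq_bigr => j _; rewrite mxE cnormN. Qed.
Lemma mnormD M M' : mnorm (M + M') <= mnorm M + mnorm M'.
Proof.
rewrite /mnorm -big_split /=; apply: ler_sum => i _.
rewrite -big_split /=; apply: ler_sum => j _; rewrite mxE; exact: cnormD.
Qed.
Lemma mnormB M M' : mnorm (M - M') <= mnorm M + mnorm M'.
Proof. by rewrite -(mnormN M'); exact: mnormD. Qed.
Lemma mnorm_sum (I : Type) (r : seq I) (P : pred I) (F : I -> 'M[R[i]]_(p, q)) :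
  mnorm (\sum_(i <- r | P i) F i) <= \sum_(i <- r | P i) mnorm (F i).
Proof.
elim/big_rec2: _ => [|i y1 y2 _ h]; first by rewrite mnorm0.
by apply: le_trans (mnormD _ _) _; rewrite lerD2l.
Qed.
Lemma mnormZ (a : R[i]) M : mnorm (a *: M) <= cnorm a * mnorm M.
Proof.
rewrite /mnorm mulr_sumr; apply: ler_sum => i _.
rewrite mulr_sumr; apply: ler_sum => j _; rewrite mxE; exact: cnormM.
Qed.
Lemma mnormZr (a : R) M : mnorm (a%:C *: M) = `|a| * mnorm M.
Proof.
rewrite /mnorm mulr_sumr; apply: eq_bigr => i _.
rewrite mulr_sumr; apply: eq_bigr => j _; rewrite mxE; exact: cnormZ.
Qed.
Lemma cnorm_le_mnorm M i j : cnorm (M i j) <= mnorm M.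
Proof.
rewrite /mnorm (bigD1 i) //= (bigD1 j) //= -addrA lerDl addr_ge0 //.
  by apply: sumr_ge0 => ? _; exact: cnorm_ge0.
by do 2![apply: sumr_ge0 => ? _]; exact: cnorm_ge0.
Qed.
Lemma mnorm_le_entries M (c : R) :
  (forall i j, cnorm (M i j) <= c) -> mnorm M <= (p * q)%:R * c.
Proof.
move=> Mc; rewrite /mnorm; apply: (@le_trans _ _ (\sum_(i < p) \sum_(j < q) c)).
  by apply: ler_sum => i _; apply: ler_sum => j _.
by rewrite !(sumr_const, card_ord) -mulrnA mulr_natl mulnC.
Qed.
Lemma mnorm_le0 M : mnorm M <= 0 -> M = 0.
Proof.
move=> M0; apply/matrixP => i j; rewrite mxE; apply: cnorm_eq0.
apply/eqP; rewrite eq_le cnorm_ge0 andbT; apply: le_trans M0.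
exact: cnorm_le_mnorm.
Qed.
End Mnorm.

(** The reason for the l^1 norm on matrices: it is submultiplicative. *)
Lemma mnormM (R : realType) p q r (M : 'M[R[i]]_(p, q)) (M' : 'M[R[i]]_(q, r)) :
  mnorm (M *m M') <= mnorm M * mnorm M'.
Proof.
rewrite /mnorm mulr_suml; apply: ler_sum => i _.
apply: (@le_trans _ _ (\sum_j \sum_k cnorm (M i k) * cnorm (M' k j))).
  apply: ler_sum => j _; rewrite mxE; apply: le_trans (cnorm_sum _ _ _) _.
  by apply: ler_sum => k _; exact: cnormM.
rewrite exchange_big /= mulr_suml; apply: ler_sum => k _.
rewrite -mulr_sumr; apply: ler_wpM2l; first exact: cnorm_ge0.
rewrite [leRHS](bigD1 k) //= lerDl.
by do 2![apply: sumr_ge0 => ? _]; exact: cnorm_ge0.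
Qed.

(** * Derivatives of scalar and matrix-valued curves *)

Section Derivatives.
Variable R : realType.

(** Multiplied out by t - s, the definition of the derivative needs no exception at t = s and
passes through sums and norms of matrices. *)
Lemma is_derive_eps (f : R -> R) (s l : R) :
  is_derive s 1 f l <->
  (forall e, 0 < e -> \forall t \near s, `|f t - f s - l * (t - s)| <= e * `|t - s|).
Proof.
have key : is_derive s 1 f l <->
    (fun h : R => h^-1 *: (f (h *: 1 + s) - f s)) @ 0^' --> l.
  split=> [[d <-]|fl].
    exact: d.
  split; first by apply/cvg_ex; exists l.
  by apply: cvg_lim fl.
rewrite key; split => [/cvgrPdist_le fl e e0|fl].
  have := fl _ e0; rewrite /dnbhs /within /=.
  move=> /nbhs_ballP[d /= d0 hd]; apply/nbhs_ballP; exists d => //= t st.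
  have [->|ts] := eqVneq t s; first by rewrite !subrr mulr0 subr0 normr0 mulr0.
  have := hd (t - s); rewrite /ball /= sub0r normrN distrC => /(_ st).
  rewrite subr_eq0 => /(_ ts); rewrite [_ *: 1]mulr1 subrK => le_e.
  have ts0 : t - s != 0 by rewrite subr_eq0.
  rewrite (_ : f t - f s - l * (t - s) =
    - (l - (t - s)^-1 *: (f t - f s)) * (t - s)).
    by rewrite normrM normrN (distrC s t) ler_pM2r ?normr_gt0.
  by rewrite mulNr mulrBl /GRing.scale /= mulrAC mulVf // mul1r opprB.
apply/cvgrPdist_le => e e0; have := fl _ e0.
move=> /nbhs_ballP[d /= d0 hd]; rewrite /dnbhs /within /=.
apply/nbhs_ballP; exists d => //= h hh h0.
have := hd (h + s); rewrite /ball /= opprD addrCA subrr addr0 normrN.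
move: hh; rewrite /ball /= sub0r normrN => hh /(_ hh).
rewrite addrK -ler_pdivrMr ?normr_gt0 // -normfV -normrM.
by rewrite distrC [_ *: 1]mulr1 mulrBl mulrC mulfK.
Qed.

Lemma is_derive_epsd (f : R -> R) (s l : R) :
  is_derive s 1 f l <->
  (forall e, 0 < e -> exists2 d, 0 < d &
     forall t, `|t - s| < d -> `|f t - f s - l * (t - s)| <= e * `|t - s|).
Proof.
rewrite is_derive_eps; split=> fl e e0.
  have /nbhs_ballP[d /= d0 hd] := fl _ e0; exists d => // t ts.
  by apply: hd; rewrite /ball /= distrC.
have [d d0 hd] := fl _ e0; apply/nbhs_ballP; exists d => //= t.
by rewrite /ball /= distrC => /hd.
Qed.

Lemma is_derive_comp_shift (f : R -> R) (s c l : R) :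
  is_derive (s + c) 1 f l -> is_derive s 1 (fun t => f (t + c)) l.
Proof.
move=> /is_derive_epsd fl; apply/is_derive_epsd => e e0.
have [d d0 hd] := fl _ e0; exists d => // t ts.
have E : t + c - (s + c) = t - s by ring.
by have := hd (t + c); rewrite E; exact.
Qed.

Lemma is_derive_comp_opp (f : R -> R) (s l : R) :
  is_derive (- s) 1 f l -> is_derive s 1 (fun t => f (- t)) (- l).
Proof.
move=> /is_derive_epsd fl; apply/is_derive_epsd => e e0.
have [d d0 hd] := fl _ e0; exists d => // t ts.
have E : - t - - s = - (t - s) by ring.
by have := hd (- t); rewrite E normrN mulNr mulrN; exact.
Qed.

(** Comparison of increments: the mean value theorem for g - f. *)
Lemma MVT_le (f df g dg : R -> R) (a b : R) : a <= b ->
  (forall s, a <= s <= b -> is_derive s 1 f (df s)) ->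
  (forall s, a <= s <= b -> is_derive s 1 g (dg s)) ->
  (forall s, a <= s <= b -> df s <= dg s) ->
  f b - f a <= g b - g a.
Proof.
move=> ab fd gd le.
have hd : forall x, x \in `]a, b[ -> is_derive x 1 (g - f) (dg x - df x).
  move=> x; rewrite in_itv /= => /andP[/ltW ax /ltW xb].
  have := fd x; rewrite ax xb => /(_ isT) ?.
  have := gd x; rewrite ax xb => /(_ isT) ?.
  exact: is_deriveB.
have hc : {within `[a, b], continuous (g - f)}.
  apply: derivable_within_continuous => x; rewrite in_itv /= => axb.
  have ? := fd _ axb; have ? := gd _ axb.
  by apply: derivableB; apply: ex_derive.
have [c cab] := MVT_segment ab hd hc.
move=> E; have E2 : (g b - f b) - (g a - f a) = (dg c - df c) * (b - a) by [].
have : 0 <= (dg c - df c) * (b - a).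
  by rewrite mulr_ge0 ?subr_ge0 // le //; move: cab; rewrite in_itv.
by rewrite -E2; lra.
Qed.

Definition cderiv (f : R -> R[i]) (s : R) (l : R[i]) : Prop :=
  is_derive s 1 (fun t => Re (f t)) (Re l) /\ is_derive s 1 (fun t => Im (f t)) (Im l).

Lemma cderiv_cst (a : R[i]) s : cderiv (fun=> a) s 0.
Proof. by split; exact: is_derive_cst. Qed.

Lemma cderivD f g s l k : cderiv f s l -> cderiv g s k ->
  cderiv (fun t => f t + g t) s (l + k).
Proof.
move=> [? ?] [? ?]; split.
- rewrite (_ : (fun t => Re (f t + g t)) = (fun t => Re (f t)) + (fun t => Re (g t))).
    by rewrite ReD; exact: is_deriveD.
  by apply/funext => t; rewrite ReD.
- rewrite (_ : (fun t => Im (f t + g t)) = (fun t => Im (f t)) + (fun t => Im (g t))).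
    by rewrite ImD; exact: is_deriveD.
  by apply/funext => t; rewrite ImD.
Qed.

Lemma cderivM f g s l k : cderiv f s l -> cderiv g s k ->
  cderiv (fun t => f t * g t) s (l * g s + f s * k).
Proof.
move=> [? ?] [? ?]; split.
- rewrite (_ : (fun t => Re (f t * g t)) = (fun t => Re (f t)) * (fun t => Re (g t))
     - (fun t => Im (f t)) * (fun t => Im (g t))).
    apply: is_derive_eq; rewrite !ReImE /GRing.scale /=; ring.
  by apply/funext => t; rewrite ReM.
- rewrite (_ : (fun t => Im (f t * g t)) = (fun t => Re (f t)) * (fun t => Im (g t))
     + (fun t => Im (f t)) * (fun t => Re (g t))).
    apply: is_derive_eq; rewrite !ReImE /GRing.scale /=; ring.
  by apply/funext => t; rewrite ImM.
Qed.

Lemma cderiv_sum (I : Type) (r : seq I) (P : pred I) (f : I -> R -> R[i]) s l :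
  (forall i, P i -> cderiv (f i) s (l i)) ->
  cderiv (fun t => \sum_(i <- r | P i) f i t) s (\sum_(i <- r | P i) l i).
Proof.
move=> fl; elim: r => [|i r IH].
  rewrite big_nil (_ : (fun _ => _) = fun=> 0); first exact: cderiv_cst.
  by apply/funext => t; rewrite big_nil.
rewrite big_cons (_ : (fun _ => _) =
  fun t => if P i then f i t + \sum_(j <- r | P j) f j t
           else \sum_(j <- r | P j) f j t).
  by case: ifP => // Pi; apply: cderivD => //; exact: fl.
by apply/funext => t; rewrite big_cons.
Qed.

Lemma cderiv_prod (I : Type) (r : seq I) (f : I -> R -> R[i]) s :
  (forall i, exists l, cderiv (f i) s l) ->
  exists l, cderiv (fun t => \prod_(i <- r) f i t) s l.
Proof.
move=> fl; elim: r => [|i r [l IH]].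
  exists 0; rewrite (_ : (fun _ => _) = fun=> 1); first exact: cderiv_cst.
  by apply/funext => t; rewrite big_nil.
have [k fk] := fl i; eexists.
rewrite (_ : (fun _ => _) = fun t => f i t * \prod_(j <- r) f j t).
  exact: cderivM fk IH.
by apply/funext => t; rewrite big_cons.
Qed.

(** Derivative of a complex matrix-valued curve in a real variable, taken entrywise in real and
imaginary parts so that the calculus reduces to that of real functions. *)
Definition mderiv p q (Y : R -> 'M[R[i]]_(p, q)) (s : R) (L : 'M[R[i]]_(p, q)) :=
  forall i j, cderiv (fun t => Y t i j) s (L i j).

Section Mderiv.
Variables p q : nat.
Implicit Types Y Z : R -> 'M[R[i]]_(p, q).

Lemma mderiv_cst (M : 'M[R[i]]_(p, q)) s : mderiv (fun=> M) s 0.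
Proof. by move=> i j; rewrite mxE; exact: cderiv_cst. Qed.

Lemma mderivD Y Z s L K : mderiv Y s L -> mderiv Z s K ->
  mderiv (fun t => Y t + Z t) s (L + K).
Proof.
move=> YL ZK i j; rewrite mxE (_ : (fun _ => _) = fun t => Y t i j + Z t i j).
  exact: cderivD.
by apply/funext => t; rewrite mxE.
Qed.

Lemma mderiv_sum (I : Type) (r : seq I) (P : pred I) (Y : I -> R -> 'M[R[i]]_(p, q)) s L :
  (forall i, P i -> mderiv (Y i) s (L i)) ->
  mderiv (fun t => \sum_(i <- r | P i) Y i t) s (\sum_(i <- r | P i) L i).
Proof.
move=> YL i j; rewrite summxE (_ : (fun _ => _) = fun t => \sum_(k <- r | P k) Y k t i j).
  by apply: cderiv_sum => k Pk; exact: YL.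
by apply/funext => t; rewrite summxE.
Qed.

Lemma mderivZ (a : R[i]) Y s L : mderiv Y s L -> mderiv (fun t => a *: Y t) s (a *: L).
Proof.
move=> YL i j; rewrite mxE (_ : (fun _ => _) = fun t => a * Y t i j).
  rewrite -[a * L i j]add0r -(mul0r (Y s i j)).
  by apply: cderivM => //; exact: cderiv_cst.
by apply/funext => t; rewrite mxE.
Qed.

Lemma mderivB Y Z s L K : mderiv Y s L -> mderiv Z s K ->
  mderiv (fun t => Y t - Z t) s (L - K).
Proof.
move=> YL ZK; rewrite -scaleN1r (_ : (fun _ => _) = fun t => Y t + -1 *: Z t).
  by apply: mderivD => //; exact: mderivZ.
by apply/funext => t; rewrite scaleN1r.
Qed.

Lemma mderiv_shift Y s c L :
  mderiv Y (s + c) L -> mderiv (fun t => Y (t + c)) s L.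
Proof.
move=> YL i j; have [YR YI] := YL i j.
by split; apply: is_derive_comp_shift.
Qed.

Lemma mderiv_opp Y s L : mderiv Y (- s) L -> mderiv (fun t => Y (- t)) s (- L).
Proof.
move=> YL i j; have [YR YI] := YL i j; rewrite mxE.
by split; rewrite ?ReN ?ImN; exact: is_derive_comp_opp.
Qed.

Lemma mderiv_uniq Y s L K : mderiv Y s L -> mderiv Y s K -> L = K.
Proof.
move=> YL YK; apply/matrixP => i j.
have [[_ LR] [_ LI]] := YL i j; have [[_ KR] [_ KI]] := YK i j.
by apply: complex_eq; [rewrite -LR -KR|rewrite -LI -KI].
Qed.

(** Mean value inequality with a variable majorant psi' of the speed, as needed to integrate
an exponential bound; the factors come from applying the scalar case to the entries. *)
Lemma mderiv_bound Y L (psi dpsi : R -> R) a b : a <= b ->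
  (forall s, a <= s <= b -> mderiv Y s (L s)) ->
  (forall s, a <= s <= b -> is_derive s 1 psi (dpsi s)) ->
  (forall s, a <= s <= b -> mnorm (L s) <= dpsi s) ->
  mnorm (Y b - Y a) <= (p * q)%:R * (2 * (psi b - psi a)).
Proof.
move=> ab YL psid le; apply: mnorm_le_entries => i j; rewrite !mxE /cnorm ReB ImB.
have key (f df : R -> R) : (forall s, a <= s <= b -> is_derive s 1 f (df s)) ->
    (forall s, a <= s <= b -> `|df s| <= cnorm (L s i j)) ->
    `|f b - f a| <= psi b - psi a.
  move=> fd dfle; have dfle' s : a <= s <= b -> `|df s| <= dpsi s.
    move=> sab; apply: le_trans (dfle _ sab) _; apply: le_trans (le _ sab).
    exact: cnorm_le_mnorm.
  rewrite ler_norml; apply/andP; split.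
    rewrite lerNl opprB.
    have : (- f) b - (- f) a <= psi b - psi a.
      apply: (@MVT_le _ (- df) _ dpsi) => // s sab.
        by have ? := fd _ sab; exact: is_deriveN.
      by have := dfle' _ sab; rewrite ler_norml => /andP[+ _]; rewrite lerNl.
    by rewrite -[(- f) b]/(- f b) -[(- f) a]/(- f a); lra.
  apply: (@MVT_le _ df _ dpsi) => // s sab.
  by have := dfle' _ sab; rewrite ler_norml => /andP[].
have h1 := key (fun t => Re (Y t i j)) (fun t => Re (L t i j)).
have h2 := key (fun t => Im (Y t i j)) (fun t => Im (L t i j)).
rewrite mulr_natl mulr2n lerD //.
  apply: h1 => s sab; [by have [] := YL _ sab i j|exact: Re_le_cnorm].
apply: h2 => s sab; [by have [] := YL _ sab i j|exact: Im_le_cnorm].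
Qed.

Lemma mderiv0_cst Y a b : a <= b ->
  (forall s, a <= s <= b -> mderiv Y s 0) -> Y b = Y a.
Proof.
move=> ab Y0; apply/eqP; rewrite -subr_eq0; apply/eqP/mnorm_le0.
have := @mderiv_bound Y (fun=> 0) (fun=> 0) (fun=> 0) a b ab Y0.
rewrite subrr mulr0 mulr0; by apply=> s _; rewrite ?mnorm0.
Qed.

Lemma mderiv0_cstT Y : (forall s, mderiv Y s 0) -> forall a b, Y a = Y b.
Proof.
move=> Y0 a b; case: (leP a b) => [ab|/ltW ab]; last exact: mderiv0_cst.
by apply/esym; apply: mderiv0_cst.
Qed.

End Mderiv.

Lemma mderivM p q r (Y : R -> 'M[R[i]]_(p, q)) (Z : R -> 'M[R[i]]_(q, r)) s L K :
  mderiv Y s L -> mderiv Z s K ->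
  mderiv (fun t => Y t *m Z t) s (L *m Z s + Y s *m K).
Proof.
move=> YL ZK i j; rewrite !mxE -big_split /=.
rewrite (_ : (fun _ => _) = fun t => \sum_k Y t i k * Z t k j).
  by apply: cderiv_sum => k _; exact: cderivM.
by apply/funext => t; rewrite mxE.
Qed.

Lemma mderivMl p q r (M : 'M[R[i]]_(p, q)) (Z : R -> 'M[R[i]]_(q, r)) s K :
  mderiv Z s K -> mderiv (fun t => M *m Z t) s (M *m K).
Proof.
move=> ZK; have := mderivM (mderiv_cst M s) ZK.
by rewrite mul0mx add0r.
Qed.

Lemma mderivMr p q r (Y : R -> 'M[R[i]]_(p, q)) (M : 'M[R[i]]_(q, r)) s L :
  mderiv Y s L -> mderiv (fun t => Y t *m M) s (L *m M).
Proof.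
move=> YL; have := mderivM YL (mderiv_cst M s).
by rewrite mulmx0 addr0.
Qed.

End Derivatives.

(** * Comparison of the l^1 norm with the maximum norm *)

Section NormComparison.
Variable R : realType.

Lemma norm_le_cnorm (x : R[i]) : `|x| <= (cnorm x)%:C.
Proof.
rewrite normc_def lecR /cnorm -[leRHS]ger0_norm ?addr_ge0 // -sqrtr_sqr.
apply: ler_wsqrtr; rewrite sqrrD -!normrX !(ger0_norm (sqr_ge0 _)).
have : 0 <= `|Re x| * `|Im x| by rewrite mulr_ge0.
by rewrite mulr2n; lra.
Qed.

Lemma cnorm_le_norm (x : R[i]) : (cnorm x)%:C <= 2 * `|x|.
Proof.
rewrite normc_def (_ : 2 = 2%:C); last first.
  by apply: complex_eq; rewrite /= ?addr0.
rewrite -rmorphM /= lecR /cnorm mulr_natl mulr2n.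
by rewrite lerD // -sqrtr_sqr; apply: ler_wsqrtr; rewrite ?lerDl ?lerDr sqr_ge0.
Qed.

Lemma norm_real (x : R[i]) : exists2 r : R, 0 <= r & `|x| = r%:C.
Proof. by rewrite normc_def; eexists; last reflexivity; exact: sqrtr_ge0. Qed.

Lemma mx_norm_le (K : numDomainType) p q (M : 'M[K]_(p, q)) (c : K) :
  0 <= c -> (forall i j, `|M i j| <= c) -> `|M| <= c.
Proof.
move=> c0 Mc; rewrite -[`|M|]/(mx_norm M); have [->//|/mx_norm_neq0[ij ->]] := eqVneq (mx_norm M) 0.
exact: Mc.
Qed.

Lemma mx_norm_entry (K : numDomainType) p q (M : 'M[K]_(p, q)) i j : `|M i j| <= `|M|.
Proof.
rewrite -[`|M|]/(mx_norm M) mx_normE -[leLHS]nngE num_le.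
exact: (le_bigmax _ (fun ij : 'I_p * 'I_q => `|M ij.1 ij.2|%:nng) (i, j)).
Qed.

Lemma natC n : n%:R = (n%:R)%:C :> R[i].
Proof. by rewrite rmorph_nat. Qed.

Variables p q : nat.
Implicit Types M : 'M[R[i]]_(p, q).

Lemma norm_le_mnorm M : `|M| <= (mnorm M)%:C.
Proof.
apply: mx_norm_le => [|i j]; first by rewrite ler0c mnorm_ge0.
by apply: le_trans (norm_le_cnorm _) _; rewrite lecR cnorm_le_mnorm.
Qed.

Lemma mnorm_le_norm M : (mnorm M)%:C <= (2 * (p * q)%:R) * `|M|.
Proof.
have [r r0 rE] : exists2 r : R, 0 <= r & `|M| = r%:C.
  rewrite -[`|M|]/(mx_norm M); have [->|/mx_norm_neq0[ij ->]] := eqVneq (mx_norm M) 0.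
    by exists 0.
  exact: norm_real.
rewrite rE (_ : 2 * (p * q)%:R = (2 * (p * q)%:R)%:C); last first.
  by rewrite [in LHS](natC 2) [in LHS](natC (p * q)) -rmorphM.
rewrite -rmorphM /= lecR.
have -> : 2 * (p * q)%:R * r = (p * q)%:R * (2 * r) by rewrite mulrA [2 * _]mulrC.
apply: mnorm_le_entries => i j.
rewrite -lecR; apply: le_trans (cnorm_le_norm _) _; rewrite rmorphM /= -rE.
rewrite (_ : 2%:C = 2 :> R[i]); last by rewrite -natC.
by rewrite ler_pM2l ?mx_norm_entry.
Qed.

Lemma cvg_mnormP (T : Type) (F : set_system T) {FF : Filter F}
    (Y : T -> 'M[R[i]]_(p, q)) (L : 'M[R[i]]_(p, q)) :
  Y @ F --> L <-> (forall e, 0 < e -> \forall t \near F, mnorm (Y t - L) <= e).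
Proof.
split=> [/cvgrPdist_le YL e e0|YL].
  pose k : R := 2 * (p * q)%:R + 1.
  have k0 : 0 < k by rewrite ltr_wpDl // mulr_ge0.
  have := YL (e / k)%:C; rewrite ltcR divr_gt0 // => /(_ isT); apply: filterS => t.
  rewrite distrC => h; rewrite -lecR; apply: le_trans (mnorm_le_norm _) _.
  apply: le_trans (ler_wpM2l _ h) _; first by rewrite mulr_ge0.
  rewrite (_ : 2 * (p * q)%:R = (2 * (p * q)%:R)%:C :> R[i]); last first.
    by rewrite [in LHS](natC 2) [in LHS](natC (p * q)) -rmorphM.
  rewrite -rmorphM /= lecR mulrCA ger_pMr // ler_pdivrMr // mul1r /k; lra.
apply/cvgrPdist_le => e e0; have eE : e = (Re e)%:C.
  by apply: complex_eq => //=; exact: ger0_Im (ltW e0).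
have := YL (Re e); rewrite -ltcR -eE => /(_ e0); apply: filterS => t h.
rewrite distrC; apply: le_trans (norm_le_mnorm _) _; by rewrite eE lecR.
Qed.

End NormComparison.

(** * The matrix exponential *)

Section CurveLimits.
Variable R : realType.

Lemma cvg_mx_hausdorff p q : hausdorff_space 'M[R[i]]_(p, q).
Proof. exact: norm_hausdorff. Qed.

Lemma cvg_mulmxr (T : Type) (F : set_system T) {FF : Filter F} p q r
    (Y : T -> 'M[R[i]]_(p, q)) (L : 'M[R[i]]_(p, q)) (M : 'M[R[i]]_(q, r)) :
  Y @ F --> L -> (fun t => Y t *m M) @ F --> L *m M.
Proof.
move=> /cvg_mnormP YL; apply/cvg_mnormP => e e0.
have k0 : 0 < mnorm M + 1 by rewrite ltr_wpDl ?mnorm_ge0.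
have := YL _ (divr_gt0 e0 k0); apply: filterS => t h.
rewrite -mulmxBl; apply: le_trans (mnormM _ _) _.
apply: le_trans (ler_wpM2r (mnorm_ge0 _) h) _.
rewrite mulrAC -mulrA ger_pMr // ler_pdivrMr // mul1r; lra.
Qed.

Lemma cvg_mulmxl (T : Type) (F : set_system T) {FF : Filter F} p q r
    (M : 'M[R[i]]_(p, q)) (Y : T -> 'M[R[i]]_(q, r)) (L : 'M[R[i]]_(q, r)) :
  Y @ F --> L -> (fun t => M *m Y t) @ F --> M *m L.
Proof.
move=> /cvg_mnormP YL; apply/cvg_mnormP => e e0.
have k0 : 0 < mnorm M + 1 by rewrite ltr_wpDl ?mnorm_ge0.
have := YL _ (divr_gt0 e0 k0); apply: filterS => t h.
rewrite -mulmxBr; apply: le_trans (mnormM _ _) _.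
apply: le_trans (ler_wpM2l (mnorm_ge0 _) h) _.
rewrite mulrA mulrAC ger_pMl // ler_pdivrMr // mul1r; lra.
Qed.

Lemma cvg_mx_unique (T : Type) (F : set_system T) {FF : ProperFilter F} p q
    (Y : T -> 'M[R[i]]_(p, q)) (L K : 'M[R[i]]_(p, q)) :
  Y @ F --> L -> Y @ F --> K -> L = K.
Proof. move=> YL YK; exact: (cvg_unique (@cvg_mx_hausdorff _ _) YL YK). Qed.

Lemma cvg_mx_entries (T : Type) (F : set_system T) {FF : Filter F} p q
    (Y : T -> 'M[R[i]]_(p, q)) (L : 'M[R[i]]_(p, q)) :
  (forall i j, (fun t => Re (Y t i j)) @ F --> Re (L i j)) ->
  (forall i j, (fun t => Im (Y t i j)) @ F --> Im (L i j)) ->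
  Y @ F --> L.
Proof.
move=> YR YI; apply/cvg_mnormP => e e0.
pose k : R := (p * q)%:R * 2 + 1.
have k0 : 0 < k by rewrite ltr_wpDl // mulr_ge0.
have ek0 := divr_gt0 e0 k0.
have H : \forall t \near F, forall ij : 'I_p * 'I_q,
    cnorm ((Y t - L) ij.1 ij.2) <= 2 * (e / k).
  apply: filter_forall => -[i j] /=.
  have /cvgrPdist_le/(_ _ ek0) hR := YR i j.
  have /cvgrPdist_le/(_ _ ek0) hI := YI i j.
  apply: filterS2 hR hI => t; rewrite !mxE /cnorm ReB ImB => hR hI.
  by rewrite mulr_natl mulr2n lerD // distrC.
apply: filterS H => t h; apply: (le_trans (mnorm_le_entries (c := 2 * (e / k)) _)).
  by move=> i j; exact: (h (i, j)).
rewrite !mulrA mulrAC -[_ * e]mulrC -mulrA ger_pMr //.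
rewrite mulrA ler_pdivrMr // mul1r /k; lra.
Qed.

End CurveLimits.

Lemma mx_exprZ (K : comPzRingType) N (a : K) (B : 'M[K]_N) j :
  (a *: B) ^+ j = a ^+ j *: B ^+ j.
Proof.
elim: j => [|j IH]; first by rewrite !expr0 scale1r.
by rewrite !exprS IH -!mulmxE -scalemxAl -scalemxAr scalerA.
Qed.

(** The exponential e^(sB); it is locked to keep unification from unfolding the defining
series whenever two exponentials are compared. *)
HB.lock Definition mexp (R : realType) (N : nat) (B : 'M[R[i]]_N) (s : R) : 'M[R[i]]_N :=
  expmx (s%:C *: B).

Lemma mexpE (R : realType) (N : nat) (B : 'M[R[i]]_N) s : mexp B s = expmx (s%:C *: B).
Proof. by rewrite mexp.unlock. Qed.

Section Exponential.
Variables (R : realType) (N : nat) (B : 'M[R[i]]_N).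

Lemma cvg_exp_type_pseries (c : nat -> R) (C K : R) :
  0 <= C -> 0 <= K -> (forall j, `|c j| <= C * (K ^+ j / j`!%:R)) ->
  forall x, cvgn (pseries c x).
Proof.
move=> C0 K0 cK x; apply: normed_cvg.
apply: (@series_le_cvg _ _ (fun j => C * exp_coeff (K * `|x|) j)).
- by move=> n; exact: normr_ge0.
- by move=> n; rewrite mulr_ge0 // exp_coeff_ge0 // mulr_ge0.
- move=> n; rewrite /exp_coeff /= normrM normrX exprMn.
  by rewrite [X in _ <= C * X]mulrAC mulrA ler_wpM2r ?exprn_ge0.
- by rewrite seriesZ; apply: is_cvgMr; exact: is_cvg_series_exp_coeff.
Qed.

(** The coefficients of the power series in s of the entries of e^(sB) D. For the real and the
imaginary part of each entry, termwise differentiation of scalar power series applies; the extra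
factor D lets the derivative, which is the family of B D, stay in the same class. *)
Definition exp_entry_coef (f : R[i] -> R) (D : 'M[R[i]]_N) (i l : 'I_N) (j : nat) : R :=
  (j`!%:R)^-1 * f ((B ^+ j *m D) i l).

Definition exp_entries (D : 'M[R[i]]_N) (s : R) : 'M[R[i]]_N :=
  \matrix_(i, l) (limn (pseries (exp_entry_coef (@Re R) D i l) s) +i*
                  limn (pseries (exp_entry_coef (@Im R) D i l) s)).

Lemma mnormX j : mnorm (B ^+ j) <= mnorm (1 : 'M[R[i]]_N) * mnorm B ^+ j.
Proof.
elim: j => [|j IH]; first by rewrite !expr0 mulr1.
rewrite exprSr [_ * _ in leLHS]/(_ *m _) exprSr mulrA.
by apply: le_trans (mnormM _ _) _; rewrite ler_wpM2r ?mnorm_ge0.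
Qed.

Lemma exp_entry_cvg (f : R[i] -> R) D i l (s : R) :
  (forall x, `|f x| <= cnorm x) -> cvgn (pseries (exp_entry_coef f D i l) s).
Proof.
move=> fle.
apply: (@cvg_exp_type_pseries _ (mnorm (1 : 'M[R[i]]_N) * mnorm D) (mnorm B)).
- by rewrite mulr_ge0 ?mnorm_ge0.
- exact: mnorm_ge0.
move=> j; rewrite /exp_entry_coef normrM ger0_norm ?invr_ge0 //.
rewrite mulrA [leRHS]mulrC ler_wpM2l ?invr_ge0 //.
apply: le_trans (fle _) _; apply: le_trans (cnorm_le_mnorm _ _ _) _.
apply: le_trans (mnormM _ _) _; rewrite mulrAC ler_wpM2r ?mnorm_ge0 //.
exact: mnormX.
Qed.

Lemma exp_entry_diffs (f : R[i] -> R) D i l :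
  pseries_diffs (exp_entry_coef f D i l) = exp_entry_coef f (B *m D) i l.
Proof.
apply/funext => j; rewrite /pseries_diffs /exp_entry_coef mulrA; congr (_ * _).
  by rewrite factS natrM invfM mulrA divff ?mul1r // pnatr_eq0.
by rewrite exprSr mulmxA.
Qed.

Lemma exp_entry_derive (f : R[i] -> R) D i l (s : R) :
  (forall x, `|f x| <= cnorm x) ->
  is_derive s 1 (fun t => limn (pseries (exp_entry_coef f D i l) t))
    (limn (pseries (exp_entry_coef f (B *m D) i l) s)).
Proof.
move=> fle; rewrite -exp_entry_diffs.
apply: (@pseries_snd_diffs _ _ (`|s| + 1)).
- exact: exp_entry_cvg.
- by rewrite exp_entry_diffs; exact: exp_entry_cvg.
- by rewrite !exp_entry_diffs; exact: exp_entry_cvg.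
- by rewrite [ltRHS]ger0_norm ?addr_ge0 // ltrDl.
Qed.

Lemma exp_entries_derive D s : mderiv (exp_entries D) s (exp_entries (B *m D) s).
Proof.
move=> i l; rewrite mxE; split=> /=.
- rewrite (_ : (fun _ => _) = (fun t => limn (pseries (exp_entry_coef (@Re R) D i l) t))).
    by apply: exp_entry_derive => x; exact: Re_le_cnorm.
  by apply/funext => t; rewrite mxE.
- rewrite (_ : (fun _ => _) = (fun t => limn (pseries (exp_entry_coef (@Im R) D i l) t))).
    by apply: exp_entry_derive => x; exact: Im_le_cnorm.
  by apply/funext => t; rewrite mxE.
Qed.

Let part (s : R) (n : nat) : 'M[R[i]]_N :=
  series (fun j => (j`!%:R)^-1 *: (s%:C *: B) ^+ j) n.

Lemma partE s n (D : 'M[R[i]]_N) i l : (part s n *m D) i l =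
  \sum_(0 <= j < n) ((j`!%:R)^-1 * s ^+ j)%:C * (B ^+ j *m D) i l.
Proof.
rewrite /part /series /= mulmx_suml summxE; apply: eq_bigr => j _.
rewrite mx_exprZ scalerA -scalemxAl mxE; congr (_ * _).
by rewrite natC rmorphM rmorphXn /= fmorphV.
Qed.

Lemma part_cvg (D : 'M[R[i]]_N) s : (fun n => part s n *m D) @ \oo --> exp_entries D s.
Proof.
apply: cvg_mx_entries => i l; rewrite mxE /=.
- rewrite (_ : (fun _ => _) = pseries (exp_entry_coef (@Re R) D i l) s).
    by apply: exp_entry_cvg => x; exact: Re_le_cnorm.
  apply/funext => n; rewrite partE Re_sum; apply: eq_bigr => j _.
  by rewrite ReZ /exp_entry_coef mulrAC.
- rewrite (_ : (fun _ => _) = pseries (exp_entry_coef (@Im R) D i l) s).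
    by apply: exp_entry_cvg => x; exact: Im_le_cnorm.
  apply/funext => n; rewrite partE Im_sum; apply: eq_bigr => j _.
  by rewrite ImZ /exp_entry_coef mulrAC.
Qed.

Local Notation mexp := (mexp B).

Lemma mexp_cvg s : part s @ \oo --> mexp s.
Proof.
have h : part s @ \oo --> exp_entries 1%:M s.
  have := @part_cvg 1%:M s.
  by under eq_fun do rewrite mulmx1.
rewrite mexpE /expmx -[X in limn X]/(part s).
by rewrite (cvg_lim (@cvg_mx_hausdorff _ _ _) h).
Qed.

Lemma exp_entriesE D s : exp_entries D s = mexp s *m D.
Proof.
apply: (cvg_mx_unique (@part_cvg D s)).
by apply: cvg_mulmxr; exact: mexp_cvg.
Qed.

Lemma mexp_comm s : B *m mexp s = mexp s *m B.
Proof.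
rewrite -exp_entriesE; apply/esym; apply: (cvg_mx_unique (@part_cvg B s)).
rewrite (_ : (fun _ => _) = (fun n => B *m part s n)).
  by apply: cvg_mulmxl; exact: mexp_cvg.
apply/funext => n; rewrite mulmx_suml mulmx_sumr; apply: eq_bigr => j _.
rewrite -scalemxAl -scalemxAr mx_exprZ -scalemxAl -scalemxAr; congr (_ *: (_ *: _)).
by rewrite -[LHS]/(B ^+ j * B) -[RHS]/(B * B ^+ j) -exprSr exprS.
Qed.

Lemma mexp_deriv s : mderiv mexp s (B *m mexp s).
Proof.
have h := @exp_entries_derive 1%:M s; rewrite mexp_comm -exp_entriesE.
rewrite mulmx1 in h; rewrite (_ : mexp = exp_entries 1%:M) //.
by apply/funext => t; rewrite exp_entriesE mulmx1.
Qed.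

Lemma mexp0 : mexp 0 = 1%:M.
Proof.
apply: (cvg_mx_unique (@mexp_cvg 0)).
apply/cvg_mnormP => e e0; exists 1%N => // n /= n0.
rewrite (_ : part 0 n = 1%:M) ?subrr ?mnorm0 ?ltW //.
rewrite /part /series /= -(prednK n0) big_nat_recl //= big1 ?addr0.
  by rewrite expr0 fact0 invr1 scale1r.
by move=> j _; rewrite scale0r exprS mul0r scaler0.
Qed.

Lemma mexpN_deriv s : mderiv (fun t => mexp (- t)) s (- (mexp (- s) *m B)).
Proof. by rewrite -mexp_comm; apply: mderiv_opp; exact: mexp_deriv. Qed.

Lemma mexpNK s : mexp (- s) *m mexp s = 1%:M.
Proof.
have h t : mderiv (fun t => mexp (- t) *m mexp t) t 0.
  have := mderivM (mexpN_deriv t) (mexp_deriv t).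
  by rewrite mulNmx -!mulmxA addNr.
by rewrite (mderiv0_cstT h s 0) oppr0 mexp0 mulmx1.
Qed.

Lemma mexpKN s : mexp s *m mexp (- s) = 1%:M.
Proof. by have := mexpNK (- s); rewrite opprK. Qed.

(** A solution Y of Y' = BY makes e^(-sB) Y(s) constant. *)
Lemma linear_ode_uniq_itv q (Y : R -> 'M[R[i]]_(N, q)) (a b : R) : a <= b ->
  (forall s, a <= s <= b -> mderiv Y s (B *m Y s)) ->
  mexp (- b) *m Y b = mexp (- a) *m Y a.
Proof.
move=> ab Y'.
apply: (@mderiv0_cst R N q (fun s => mexp (- s) *m Y s) a b ab) => s sab.
have := mderivM (mexpN_deriv s) (Y' s sab).
by rewrite mulNmx -!mulmxA addNr.
Qed.

Lemma linear_ode_uniq q (Y : R -> 'M[R[i]]_(N, q)) :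
  (forall s, mderiv Y s (B *m Y s)) -> forall s, Y s = mexp s *m Y 0.
Proof.
move=> Y' s.
have h t : mderiv (fun t => mexp (- t) *m Y t) t 0.
  have := mderivM (mexpN_deriv t) (Y' t).
  by rewrite mulNmx -!mulmxA addNr.
have := mderiv0_cstT h s 0; rewrite oppr0 mexp0 mul1mx => <-.
by rewrite mulmxA mexpKN mul1mx.
Qed.

(** Both sides solve Y' = BY in s, with the same value at 0. *)
Lemma mexpD s t : mexp (s + t) = mexp s *m mexp t.
Proof.
have h u : mderiv (fun u => mexp (u + t)) u (B *m mexp (u + t)).
  by apply: mderiv_shift; exact: mexp_deriv.
by rewrite (linear_ode_uniq h s) add0r.
Qed.

(** Uniqueness again: P e^(sB) solves Y' = BY with initial value P. *)
Lemma mexp_commute (P : 'M[R[i]]_N) s : P *m B = B *m P -> P *m mexp s = mexp s *m P.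
Proof.
move=> PB; have h t : mderiv (fun t => P *m mexp t) t (B *m (P *m mexp t)).
  by rewrite mulmxA -PB -mulmxA; apply: mderivMl; exact: mexp_deriv.
by rewrite (linear_ode_uniq h s) mexp0 mulmx1.
Qed.

End Exponential.

(** * The invariant splitting *)

Section CoprimeKernels.
Variables (K : fieldType) (N : nat) (T : 'M[K]_N).

Definition shift_prod (s : seq (K * nat)) : 'M[K]_N :=
  \prod_(x <- s) (T - x.1%:M) ^+ x.2.

Lemma comm_shift (l : K) : GRing.comm T (T - l%:M).
Proof. by apply: commrB => //; rewrite /GRing.comm -!mulmxE scalar_mxC. Qed.

Lemma comm_shift_shift (l l' : K) : GRing.comm (T - l%:M) (T - l'%:M).
Proof.
apply: commrB; first exact/commr_sym/comm_shift.
by rewrite /GRing.comm -!mulmxE scalar_mxC.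
Qed.

Lemma comm_shift_prod (M : 'M[K]_N) (s : seq (K * nat)) :
  (forall l, GRing.comm M (T - l%:M)) -> GRing.comm M (shift_prod s).
Proof. by move=> MT; apply: commr_prod => x _; apply: commrX. Qed.

Lemma shift_prod_eigen (s : seq (K * nat)) (l : K) (v : 'cV[K]_N) :
  (T - l%:M) *m v = 0 ->
  shift_prod s *m v = (\prod_(x <- s) (l - x.1) ^+ x.2) *: v.
Proof.
move=> Tv; rewrite /shift_prod; elim: s => [|x s IH].
  by rewrite !big_nil mul1mx scale1r.
rewrite !big_cons -mulmxE -mulmxA IH -scalemxAr -scalerA scalerA mulrC -scalerA.
congr (_ *: _); elim: x.2 => [|p IHp]; first by rewrite !expr0 mul1mx scale1r.
rewrite exprSr -mulmxE -mulmxA (_ : (T - x.1%:M) *m v = (l - x.1) *: v).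
  by rewrite -scalemxAr IHp scalerA exprS.
move: Tv; rewrite !mulmxBl !mul_scalar_mx scalerBl => /eqP; rewrite subr_eq0 => /eqP ->.
by [].
Qed.

(** On an eigenvector for l the product acts as a nonzero scalar, and the last nonzero vector
among the (T - l)^j v is one. *)
Lemma shift_prod_inj (s : seq (K * nat)) (l : K) (p : nat) (v : 'cV[K]_N) :
  all (fun x => x.1 != l) s -> (T - l%:M) ^+ p *m v = 0 -> shift_prod s *m v = 0 ->
  v = 0.
Proof.
move=> sl; elim: p v => [|p IH] v; first by rewrite expr0 mul1mx.
rewrite exprS -mulmxE -mulmxA => Tv sv; apply: IH => //.
have := shift_prod_eigen s Tv; rewrite mulmxA mulmxE.
have -> : shift_prod s * (T - l%:M) ^+ p = (T - l%:M) ^+ p * shift_prod s.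
  by apply/commr_sym/comm_shift_prod => l'; apply/commr_sym/commrX/comm_shift_shift.
rewrite -mulmxE -mulmxA sv mulmx0 => /esym/eqP; rewrite scaler_eq0 => /orP[|/eqP//].
rewrite prodf_seq_eq0 => /hasP[x xs] /=; rewrite expf_eq0 subr_eq0 eq_sym.
by have /allP/(_ _ xs)/negPf -> := sl; rewrite andbF.
Qed.

(** Two coprime polynomials in T, given by their roots: by [shift_prod_inj] the factors of the
first are cancelled one at a time, without a Bezout relation. *)
Lemma shift_prod_coprime (s s' : seq (K * nat)) (v : 'cV[K]_N) :
  (forall x y, x \in s -> y \in s' -> x.1 != y.1) ->
  shift_prod s *m v = 0 -> shift_prod s' *m v = 0 -> v = 0.
Proof.
move=> ss'; elim: s ss' => [|x s IH] ss' sv s'v.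
  by move: sv; rewrite /shift_prod big_nil mul1mx.
apply: IH => // [y z ys zs'|]; first by apply: ss' => //; rewrite inE ys orbT.
move: sv; rewrite /shift_prod big_cons -mulmxE -mulmxA -/(shift_prod s) => sv.
apply: (@shift_prod_inj s' x.1 x.2) => //.
  by apply/allP => y ys'; rewrite eq_sym; apply: ss' => //; rewrite inE eqxx.
rewrite mulmxA mulmxE.
have -> : shift_prod s' * shift_prod s = shift_prod s * shift_prod s'.
  apply: comm_shift_prod => l; apply/commr_sym/comm_shift_prod => l'.
  exact: comm_shift_shift.
by rewrite -mulmxE -mulmxA s'v mulmx0.
Qed.

Lemma shift_prod_kill (s : seq (K * nat)) x (v : 'cV[K]_N) :
  x \in s -> (T - x.1%:M) ^+ x.2 *m v = 0 -> shift_prod s *m v = 0.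
Proof.
move=> xs xv; rewrite /shift_prod; elim: s xs => // y s IH; rewrite inE big_cons.
case/orP => [/eqP <-|xs]; last by rewrite -mulmxE -mulmxA IH // mulmx0.
have -> : (T - x.1%:M) ^+ x.2 * shift_prod s = shift_prod s * (T - x.1%:M) ^+ x.2.
  by apply: comm_shift_prod => l; apply/commr_sym/commrX/comm_shift_shift.
by rewrite -mulmxE -mulmxA xv mulmx0.
Qed.

Lemma shift_prod_commute (P : 'M[K]_N) (s : seq (K * nat)) (v : 'cV[K]_N) :
  P *m T = T *m P -> shift_prod s *m (P *m v) = P *m (shift_prod s *m v).
Proof.
move=> PT; rewrite (mulmxA _ P) (mulmxA P); congr (_ *m _); apply/esym.
apply: comm_shift_prod => l; apply: commrB; rewrite /GRing.comm -!mulmxE //.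
by rewrite scalar_mxC.
Qed.

End CoprimeKernels.

Section Splitting.
Variables (R : realType) (N m : nat) (A : 'M[R]_N) (beta : nat -> R[i])
  (e : nat -> 'cV[R[i]]_N).
Hypothesis spectrum : spectral_data A beta e.
Hypotheses (m_ge1 : (1 <= m)%N) (m_ltN : (m < N)%N).
Hypothesis spectral_gap : Re (beta m.+1) < Re (beta m).

Local Notation E := (basis_mx e).
Local Notation Ec := (Ec e m).
Local Notation Es := (Es e m).
Local Notation Pic := (Pic e m).
Local Notation Pis := (Pis e m).
Local Notation T := (cplx A).

Lemma Re_beta_le i j : (1 <= i)%N -> (i <= j)%N -> (j <= N)%N -> Re (beta j) <= Re (beta i).
Proof.
move=> i1; rewrite leq_eqVlt => /orP[/eqP-> //|ij jN].
by case: (spectral_order spectrum i1 ij jN) => [/ltW //|[-> _]].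
Qed.

Lemma Re_beta_c j : (1 <= j <= m)%N -> Re (beta m) <= Re (beta j).
Proof. by move=> /andP[? ?]; apply: Re_beta_le => //; exact: ltnW. Qed.

Lemma Re_beta_s j : (m < j <= N)%N -> Re (beta j) <= Re (beta m.+1).
Proof. by move=> /andP[? ?]; apply: Re_beta_le. Qed.

Lemma basis_delta (j : 'I_N) : E *m delta_mx j 0 = e j.+1.
Proof. by rewrite -colE; apply/matrixP => i k; rewrite !mxE ord1. Qed.

Lemma basis_coords (v : 'cV[R[i]]_N) : E *m v = \sum_(j < N) v j 0 *: e j.+1.
Proof.
rewrite [in LHS](matrix_sum_delta v) mulmx_sumr; apply: eq_bigr => j _.
by rewrite big_ord1 -scalemxAr basis_delta.
Qed.

Lemma Pic_e (j : 'I_N) : Pic *m e j.+1 = (j < m)%:R *: e j.+1.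
Proof.
rewrite -basis_delta /Defs.Pic -!mulmxA (mulmxA (invmx _)) mulVmx ?(spectral_basis spectrum) //.
rewrite mul1mx scalemxAr; congr (_ *m _); apply/matrixP => i k; rewrite !mxE.
rewrite (bigD1 j) //= big1 => [|l lj]; last by rewrite !mxE (negPf lj) mulr0.
rewrite !mxE eqxx ord1 /= !mulr1 addr0 eqxx andbT -val_eqE /=.
by case: eqP => [->|_]; rewrite ?mulr1 ?mulr0.
Qed.

Lemma Pic_sum (v : 'cV[R[i]]_N) : Pic *m v = \sum_(j < N | (j < m)%N) (invmx E *m v) j 0 *: e j.+1.
Proof.
have {1}-> : v = E *m (invmx E *m v) by rewrite mulmxA mulmxV ?mul1mx ?(spectral_basis spectrum).
rewrite basis_coords mulmx_sumr [RHS]big_mkcond; apply: eq_bigr => j _.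
by rewrite -scalemxAr Pic_e; case: (j < m)%N; rewrite ?scale1r // scale0r scaler0.
Qed.

Lemma Pis_sum (v : 'cV[R[i]]_N) : Pis *m v = \sum_(j < N | (m <= j)%N) (invmx E *m v) j 0 *: e j.+1.
Proof.
rewrite mulmxBl mul1mx Pic_sum.
have {1}-> : v = E *m (invmx E *m v) by rewrite mulmxA mulmxV ?mul1mx ?(spectral_basis spectrum).
rewrite basis_coords (bigID (fun j : 'I_N => (j < m)%N)) /= addrAC subrr add0r.
by apply: eq_bigl => j; rewrite -leqNgt.
Qed.

Lemma EcP z : Ec z <-> Pic *m z = z.
Proof.
split=> [[c ->]|Pz].
  rewrite mulmx_sumr; apply: eq_big_nat => -[//|j] /andP[_ jm].
  rewrite ltnS in jm; have jN : (j < N)%N := leq_trans jm (ltnW m_ltN).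
  by rewrite -scalemxAr (Pic_e (Ordinal jN)) /= jm scale1r.
exists (fun k => if insub k.-1 is Some i then (invmx E *m z) i 0 else 0).
rewrite -[LHS]Pz Pic_sum big_add1 /= big_mkord.
rewrite [RHS](big_ord_widen N (fun j => (if insub j is Some i then (invmx E *m z) i 0 else 0) *: e j.+1)) ?(ltnW m_ltN) //.
by apply: eq_bigr => j _; rewrite valK.
Qed.

Lemma EsP z : Es z <-> Pis *m z = z.
Proof.
split=> [[c ->]|Pz].
  rewrite mulmx_sumr; apply: eq_big_nat => -[//|j] /andP[mj jN]; rewrite ltnS in jN.
  rewrite -scalemxAr mulmxBl mul1mx (Pic_e (Ordinal jN)) /=.
  by rewrite ltnNge -ltnS mj scale0r subr0.
exists (fun k => if insub k.-1 is Some i then (invmx E *m z) i 0 else 0).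
rewrite -[LHS]Pz Pis_sum big_add1 /= (big_nat_widenl _ 0) // big_mkord.
by apply: eq_bigr => j _; rewrite valK.
Qed.

Lemma Pic_idem : Pic *m Pic = Pic.
Proof.
rewrite /Defs.Pic -!mulmxA (mulmxA (invmx _)) mulVmx ?(spectral_basis spectrum) // mul1mx.
by congr (_ *m _); rewrite mulmxA pid_mx_id // ltnW.
Qed.

Lemma Pis_Pic : Pis *m Pic = 0.
Proof. by rewrite mulmxBl mul1mx Pic_idem subrr. Qed.
Lemma Pis_idem : Pis *m Pis = Pis.
Proof. by rewrite {2}/Defs.Pis mulmxBr mulmx1 Pis_Pic subr0. Qed.

Lemma Ec_Pis z : Ec z <-> Pis *m z = 0.
Proof.
rewrite EcP mulmxBl mul1mx; split=> [->|/eqP]; first by rewrite subrr.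
by rewrite subr_eq0 => /eqP.
Qed.
Lemma Es_Pic z : Es z <-> Pic *m z = 0.
Proof.
rewrite EsP mulmxBl mul1mx; split=> [h|->]; last by rewrite subr0.
by apply/eqP; rewrite -oppr_eq0 -(inj_eq (addrI z)) h addr0.
Qed.
Lemma Ec_im z : Ec (Pic *m z).
Proof. by apply/EcP; rewrite mulmxA Pic_idem. Qed.
Lemma Es_im z : Es (Pis *m z).
Proof. by apply/EsP; rewrite mulmxA Pis_idem. Qed.

(** The roots of each polynomial lie on one side of the gap; so, by coprimality, Ec and Es are
the full kernels of these polynomials, which identifies them independently of the basis. *)
Lemma splitting_annihilators : exists sc ss : seq (R[i] * nat),
  [/\ forall x, x \in sc -> Re (beta m) <= Re x.1,
      forall x, x \in ss -> Re x.1 <= Re (beta m.+1),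
      forall z, Ec z -> shift_prod T sc *m z = 0 &
      forall z, Es z -> shift_prod T ss *m z = 0].
Proof.
have /boolp.choice[p pP] : forall j, exists p, (1 <= j <= N)%N -> (T - (beta j)%:M) ^+ p *m e j = 0.
  move=> j; have [jN|//] := boolP (1 <= j <= N)%N; last by exists 0.
  by have [p pe] := spectral_gen_eigenvectors spectrum jN; exists p.
exists [seq (beta j, p j) | j <- index_iota 1 m.+1].
exists [seq (beta j, p j) | j <- index_iota m.+1 N.+1]; split.
- by move=> x /mapP[j]; rewrite mem_index_iota ltnS => jm -> /=; exact: Re_beta_c.
- by move=> x /mapP[j]; rewrite mem_index_iota ltnS => jm -> /=; exact: Re_beta_s.
- move=> z [c ->]; rewrite mulmx_sumr big_nat_cond big1 // => j /andP[jm _].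
  rewrite -scalemxAr (@shift_prod_kill _ _ _ _ (beta j, p j)) ?scaler0 //.
    by apply/mapP; exists j => //; rewrite mem_index_iota.
  apply: pP; move: jm => /andP[-> +] /=; rewrite ltnS => jm; exact: leq_trans jm (ltnW m_ltN).
- move=> z [c ->]; rewrite mulmx_sumr big_nat_cond big1 // => j /andP[jm _].
  rewrite -scalemxAr (@shift_prod_kill _ _ _ _ (beta j, p j)) ?scaler0 //.
    by apply/mapP; exists j => //; rewrite mem_index_iota.
  by apply: pP; move: jm => /andP[/ltnW jm]; rewrite ltnS => ->; rewrite andbT (leq_trans _ jm).
Qed.

Lemma gap_neq (x y : R[i]) : Re (beta m) <= Re x -> Re y <= Re (beta m.+1) -> x != y.
Proof.
move=> bx yb; apply/eqP => xy; move: bx; rewrite xy leNgt => /negP; apply.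
exact: le_lt_trans yb spectral_gap.
Qed.

(** Kernels of polynomials in A are invariant under A. *)
Lemma splitting_commute : Pic *m T = T *m Pic.
Proof.
have [sc [ss [scP ssP cc css]]] := splitting_annihilators.
have inc z : shift_prod T sc *m z = 0 -> Ec z.
  move=> scz; apply/Ec_Pis; apply: (@shift_prod_coprime _ _ T sc ss).
  - by move=> x y /scP + /ssP; exact: gap_neq.
  - by rewrite mulmxBl mul1mx mulmxBr scz cc ?subr0 //; exact: Ec_im.
  - by apply: css; exact: Es_im.
have ins z : shift_prod T ss *m z = 0 -> Es z.
  move=> ssz; apply/Es_Pic; apply: (@shift_prod_coprime _ _ T sc ss).
  - by move=> x y /scP + /ssP; exact: gap_neq.
  - by apply: cc; exact: Ec_im.
  - have -> : Pic = 1%:M - Pis by rewrite opprB addrC subrK.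
    by rewrite mulmxBl mul1mx mulmxBr ssz css ?subr0 //; exact: Es_im.
have TP s z : shift_prod T s *m z = 0 -> shift_prod T s *m (T *m z) = 0.
  move=> sz; rewrite mulmxA mulmxE -(_ : T * shift_prod T s = shift_prod T s * T).
    by rewrite -mulmxE -mulmxA sz mulmx0.
  by apply: comm_shift_prod => l; exact: comm_shift.
apply/matrixP => i j; have : Pic *m T *m delta_mx j 0 = T *m Pic *m delta_mx j (0 : 'I_1).
  set d := delta_mx j 0.
  have h1 : Pic *m (T *m (Pic *m d)) = T *m (Pic *m d).
    by apply/EcP/inc/TP/cc/Ec_im.
  have h2 : Pic *m (T *m (Pis *m d)) = 0.
    by apply/Es_Pic/ins/TP/css/Es_im.
  have {1}-> : d = Pic *m d + Pis *m d by rewrite -mulmxDl addrC subrK mul1mx.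
  by rewrite -(mulmxA Pic T) -(mulmxA T Pic) mulmxDr (mulmxDr Pic) h1 h2 addr0.
by rewrite -!colE => /colP/(_ i); rewrite !mxE.
Qed.

Lemma Pis_commute : Pis *m T = T *m Pis.
Proof. by rewrite mulmxBl mulmxBr mul1mx mulmx1 splitting_commute. Qed.

Local Notation conjmx := (map_mx (@conjc R)).

Lemma conj_cplx p q (M : 'M[R]_(p, q)) : conjmx (cplx M) = cplx M.
Proof. by apply/matrixP => i j; rewrite !mxE /= oppr0. Qed.

Lemma conj_shift_prod (s : seq (R[i] * nat)) :
  conjmx (shift_prod T s) = shift_prod T [seq (x.1^*, x.2) | x <- s].
Proof.
rewrite /shift_prod big_map; elim: s => [|x s IH].
  by rewrite !big_nil map_mx1.
rewrite !big_cons -!mulmxE map_mxM IH; congr (_ *m _).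
elim: x.2 => [|p IHp]; first by rewrite !expr0 map_mx1.
by rewrite !exprS -!mulmxE map_mxM -IHp map_mxB conj_cplx map_scalar_mx.
Qed.

Lemma conj_shift_prod0 (s : seq (R[i] * nat)) (P : 'M[R[i]]_N) (z : 'cV[R[i]]_N) :
  P *m T = T *m P -> shift_prod T s *m z = 0 ->
  shift_prod T [seq (x.1^*, x.2) | x <- s] *m (P *m conjmx z) = 0.
Proof.
by move=> PT sz; rewrite shift_prod_commute // -conj_shift_prod -map_mxM sz map_mx0 mulmx0.
Qed.

(** As A is real, the conjugate of a vector of Ec is killed by the conjugate polynomial, whose
roots have the same real parts, hence are still on the same side of the gap. *)
Lemma conj_Ec z : Ec z -> Ec (conjmx z).
Proof.
have [sc [ss [scP ssP cc css]]] := splitting_annihilators.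
move=> /cc scz; apply/Ec_Pis.
apply: (@shift_prod_coprime _ _ T [seq (x.1^*, x.2) | x <- sc] ss).
- move=> x y /mapP[x' /scP h ->] /ssP; apply: gap_neq => /=.
  by case: x'.1 h.
- exact: conj_shift_prod0 Pis_commute scz.
- by apply: css; exact: Es_im.
Qed.

Lemma conj_Es z : Es z -> Es (conjmx z).
Proof.
have [sc [ss [scP ssP cc css]]] := splitting_annihilators.
move=> /css ssz; apply/Es_Pic.
apply: (@shift_prod_coprime _ _ T sc [seq (x.1^*, x.2) | x <- ss]).
- move=> x y /scP h /mapP[y' /ssP h' ->]; apply: gap_neq => //=.
  by case: y'.1 h'.
- by apply: cc; exact: Ec_im.
- exact: conj_shift_prod0 splitting_commute ssz.
Qed.

Lemma conj_Pic : conjmx Pic = Pic.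
Proof.
have cK p q (M : 'M[R[i]]_(p, q)) : conjmx (conjmx M) = M.
  by apply/matrixP => i j; rewrite !mxE conjcK.
apply/matrixP => i j; have : conjmx Pic *m delta_mx j 0 = Pic *m delta_mx j (0 : 'I_1).
  set d := delta_mx j 0.
  have dE : d = conjmx (Pic *m conjmx d) + conjmx (Pis *m conjmx d).
    by rewrite -map_mxD -mulmxDl [Pic + _]addrC subrK mul1mx cK.
  rewrite [in RHS]dE mulmxDr.
  have /EcP -> := conj_Ec (Ec_im (conjmx d)).
  have /Es_Pic -> := conj_Es (Es_im (conjmx d)).
  by rewrite addr0 (map_mxM _ Pic) cK.
by rewrite -!colE => /colP/(_ i); rewrite !mxE.
Qed.

Definition PcR : 'M[R]_N := map_mx (@Re R) Pic.

(** A projector whose image and kernel are invariant under conjugation is real. *)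
Lemma Pic_real : Pic = cplx PcR.
Proof.
apply/matrixP => i j; rewrite [RHS]mxE [X in X%:C]mxE.
have : conjmx Pic i j = Pic i j by rewrite conj_Pic.
rewrite [LHS]mxE; case: (Pic i j) => a b [] bb; apply: complex_eq => //=; lra.
Qed.

End Splitting.
Arguments EsP [R N] {m} [A beta e].
Arguments Es_Pic [R N] {m} [A beta e].

(** * Growth of solutions in a generalized eigenspace *)

Section ScalarDerivatives.
Variable R : realType.
Implicit Types f g : R -> R.

Lemma derD f g (s a b : R) : is_derive s 1 f a -> is_derive s 1 g b ->
  is_derive s 1 (fun t => f t + g t) (a + b).
Proof. by move=> ? ?; exact: is_deriveD. Qed.

Lemma derM f g (s a b : R) : is_derive s 1 f a -> is_derive s 1 g b ->
  is_derive s 1 (fun t => f t * g t) (a * g s + f s * b).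
Proof.
move=> ? ?; rewrite addrC [a * _]mulrC; exact: is_deriveM.
Qed.

Lemma derZ f (s c a : R) : is_derive s 1 f a -> is_derive s 1 (fun t => c * f t) (c * a).
Proof. by move=> ?; exact: is_deriveZ. Qed.

Lemma der_expRM (a t : R) : is_derive t 1 (fun t => expR (a * t)) (a * expR (a * t)).
Proof.
have h : is_derive t 1 (fun t => a * t) a.
  by have := @derZ id t a 1 (is_derive_id _ _); rewrite mulr1.
rewrite mulrC; exact: (@is_derive1_comp _ expR (fun t => a * t) t).
Qed.

(** Energy estimate: with k = a - Re l, the derivative of e^(-2at) |y|^2 is at most
e^(-2at) (2 |y| |z| - 2k |y|^2), hence at most e^(-2at) |z|^2 / (2k), and the bound on z makes
this O(e^(-kt)), by the choice of a'. Adding the corresponding multiple of e^(-kt) gives a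
nonincreasing quantity, so no integration is needed. *)
Lemma forced_scalar_growth (l : R[i]) (a a' C : R) (y z : R -> R[i]) :
  Re l < a -> a = 2 * a' - Re l ->
  (forall t, cderiv y t (l * y t + z t)) ->
  (forall t, 0 <= t -> cnorm (z t) <= C * expR (a' * t)) ->
  exists D, forall t, 0 <= t -> cnorm (y t) <= D * expR (a * t).
Proof.
move=> la aE y' zC; pose k := a - Re l; have k0 : 0 < k by rewrite subr_gt0.
pose u (t : R) := Re (y t) * Re (y t) + Im (y t) * Im (y t).
pose K := C ^+ 2 / (2 * k ^+ 2).
pose g (t : R) := expR (- (2 * a) * t) * u t + K * expR (- k * t).
pose du (t : R) := 2 * Re l * u t + 2 * (Re (y t) * Re (z t) + Im (y t) * Im (z t)).
have u' (t : R) : is_derive t 1 u (du t).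
  have [yr yi] := y' t; apply: is_derive_eq (derD (derM yr yr) (derM yi yi)) _.
  rewrite !ReImE /du /u; ring.
have g' (t : R) : is_derive t 1 g (expR (- (2 * a) * t) * (du t - 2 * a * u t) - k * K * expR (- k * t)).
  apply: is_derive_eq (derD (derM (der_expRM _ t) (u' t)) (derZ K (der_expRM _ t))) _.
  ring.
have g'le (t : R) : 0 <= t ->
    expR (- (2 * a) * t) * (du t - 2 * a * u t) - k * K * expR (- k * t) <= 0.
  move=> t0; have := zC t t0.
  have -> : expR (- k * t) = expR (- (2 * a) * t) * expR (a' * t) ^+ 2.
    by rewrite -expRM_natl -expRD /k aE; congr expR; ring.
  set p := expR (- _ * t); set q := expR _; rewrite /du /u /K /cnorm.
  have p0 : 0 < p by exact: expR_gt0.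
  have q0 : 0 < q by exact: expR_gt0.
  move: (Re (y t)) (Im (y t)) (Re (z t)) (Im (z t)) => yr yi zr zi zle.
  have zz : zr ^+ 2 + zi ^+ 2 <= C ^+ 2 * q ^+ 2.
    have : (`|zr| + `|zi|) ^+ 2 <= (C * q) ^+ 2.
      by rewrite ler_sqr ?nnegrE ?addr_ge0 // (le_trans _ zle) // addr_ge0.
    rewrite sqrrD -!normrX !(ger0_norm (sqr_ge0 _)) exprMn.
    by have : 0 <= `|zr| * `|zi| by []; rewrite mulr2n; lra.
  rewrite (_ : k * (C ^+ 2 / (2 * k ^+ 2)) * (p * q ^+ 2) =
    p * (C ^+ 2 * q ^+ 2 / (2 * k))); last first.
    by field; rewrite gt_eqF.
  rewrite -mulrBr pmulr_rle0 // subr_le0 ler_pdivlMr ?mulr_gt0 //.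
  apply: le_trans zz; rewrite -subr_ge0.
  rewrite (_ : _ - _ = (2 * k * yr - zr) ^+ 2 + (2 * k * yi - zi) ^+ 2).
    by rewrite addr_ge0 ?sqr_ge0.
  by rewrite /k; ring.
have gle (t : R) : 0 <= t -> g t <= g 0.
  move=> t0; have := @MVT_le R g _ (fun=> 0) (fun=> 0) 0 t t0 (fun s _ => g' s)
    (fun s _ => is_derive_cst _ _ _).
  rewrite subrr subr_le0; apply=> s /andP[s0 _]; exact: g'le.
pose D := g 0 + 1; have K0 : 0 <= K by rewrite divr_ge0 ?sqr_ge0 // mulr_ge0 // sqr_ge0.
have u0 (t : R) : 0 <= u t by rewrite /u addr_ge0 // -expr2 sqr_ge0.
have D1 : 1 <= D.
  by rewrite /D lerDr /g !mulr0 !expR0 mul1r mulr1 addr_ge0.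
exists (2 * D) => t t0.
have ule : u t <= (D * expR (a * t)) ^+ 2.
  have h : expR (- (2 * a) * t) * u t <= D.
    apply: (@le_trans _ _ (g t)); first by rewrite /g lerDl mulr_ge0 ?expR_ge0.
    by apply: le_trans (gle t t0) _; rewrite /D lerDl.
  have E : u t = expR (a * t) ^+ 2 * (expR (- (2 * a) * t) * u t).
    rewrite mulrA -expRM_natl -expRD (_ : _ + _ = 0) ?expR0 ?mul1r //; ring.
  rewrite E exprMn mulrC; apply: ler_wpM2r; first exact: sqr_ge0.
  by apply: le_trans h _; rewrite expr2 ler_peMl // (le_trans _ D1).
have pos : 0 <= D * expR (a * t) by rewrite mulr_ge0 ?expR_ge0 // (le_trans _ D1).
rewrite /cnorm -mulrA mulr_natl mulr2n lerD //.
- rewrite -ler_sqr ?nnegrE // -normrX ger0_norm ?sqr_ge0 //; apply: le_trans ule.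
  by rewrite /u -!expr2 lerDl sqr_ge0.
- rewrite -ler_sqr ?nnegrE // -normrX ger0_norm ?sqr_ge0 //; apply: le_trans ule.
  by rewrite /u -!expr2 lerDr sqr_ge0.
Qed.

(** Induction on the nilpotency order: z = (B - l) y solves the same equation with order one
less, and each entry of y solves a scalar equation forced by z. The loss from the exponent of z
to that of y absorbs the polynomial factors of the Jordan blocks. *)
Lemma gen_eigen_growth N (B : 'M[R[i]]_N) (l : R[i]) (p : nat) (a : R)
    (y : R -> 'cV[R[i]]_N) : Re l < a ->
  (forall t, mderiv y t (B *m y t)) ->
  (forall t, (B - l%:M) ^+ p *m y t = 0) ->
  exists C, forall t, 0 <= t -> mnorm (y t) <= C * expR (a * t).
Proof.
elim: p a y => [|p IH] a y la y' yp.
  by exists 0 => t _; have := yp t; rewrite expr0 mul1mx => ->; rewrite mnorm0 mul0r.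
pose z t := (B - l%:M) *m y t.
have la' : Re l < (a + Re l) / 2 by lra.
have [||C zC] := IH _ z la'.
- move=> t; have -> : B *m z t = (B - l%:M) *m (B *m y t).
    rewrite /z !mulmxA; congr (_ *m _).
    by rewrite mulmxBl mulmxBr scalar_mxC.
  exact: mderivMl.
- by move=> t; rewrite /z mulmxA -[_ *m _ in X in X *m _]/(_ * _) -exprSr.
have H i : exists D, forall t, 0 <= t -> cnorm (y t i 0) <= D * expR (a * t).
  apply: (@forced_scalar_growth l a ((a + Re l) / 2) C _ (fun t => z t i 0)) => //.
  - by lra.
  - move=> t; have := y' t i 0; congr (cderiv _ _ _).
    by rewrite /z mulmxBl mul_scalar_mx; move: (B *m y t) => w; rewrite !mxE [RHS]addrC subrK.
  - by move=> t t0; apply: le_trans (zC t t0); exact: cnorm_le_mnorm.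
have /boolp.choice[D DP] := H.
exists (\sum_i D i) => t t0; rewrite /mnorm mulr_suml; apply: ler_sum => i _.
by rewrite big_ord1; exact: DP.
Qed.

Lemma mexpN N (B : 'M[R[i]]_N) t : mexp (- B) t = mexp B (- t).
Proof. by rewrite !mexpE scalerN -scaleNr -rmorphN. Qed.

Lemma mexp_gen_eigen_growth N (B : 'M[R[i]]_N) (l : R[i]) (p : nat) (a : R) (v : 'cV[R[i]]_N) :
  Re l < a -> (B - l%:M) ^+ p *m v = 0 ->
  exists C, forall t, 0 <= t -> mnorm (mexp B t *m v) <= C * expR (a * t).
Proof.
move=> la Bv; apply: (gen_eigen_growth (l := l) (p := p) (B := B)) => // t.
  by rewrite mulmxA; apply: mderivMr; exact: mexp_deriv.
rewrite mulmxA mexp_commute ?mulmxA -?mulmxA ?Bv ?mulmx0 //.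
by apply/commr_sym/commrX/comm_shift.
Qed.

End ScalarDerivatives.

(** * Exponential bounds for the two flows *)

Lemma mnorm_cols (R : realType) p q (M : 'M[R[i]]_(p, q)) :
  mnorm M = \sum_j mnorm (col j M).
Proof.
rewrite /mnorm exchange_big; apply: eq_bigr => j _; apply: eq_bigr => i _.
by rewrite big_ord1 mxE.
Qed.

Section FlowBounds.
Variables (R : realType) (N m : nat) (A : 'M[R]_N) (beta : nat -> R[i])
  (e : nat -> 'cV[R[i]]_N).
Hypothesis spectrum : spectral_data A beta e.
Hypotheses (m_ge1 : (1 <= m)%N) (m_ltN : (m < N)%N).
Hypothesis spectral_gap : Re (beta m.+1) < Re (beta m).

Local Notation Ec := (Ec e m).
Local Notation Es := (Es e m).
Local Notation Pic := (Pic e m).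
Local Notation Pis := (Pis e m).
Local Notation T := (cplx A).
Local Notation Ac := (Ac A e m).
Local Notation As := (As A e m).

Let PicT : Pic *m T = T *m Pic := splitting_commute spectrum m_ge1 m_ltN spectral_gap.
Let PisT : Pis *m T = T *m Pis := Pis_commute spectrum m_ge1 m_ltN spectral_gap.

Lemma Pic_Ac : Pic *m Ac = Ac.
Proof. by rewrite /Defs.Ac mulmxA (Pic_idem spectrum m_ltN). Qed.
Lemma Ac_Pic : Ac *m Pic = Ac.
Proof. by rewrite /Defs.Ac -mulmxA -PicT Pic_Ac. Qed.
Lemma Pis_As : Pis *m As = As.
Proof. by rewrite /Defs.As mulmxA (Pis_idem spectrum m_ltN). Qed.
Lemma As_Pis : As *m Pis = As.
Proof. by rewrite /Defs.As -mulmxA -PisT Pis_As. Qed.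

Lemma Ac_Ec v : Ec v -> Ac *m v = T *m v.
Proof.
by move=> /(EcP spectrum m_ltN) {2}<-; rewrite /Defs.Ac PicT mulmxA.
Qed.
Lemma As_Es v : Es v -> As *m v = T *m v.
Proof.
by move=> /(EsP spectrum) {2}<-; rewrite /Defs.As PisT mulmxA.
Qed.

Lemma Pic_flow s : Pic *m mexp Ac s = mexp Ac s *m Pic.
Proof. by apply: mexp_commute; rewrite Pic_Ac Ac_Pic. Qed.
Lemma Pis_flow s : Pis *m mexp As s = mexp As s *m Pis.
Proof. by apply: mexp_commute; rewrite Pis_As As_Pis. Qed.

Lemma Ec_flow s v : Ec v -> Ec (mexp Ac s *m v).
Proof.
move=> /(EcP spectrum m_ltN) vc; apply/(EcP spectrum m_ltN).
by rewrite mulmxA Pic_flow -mulmxA vc.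
Qed.
Lemma Es_flow s v : Es v -> Es (mexp As s *m v).
Proof.
move=> /(EsP spectrum) vc; apply/(EsP spectrum).
by rewrite mulmxA Pis_flow -mulmxA vc.
Qed.

(** The range of P is invariant under T, and PT coincides with T on it. *)
Lemma compressed_shiftX (P : 'M[R[i]]_N) (l : R[i]) p (v : 'cV[R[i]]_N) :
  P *m P = P -> P *m T = T *m P -> P *m v = v ->
  (P *m T - l%:M) ^+ p *m v = (T - l%:M) ^+ p *m v.
Proof.
move=> PP PT Pv; elim: p => [|p IH]; first by rewrite !expr0.
rewrite !exprS -!mulmxE -!mulmxA IH.
have -> : (T - l%:M) ^+ p *m v = P *m ((T - l%:M) ^+ p *m v).
  rewrite mulmxA -{1}Pv mulmxA; congr (_ *m _); apply/esym/commrX/commrB => //.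
  by rewrite /GRing.comm -!mulmxE scalar_mxC.
by rewrite !mulmxA !mulmxBl -!mulmxA (mulmxA T P) -PT !(mulmxA P) PP.
Qed.

Let p_ex j : (1 <= j <= N)%N -> exists p, (T - (beta j)%:M) ^+ p *m e j = 0.
Proof. exact: (spectral_gen_eigenvectors spectrum). Qed.

(** Bounds for the images of the basis vectors bound the operator norm on the range of P. *)
Lemma flow_bound_uniform (B P : 'M[R[i]]_N) (E : set 'cV[R[i]]_N) (a : R) :
  (forall v, E (P *m v)) -> (forall v, E v -> P *m v = v) ->
  (forall v, E v -> exists C, forall t, 0 <= t -> mnorm (mexp B t *m v) <= C * expR (a * t)) ->
  exists2 C, 0 < C & forall t v, 0 <= t -> E v ->
    mnorm (mexp B t *m v) <= C * expR (a * t) * mnorm v.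
Proof.
move=> EP PE bound.
have /boolp.choice[C CP] j := bound _ (EP (delta_mx j 0)).
exists (`|\sum_j C j| + 1) => [|t v t0 /PE Pv]; first by rewrite ltr_wpDl.
rewrite -{1}Pv mulmxA; apply: le_trans (mnormM _ _) _.
apply: ler_wpM2r; first exact: mnorm_ge0.
apply: (@le_trans _ _ ((\sum_j C j) * expR (a * t))); last first.
  rewrite ler_wpM2r ?expR_ge0 //; apply: le_trans (ler_norm _) _; lra.
rewrite mnorm_cols mulr_suml; apply: ler_sum => j _.
by rewrite colE -mulmxA; exact: CP.
Qed.

(** Backward in time, the flow on Ec is the forward flow of - Ac, whose eigenvalues there have
real part at most - Re (beta m). *)
Lemma Ec_backward_bound (a : R) : - Re (beta m) < a ->
  exists2 C, 0 < C & forall t v, 0 <= t -> Ec v ->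
    mnorm (mexp Ac (- t) *m v) <= C * expR (a * t) * mnorm v.
Proof.
move=> am; have [|||C C0 CP] := @flow_bound_uniform (- Ac) Pic Ec a.
- by move=> v; exact: (Ec_im spectrum m_ltN).
- by move=> v /(EcP spectrum m_ltN).
- move=> v [c ->]; rewrite big_nat_cond.
  apply: (big_ind (fun v => exists C, forall t, 0 <= t -> mnorm (mexp (- Ac) t *m v) <= C * expR (a * t))).
  + by exists 0 => t _; rewrite mulmx0 mnorm0 mul0r.
  + move=> x y [C CP] [D DP]; exists (C + D) => t t0; rewrite mulmxDr.
    by apply: le_trans (mnormD _ _) _; rewrite mulrDl lerD ?CP ?DP.
  move=> j; rewrite andbT ltnS => jm.
  have ejc : Pic *m e j = e j.
    have j1 : (j.-1 < m)%N by case: j jm => [|j /andP[]].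
    have := Pic_e m spectrum (Ordinal (leq_trans j1 (ltnW m_ltN))).
    by rewrite /= j1 scale1r prednK //; case/andP: jm.
  have [|p pe] := p_ex (j := j).
    by case/andP: jm => -> jm /=; exact: leq_trans jm (ltnW m_ltN).
  apply: (@mexp_gen_eigen_growth _ _ _ (- beta j) p).
    rewrite ReN; apply: le_lt_trans am; rewrite lerN2.
    exact: (Re_beta_c spectrum m_ltN).
  rewrite -scalemxAr (_ : - Ac - (- beta j)%:M = - (Ac - (beta j)%:M)); last first.
    by rewrite opprB rmorphN opprK addrC.
  rewrite exprNn -mulmxE -mulmxA compressed_shiftX ?pe ?mulmx0 ?scaler0 //.
  exact: (Pic_idem spectrum m_ltN).
exists C; first exact: C0.
by move=> t v t0 vE; rewrite -mexpN; exact: CP.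
Qed.

Lemma Es_forward_bound (b : R) : b < - Re (beta m.+1) ->
  exists2 C, 0 < C & forall t v, 0 <= t -> Es v ->
    mnorm (mexp As t *m v) <= C * expR (- b * t) * mnorm v.
Proof.
move=> bm; have [|||C C0 CP] := @flow_bound_uniform As Pis Es (- b).
- by move=> v; exact: (Es_im spectrum m_ltN).
- by move=> v /(EsP spectrum).
- move=> v [c ->]; rewrite big_nat_cond.
  apply: (big_ind (fun v => exists C, forall t, 0 <= t -> mnorm (mexp As t *m v) <= C * expR (- b * t))).
  + by exists 0 => t _; rewrite mulmx0 mnorm0 mul0r.
  + move=> x y [C CP] [D DP]; exists (C + D) => t t0; rewrite mulmxDr.
    by apply: le_trans (mnormD _ _) _; rewrite mulrDl lerD ?CP ?DP.
  move=> j; rewrite andbT ltnS => /andP[mj jN].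
  have ejs : Pis *m e j = e j.
    have j1 : (j.-1 < N)%N by case: j mj jN.
    have jm : (j.-1 < m)%N = false by case: j mj {jN j1} => // j; rewrite ltnS ltnNge => ->.
    have := Pic_e m spectrum (Ordinal j1); rewrite /= jm prednK ?(leq_ltn_trans _ mj) //.
    by rewrite scale0r mulmxBl mul1mx => ->; rewrite subr0.
  have [|p pe] := p_ex (j := j); first by rewrite jN (leq_ltn_trans _ mj).
  apply: (@mexp_gen_eigen_growth _ _ _ (beta j) p).
    rewrite ltrNr; apply: lt_le_trans bm _; rewrite lerN2.
    by apply: (Re_beta_s spectrum); rewrite mj.
  rewrite -scalemxAr compressed_shiftX ?pe ?scaler0 //.
  exact: (Pis_idem spectrum m_ltN).
by exists C.
Qed.

End FlowBounds.

(** * Improper integrals of exponentially decaying functions *)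

Section Primitives.
Variable R : realType.
Notation mu := (@lebesgue_measure R).
Implicit Types f : R -> R.

Lemma is_derive_continuous f (s l : R) : is_derive s 1 f l -> {for s, continuous f}.
Proof. by case=> /derivable1_diffP/differentiable_continuous. Qed.

(** The tail is reflected to a half-line going to +oo, where the fundamental theorem of calculus
for nonnegative functions applies. *)
Lemma integral_expR_tail (c x : R) : 0 < c ->
  (\int[mu]_(t in `]-oo, x]) (expR (c * t))%:E = (expR (c * x) / c)%:E)%E.
Proof.
move=> c0; have ec (t : R) : {for t, continuous (fun t => expR (c * t))}.
  exact: is_derive_continuous (der_expRM c t).
rewrite -[x in `]-oo, x]]opprK ge0_integration_by_substitutionNy; last 2 first.
- by apply: continuous_subspaceT => t; exact: ec.
- by move=> t _; exact: expR_ge0.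
rewrite (_ : _ \o _ = (fun t => expR (- c * t))); last first.
  by apply/funext => t; rewrite /= mulrN mulNr.
have d (t : R) : is_derive t 1 (fun t => - c^-1 * expR (- c * t)) (expR (- c * t)).
  have := derZ (- c^-1) (der_expRM (- c) t).
  by rewrite mulrA mulrNN mulVf ?gt_eqF // mul1r.
rewrite (@ge0_continuous_FTC2y _ _ (fun t => - c^-1 * expR (- c * t)) (- x) 0).
- by rewrite -EFinB sub0r mulNr opprK mulrNN mulrC.
- by move=> t _ /=; exact: expR_ge0.
- by apply: continuous_subspaceT => t; exact: is_derive_continuous (der_expRM _ t).
- rewrite -(mulr0 (- c^-1)); apply: cvgMr.
  rewrite (_ : (fun t => _) = (fun t => expR (- (c * t)))); last by apply/funext => t; rewrite mulNr.
  apply: (cvg_comp (fun t => c * t) (fun t => expR (- t))); last exact: cvgr_expR.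
  by apply: gt0_cvgMry => //; exact: cvg_id.
- by move=> t _; have ? := d t; exact: ex_derive.
- by apply: cvg_at_right_filter; exact: is_derive_continuous (d _).
- by move=> t _; rewrite derive1E; have ? := d t; exact: derive_val.
Qed.

Lemma continuous_measurable_itv f (D : set R) : measurable D ->
  (forall t, {for t, continuous f}) -> measurable_fun D f.
Proof.
by move=> mD fc; apply: subspace_continuous_measurable_fun => //; exact: continuous_subspaceT.
Qed.

Lemma integrable_exp_tail f (c K x : R) : 0 < c -> (forall t, {for t, continuous f}) ->
  (forall t, t <= x -> `|f t| <= K * expR (c * t)) ->
  mu.-integrable `]-oo, x] (EFin \o f).
Proof.
move=> c0 fc fK.
apply: (@le_integrable _ _ _ mu _ _ _ (fun t => (K * expR (c * t))%:E)) => //.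
- by apply/measurable_EFinP; exact: continuous_measurable_itv.
- move=> t /=; rewrite in_itv /= => tx; rewrite lee_fin.
  by apply: le_trans (fK t tx) _; exact: ler_norm.
rewrite (_ : (fun t => _) = (fun t => K%:E * (expR (c * t))%:E)%E); last first.
  by apply/funext => t; rewrite EFinM.
apply: integrableZl => //; apply/integrableP; split.
  apply/measurable_EFinP; apply: continuous_measurable_itv => // t.
  exact: is_derive_continuous (der_expRM c t).
under eq_integral do rewrite gee0_abs ?lee_fin ?expR_ge0 //.
by rewrite integral_expR_tail // ltry.
Qed.

(** The primitive is the integral over ]-oo, t]; for t > 0 integrability holds because f is
bounded on [0, t], and for t <= 0 integrating the majorant gives the decay. *)
Lemma decaying_primitive f (c K : R) : 0 < c -> (forall t, {for t, continuous f}) ->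
  (forall t, t <= 0 -> `|f t| <= K * expR (c * t)) ->
  mu.-integrable `]-oo, 0] (EFin \o f) /\
  exists F : R -> R, [/\ forall t : R, is_derive t 1 F (f t),
    forall t, t <= 0 -> `|F t| <= K / c * expR (c * t) &
    F 0 = Rintegral mu `]-oo, 0] f].
Proof.
move=> c0 fc fK; split; first exact: integrable_exp_tail fK.
have int (x : R) : mu.-integrable `]-oo, x] (EFin \o f).
  have [x0|/ltW x0] := leP x 0.
    by apply: (integrable_exp_tail c0 fc (K := K)) => t tx; apply: fK; exact: le_trans tx x0.
  have [y _ fy] : exists2 y, y \in `[0, x]%R & forall t, t \in `[0, x]%R -> `|f t| <= `|f y|.
    apply: EVT_max => //; apply: continuous_subspaceT => t.
    by apply: continuous_comp; [exact: fc|exact: norm_continuous].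
  apply: (integrable_exp_tail c0 fc (K := `|K| + `|f y|)) => t tx.
  have [t0|/ltW t0] := leP t 0.
    apply: le_trans (fK t t0) _; rewrite ler_wpM2r ?expR_ge0 //.
    by apply: le_trans (ler_norm _) _; rewrite lerDl.
  have : `|f t| <= `|f y| by apply: fy; rewrite in_itv /= t0 tx.
  move/le_trans; apply; rewrite -[leLHS]mulr1; apply: ler_pM => //; first by rewrite lerDr.
  by rewrite -expR0 ler_expR mulr_ge0 // ltW.
exists (fun x => Rintegral mu `]-oo, x] f); split => //.
- move=> t; have t1 : t < t + 1 by rewrite ltrDl.
  have [d1 d2] := @continuous_FTC1 R f -oo%O t (t + 1) t1 (int _) (ltNyr t) (fc t).
  by apply: DeriveDef; [exact: d1|rewrite -derive1E].
- move=> x x0; apply: le_trans (le_normr_Rintegral _ (int x)) _ => //.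
  have intg : mu.-integrable `]-oo, x] (EFin \o (fun t => K * expR (c * t))).
    apply: (integrable_exp_tail c0 (K := `|K|)) => [t|t _].
      by apply: is_derive_continuous (derZ _ (der_expRM _ _)).
    by rewrite normrM (ger0_norm (expR_ge0 _)).
  apply: (@le_trans _ _ (Rintegral mu `]-oo, x] (fun t => K * expR (c * t)))).
    apply: le_Rintegral => //; last by move=> t /=; rewrite in_itv /= => tx; apply: fK; exact: le_trans tx x0.
    exact: integrable_norm.
  rewrite /Rintegral; under eq_integral do rewrite EFinM.
  have intE : mu.-integrable `]-oo, x] (fun t => (expR (c * t))%:E).
    apply: (integrable_exp_tail (f := fun t => expR (c * t)) c0 (K := 1)) => t.
      exact: is_derive_continuous (der_expRM c t).
    by rewrite mul1r ger0_norm ?expR_ge0.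
  have -> : K / c * expR (c * x) = K * (expR (c * x) / c) by rewrite mulrA mulrAC.
  by rewrite (integralZl _ intE) // integral_expR_tail.
Qed.

Lemma primitive_exists f (b : R) : 0 < b -> (forall t, {for t, continuous f}) ->
  exists2 F : R -> R, F 0 = 0 & forall t : R, - b < t -> is_derive t 1 F (f t).
Proof.
move=> b0 fc; pose P x := Rintegral mu `[- b, x] f.
exists (fun x => P x - P 0) => [|t bt]; first by rewrite subrr.
have int : mu.-integrable `[- b, t + 1] (EFin \o f).
  apply: continuous_compact_integrable; first exact: segment_compact.
  exact: continuous_subspaceT.
have t1 : t < t + 1 by rewrite ltrDl.
have [d1 d2] := @continuous_FTC1_closed R f (- b) t (t + 1) t1 int bt (fc t).
have dP : is_derive t 1 P (f t) by apply: DeriveDef; [exact: d1|rewrite -derive1E].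
by rewrite -[f t]addr0; apply: derD => //; exact: is_derive_cst.
Qed.

End Primitives.

(** * Decaying primitives of matrix-valued curves, and the chain rule *)

Section MatrixPrimitives.
Variable R : realType.
Notation mu := (@lebesgue_measure R).

Definition decays p q (c : R) (Y : R -> 'M[R[i]]_(p, q)) : Prop :=
  exists K, forall s, s <= 0 -> mnorm (Y s) <= K * expR (c * s).

(** A primitive F of f that vanishes at -oo, at an exponential rate c. This characterization
replaces manipulations of improper integrals: linear combinations, images by matrices and
translates by t <= 0 of such primitives are again of this kind, and they are determined by f. *)
Definition tail_primitive p q (c : R) (f F : R -> 'M[R[i]]_(p, q)) : Prop :=
  (forall s, mderiv F s (f s)) /\ decays c F.

(** Exponential growth beats any constant: e^(ct) >= 1 + ct. *)
Lemma decays_cst p q c (M : 'M[R[i]]_(p, q)) : 0 < c -> decays c (fun=> M) -> M = 0.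
Proof.
move=> c0 [K MK]; apply: mnorm_le0; rewrite leNgt; apply/negP => M0.
have K0 : 0 < K.
  by apply: lt_le_trans M0 _; apply: le_trans (MK 0 (lexx _)) _; rewrite mulr0 expR0 mulr1.
pose t := K / (mnorm M * c).
have t0 : 0 < t by rewrite divr_gt0 // mulr_gt0.
have : mnorm M * expR (c * t) <= K.
  have := MK (- t); rewrite oppr_le0 ltW // => /(_ isT).
  by rewrite mulrN expRN -lter_pdivrMr ?invr_gt0 ?expR_gt0 // invrK.
apply/negP; rewrite -ltNge; apply: lt_le_trans (_ : mnorm M * (1 + c * t) <= _).
  rewrite mulrDr mulr1 (_ : mnorm M * (c * t) = K) ?ltrDr //.
  by rewrite /t; field; rewrite !gt_eqF.
by rewrite ler_wpM2l ?mnorm_ge0 // expR_ge1Dx.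
Qed.

Section Closure.
Variables (p q : nat) (c : R).
Implicit Types f g F G : R -> 'M[R[i]]_(p, q).

Lemma decaysD f g : decays c f -> decays c g -> decays c (fun s => f s + g s).
Proof.
move=> [K fK] [L gL]; exists (K + L) => s s0; apply: le_trans (mnormD _ _) _.
by rewrite mulrDl lerD ?fK ?gL.
Qed.

Lemma decaysZ (a : R[i]) f : decays c f -> decays c (fun s => a *: f s).
Proof.
move=> [K fK]; exists (cnorm a * K) => s s0; apply: le_trans (mnormZ _ _) _.
by rewrite -mulrA ler_wpM2l ?fK ?cnorm_ge0.
Qed.

(** The difference of two primitives is constant, and a decaying constant is 0. *)
Lemma tail_primitive_unique f F G : 0 < c ->
  tail_primitive c f F -> tail_primitive c f G -> F = G.
Proof.
move=> c0 [F' dF] [G' dG].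
have FG s : F s - G s = F 0 - G 0.
  have h t : mderiv (fun t => F t - G t) t 0 by rewrite -(subrr (f t)); exact: mderivB.
  by rewrite (mderiv0_cstT h s 0).
have : decays c (fun=> F 0 - G 0).
  have := decaysD dF (decaysZ (-1) dG); congr (decays _ _).
  by apply/funext => s; rewrite scaleN1r FG.
move=> /(decays_cst c0) FG0; apply/funext => s; apply/eqP.
by rewrite -subr_eq0 FG FG0.
Qed.

Lemma tail_primitive0 : tail_primitive c (fun=> 0 : 'M[R[i]]_(p, q)) (fun=> 0).
Proof.
split=> [s|]; first exact: mderiv_cst.
by exists 0 => s _; rewrite mnorm0 mul0r.
Qed.

Lemma tail_primitiveZ (a : R[i]) f F : tail_primitive c f F ->
  tail_primitive c (fun s => a *: f s) (fun s => a *: F s).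
Proof.
by move=> [F' dF]; split=> [s|]; [exact: mderivZ|exact: decaysZ].
Qed.

Lemma tail_primitive_sum (I : Type) (r : seq I) (P : pred I) (f F : I -> R -> 'M[R[i]]_(p, q)) :
  (forall i, tail_primitive c (f i) (F i)) ->
  tail_primitive c (fun s => \sum_(i <- r | P i) f i s) (fun s => \sum_(i <- r | P i) F i s).
Proof.
move=> fF; split=> [s|]; first by apply: mderiv_sum => i _; have [] := fF i.
elim: r => [|i r IH].
  by exists 0 => s _; rewrite big_nil mnorm0 mul0r.
rewrite (_ : (fun s => _) = fun s => (if P i then F i s else 0) + \sum_(j <- r | P j) F j s).
  apply: decaysD => //; case: (P i); first by have [] := fF i.
  by exists 0 => s _; rewrite mnorm0 mul0r.
by apply/funext => s; rewrite big_cons; case: (P i); rewrite ?add0r.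
Qed.

Lemma tail_primitive_exists f : 0 < c -> (forall s, exists L, mderiv f s L) -> decays c f ->
  exists F, tail_primitive c f F /\
    forall i j,
      [/\ mu.-integrable `]-oo, 0] (fun s => (Re (f s i j))%:E),
          mu.-integrable `]-oo, 0] (fun s => (Im (f s i j))%:E) &
          F 0 i j = Rintegral mu `]-oo, 0] (fun s => Re (f s i j)) +i*
                    Rintegral mu `]-oo, 0] (fun s => Im (f s i j))].
Proof.
move=> c0 f' [K fK].
have key (u : R[i] -> R) : (u = @Re R \/ u = @Im R) -> forall i j,
  mu.-integrable `]-oo, 0] (EFin \o (fun s => u (f s i j))) /\
  exists F : R -> R, [/\ forall t : R, is_derive t 1 F (u (f t i j)),
    forall t, t <= 0 -> `|F t| <= K / c * expR (c * t) &
    F 0 = Rintegral mu `]-oo, 0] (fun s => u (f s i j))].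
  move=> ru i j; apply: decaying_primitive => // t.
    have [L /(_ i j)[h1 h2]] := f' t.
    by case: ru => ->; [exact: is_derive_continuous h1|exact: is_derive_continuous h2].
  move=> t0; apply: le_trans (fK t t0); apply: le_trans (cnorm_le_mnorm _ i j).
  by case: ru => ->; [exact: Re_le_cnorm|exact: Im_le_cnorm].
have kR (ij : 'I_p * 'I_q) := key (@Re R) (or_introl erefl) ij.1 ij.2.
have kI (ij : 'I_p * 'I_q) := key (@Im R) (or_intror erefl) ij.1 ij.2.
have /boolp.choice[FR FRP] : forall ij : 'I_p * 'I_q, exists F : R -> R,
    [/\ forall t : R, is_derive t 1 F (Re (f t ij.1 ij.2)),
    forall t, t <= 0 -> `|F t| <= K / c * expR (c * t) &
    F 0 = Rintegral mu `]-oo, 0] (fun s => Re (f s ij.1 ij.2))].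
  by move=> ij; case: (kR ij).
have /boolp.choice[FI FIP] : forall ij : 'I_p * 'I_q, exists F : R -> R,
    [/\ forall t : R, is_derive t 1 F (Im (f t ij.1 ij.2)),
    forall t, t <= 0 -> `|F t| <= K / c * expR (c * t) &
    F 0 = Rintegral mu `]-oo, 0] (fun s => Im (f s ij.1 ij.2))].
  by move=> ij; case: (kI ij).
exists (fun s => \matrix_(i, j) (FR (i, j) s +i* FI (i, j) s)); split; first split.
- move=> s i j; have [h1 _ _] := FRP (i, j); have [h2 _ _] := FIP (i, j); split.
    rewrite (_ : (fun _ => _) = FR (i, j)); first exact: h1.
    by apply/funext => t; rewrite mxE.
  rewrite (_ : (fun _ => _) = FI (i, j)); first exact: h2.
  by apply/funext => t; rewrite mxE.
- exists ((p * q)%:R * (2 * (K / c))) => s s0; rewrite -mulrA.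
  apply: mnorm_le_entries => i j; rewrite mxE /cnorm /=.
  have [_ h1 _] := FRP (i, j); have [_ h2 _] := FIP (i, j).
  by rewrite -mulrA mulr_natl mulr2n lerD ?h1 ?h2.
- move=> i j; have [i1 _] := kR (i, j); have [i2 _] := kI (i, j).
  split; [exact: i1|exact: i2|].
  by rewrite mxE; have [_ _ <-] := FRP (i, j); have [_ _ <-] := FIP (i, j).
Qed.

End Closure.

Lemma tail_primitiveMl p q r c (M : 'M[R[i]]_(p, q)) (f F : R -> 'M[R[i]]_(q, r)) :
  tail_primitive c f F -> tail_primitive c (fun s => M *m f s) (fun s => M *m F s).
Proof.
move=> [F' [K FK]]; split=> [s|]; first exact: mderivMl.
exists (mnorm M * K) => s s0; apply: le_trans (mnormM _ _) _.
by rewrite -mulrA ler_wpM2l ?FK ?mnorm_ge0.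
Qed.

Lemma tail_primitive_shift p q c t (f F : R -> 'M[R[i]]_(p, q)) : t <= 0 ->
  tail_primitive c f F -> tail_primitive c (fun s => f (s + t)) (fun s => F (s + t)).
Proof.
move=> t0 [F' [K FK]]; split=> [s|]; first exact: mderiv_shift.
exists (K * expR (c * t)) => s s0; apply: le_trans (FK _ _) _.
  by rewrite -[leRHS]addr0 lerD.
by rewrite mulrDr expRD [_ * expR (c * t)]mulrC mulrA mulrAC.
Qed.

End MatrixPrimitives.

Section FirstOrder.
Variable R : realType.

Lemma mderiv_epsd p q (Y : R -> 'M[R[i]]_(p, q)) s L :
  mderiv Y s L <->
  (forall e, 0 < e -> exists2 d, 0 < d & forall t, `|t - s| < d ->
     mnorm (Y t - Y s - (t - s)%:C *: L) <= e * `|t - s|).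
Proof.
split=> [YL e e0|YL i j].
  pose k : R := (p * q)%:R * 2 + 1.
  have k0 : 0 < k by rewrite ltr_wpDl // mulr_ge0.
  have ek0 := divr_gt0 e0 k0.
  have H : forall ij : 'I_p * 'I_q, \forall t \near s,
      cnorm (Y t ij.1 ij.2 - Y s ij.1 ij.2 - (t - s)%:C * L ij.1 ij.2) <= 2 * (e / k) * `|t - s|.
    move=> [i j] /=; have [/is_derive_eps/(_ _ ek0) h1 /is_derive_eps/(_ _ ek0) h2] := YL i j.
    apply: filterS2 h1 h2 => t h1 h2; rewrite /cnorm !ReB !ImB ReZ ImZ.
    by rewrite -mulrA mulr_natl mulr2n lerD // [(t - s) * _]mulrC.
  have H' : nbhs s [set t | forall ij : 'I_p * 'I_q,
      cnorm (Y t ij.1 ij.2 - Y s ij.1 ij.2 - (t - s)%:C * L ij.1 ij.2) <= 2 * (e / k) * `|t - s|].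
    exact: (@filter_forall _ _ _ (nbhs s) (nbhs_filter s) H).
  move/nbhs_ballP: H' => [d /= d0 hd].
  exists d => // t ts; have {}hd := hd t; rewrite /ball /= distrC in hd.
  apply: (le_trans (mnorm_le_entries (c := 2 * (e / k) * `|t - s|) _)).
    by move=> i j; have := hd ts (i, j); rewrite /= !mxE.
  rewrite (_ : _ * (2 * (e / k) * _) = e * `|t - s| * ((p * q)%:R * 2 / k)); last by field; rewrite gt_eqF.
  by rewrite ler_piMr ?mulr_ge0 ?(ltW e0) // ler_pdivrMr // mul1r /k; lra.
split; apply/is_derive_epsd => e e0; have [d d0 hd] := YL e e0;
    exists d => // t ts; apply: le_trans (hd t ts); apply: le_trans (cnorm_le_mnorm _ i j);
    rewrite !mxE.
  by apply: le_trans (Re_le_cnorm _); rewrite !ReB ReZ [_ * (t - s)]mulrC.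
by apply: le_trans (Im_le_cnorm _); rewrite !ImB ImZ [_ * (t - s)]mulrC.
Qed.

Lemma mderiv_lipschitz p q (Y : R -> 'M[R[i]]_(p, q)) s L : mderiv Y s L ->
  exists C, 0 < C /\ exists2 d, 0 < d & forall t, `|t - s| < d -> mnorm (Y t - Y s) <= C * `|t - s|.
Proof.
move=> /mderiv_epsd/(_ 1 ltr01)[d d0 hd]; exists (1 + mnorm L).
split; first by rewrite ltr_pwDl ?mnorm_ge0.
exists d => // t ts; have -> : Y t - Y s = (Y t - Y s - (t - s)%:C *: L) + (t - s)%:C *: L.
  by rewrite subrK.
apply: le_trans (mnormD _ _) _; rewrite mulrDl lerD ?hd //.
by rewrite mnormZr mulrC.
Qed.

(** Chain rule along a curve, for a map Z of Y known to first order at Y s only along the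
curve itself, as is the case of a map differentiable relatively to a subspace. *)
Lemma mderiv_chain p q (Y : R -> 'cV[R[i]]_p) (Z : R -> 'cV[R[i]]_q)
    (s : R) (y' : 'cV[R[i]]_p) (L : 'M[R[i]]_(q, p)) :
  mderiv Y s y' ->
  (forall e, 0 < e -> exists2 d, 0 < d & forall t, mnorm (Y t - Y s) <= d ->
     mnorm (Z t - Z s - L *m (Y t - Y s)) <= e * mnorm (Y t - Y s)) ->
  mderiv Z s (L *m y').
Proof.
move=> Y' Z'; apply/mderiv_epsd => e e0.
have [C [C0 [d1 d10 Yd]]] := mderiv_lipschitz Y'.
have L0 : 0 < mnorm L + 1 by rewrite ltr_wpDl ?mnorm_ge0.
have e2 : 0 < e / 2 by rewrite divr_gt0.
have [d2 d20 Zd] := Z' (e / 2 / C) (divr_gt0 e2 C0).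
have /mderiv_epsd/(_ _ (divr_gt0 e2 L0))[d3 d30 Yd3] := Y'.
exists (Num.min d1 (Num.min d3 (d2 / C))) => [|t].
  by rewrite !lt_min d10 d30 divr_gt0.
rewrite !lt_min => /and3P[t1 t3 t2].
have -> : Z t - Z s - (t - s)%:C *: (L *m y') =
   (Z t - Z s - L *m (Y t - Y s)) + L *m (Y t - Y s - (t - s)%:C *: y').
  by rewrite [L *m (_ - _ *: _)]mulmxBr -scalemxAr addrA subrK.
apply: le_trans (mnormD _ _) _.
have -> : e * `|t - s| = e / 2 / C * (C * `|t - s|) + e / 2 * `|t - s|.
  by field; rewrite gt_eqF.
apply: lerD.
  have Yt := Yd t t1; apply: le_trans (Zd t _) _.
    by apply: le_trans Yt _; rewrite mulrC -ler_pdivlMr // ltW.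
  by rewrite ler_wpM2l // ltW // divr_gt0.
apply: le_trans (mnormM _ _) _; apply: le_trans (ler_wpM2l (mnorm_ge0 _) (Yd3 t t3)) _.
rewrite mulrA ler_wpM2r // mulrCA ler_piMr ?(ltW e2) // ler_pdivrMr // mul1r; lra.
Qed.

End FirstOrder.

(** * Polynomial maps and differentiability relative to a subspace *)

Section PolynomialMaps.
Variables (R : realType) (N k : nat) (J : {ffun 'I_k -> 'I_N} -> 'cV[R[i]]_N).

(** A homogeneous polynomial map of degree k in general form: one vector coefficient for each
word of k coordinates. *)
Definition poly_map (y : 'cV[R[i]]_N) : 'cV[R[i]]_N :=
  \sum_(s : {ffun 'I_k -> 'I_N}) (\prod_(i < k) y (s i) 0) *: J s.

Lemma differentiable_prod_coords (r : seq 'I_k) (s : 'I_k -> 'I_N) (x : 'cV[R[i]]_N) :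
  differentiable (fun y : 'cV[R[i]]_N => \prod_(i <- r) y (s i) 0 : R[i]) x.
Proof.
elim: r => [|i r IH].
  rewrite (_ : (fun _ => _) = cst 1); first exact: differentiable_cst.
  by apply/funext => y; rewrite big_nil.
rewrite (_ : (fun _ => _) = (fun y : 'cV[R[i]]_N => y (s i) 0 : R[i]) *
    (fun y : 'cV[R[i]]_N => \prod_(i <- r) y (s i) 0)); last first.
  by apply/funext => y; rewrite big_cons.
apply: differentiableM => //; exact: (@differentiable_coord R[i] N 1 x (s i) 0).
Qed.

Lemma differentiable_poly_map x : differentiable poly_map x.
Proof.
rewrite /poly_map; elim: (index_enum _) => [|s r IH].
  rewrite (_ : (fun _ => _) = cst 0); first exact: differentiable_cst.
  by apply/funext => y; rewrite big_nil.
rewrite (_ : (fun _ => _) = (fun y : 'cV[R[i]]_N => (\prod_(i < k) y (s i) 0) *: J s) +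
    (fun y => \sum_(s <- r) (\prod_(i < k) y (s i) 0) *: J s)); last first.
  by apply/funext => y; rewrite big_cons.
apply: differentiableD => //; apply: differentiableZl.
exact: differentiable_prod_coords.
Qed.

Lemma linear_cV_mx p q (f : {linear 'cV[R[i]]_p -> 'cV[R[i]]_q}) v :
  f v = (\matrix_(i, j) f (delta_mx j 0) i 0) *m v.
Proof.
rewrite [in LHS](matrix_sum_delta v) linear_sum; apply/colP => i.
rewrite summxE mxE; apply: eq_bigr => j _.
by rewrite big_ord1 linearZ !mxE mulrC.
Qed.

Lemma poly_map_derive_on (x : 'cV[R[i]]_N) :
  exists D, forall E, derive_on E poly_map x D.
Proof.
exists (\matrix_(i, j) 'd poly_map x (delta_mx j 0) i 0) => E.
have /diff_locally/eqaddoP h := differentiable_poly_map x.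
apply/eqoP => e e0; have /nbhs_ballP[d /= d0 hd] := h e e0.
rewrite /within /=; apply/nbhs_ballP; exists d => //= y yx _.
have := hd (y - x); rewrite -ball_normE /= sub0r opprB.
move: yx; rewrite -ball_normE /= => yx /(_ yx).
by rewrite -linear_cV_mx !fctE /= subrK opprD addrA.
Qed.

End PolynomialMaps.

Section DeriveOn.
Variable R : realType.

Lemma mnorm_cplx p q (M : 'M[R]_(p, q)) : mnorm (cplx M) = \sum_i \sum_j `|M i j|.
Proof. by apply: eq_bigr => i _; apply: eq_bigr => j _; rewrite mxE cnormC. Qed.

Lemma mnorm_cplx_le p q (M : 'M[R]_(p, q)) : mnorm (cplx M) <= (p * q)%:R * `|M|.
Proof.
by apply: mnorm_le_entries => i j; rewrite mxE cnormC; exact: mx_norm_entry.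
Qed.

Lemma norm_le_mnorm_cplx p q (M : 'M[R]_(p, q)) : `|M| <= mnorm (cplx M).
Proof.
apply: mx_norm_le => [|i j]; first exact: mnorm_ge0.
by have := cnorm_le_mnorm (cplx M) i j; rewrite mxE cnormC.
Qed.

Lemma derive_on_eps_cplx N (E : set 'cV[R[i]]_N) f x (L : 'M[R[i]]_N) :
  derive_on E f x L -> forall e, 0 < e -> exists2 d, 0 < d & forall y, E y ->
    mnorm (y - x) <= d -> mnorm (f y - f x - L *m (y - x)) <= e * mnorm (y - x).
Proof.
move=> /eqoP h e e0; pose k : R := 2 * (N * 1)%:R + 1.
have k0 : 0 < k by rewrite ltr_wpDl // mulr_ge0.
have /= := h (e / k)%:C; rewrite ltcR divr_gt0 // => /(_ isT).
rewrite /within /= => /nbhs_ballP[d /= d0 hd].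
have dE : d = (Re d)%:C by apply: complex_eq => //=; exact: ger0_Im (ltW d0).
have d0' : 0 < Re d by rewrite -ltcR -dE.
exists (Re d / 2) => [|y Ey yx]; first by rewrite divr_gt0.
have := hd y; rewrite -ball_normE /= => /(_ _ Ey) hy.
have {}hy : `|f y - f x - L *m (y - x)| <= (e / k)%:C * `|y - x|.
  apply: hy; rewrite distrC; apply: le_lt_trans (norm_le_mnorm _) _.
  by rewrite dE ltcR; apply: le_lt_trans yx _; rewrite ltr_pdivrMr // ltr_pMr // ltr1n.
rewrite -lecR; apply: le_trans (mnorm_le_norm _) _.
apply: le_trans (ler_wpM2l _ hy) _; first by rewrite mulr_ge0.
apply: (@le_trans _ _ ((2 * (N * 1)%:R) * ((e / k)%:C * (mnorm (y - x))%:C))).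
  rewrite ler_wpM2l ?mulr_ge0 // ler_wpM2l ?norm_le_mnorm // lecR ltW // divr_gt0 //.
rewrite [in X in X * _](natC R 2) [in X in X * _](natC R (N * 1)) -!rmorphM lecR.
rewrite mulrA ler_wpM2r ?mnorm_ge0 // mulrCA ler_piMr ?(ltW e0) //.
rewrite ler_pdivrMr // mul1r /k; lra.
Qed.

Lemma derive_on_eps_real N (E : set 'cV[R]_N) f x (L : 'M[R]_N) :
  derive_on E f x L -> forall e, 0 < e -> exists2 d, 0 < d & forall y, E y ->
    mnorm (cplx (y - x)) <= d ->
    mnorm (cplx (f y - f x - L *m (y - x))) <= e * mnorm (cplx (y - x)).
Proof.
move=> /eqoP h e e0; pose k : R := (N * 1)%:R + 1.
have k0 : 0 < k by rewrite ltr_wpDl.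
have /= := h (e / k); rewrite divr_gt0 // => /(_ isT).
rewrite /within /= => /nbhs_ballP[d /= d0 hd].
exists (d / 2) => [|y Ey yx]; first by rewrite divr_gt0.
have := hd y; rewrite -ball_normE /= => /(_ _ Ey) hy.
have {}hy : `|f y - f x - L *m (y - x)| <= (e / k) * `|y - x|.
  apply: hy; rewrite distrC; apply: le_lt_trans (norm_le_mnorm_cplx _) _.
  by apply: le_lt_trans yx _; rewrite ltr_pdivrMr // ltr_pMr // ltr1n.
apply: le_trans (mnorm_cplx_le _) _.
apply: le_trans (ler_wpM2l _ hy) _; first by [].
rewrite mulrA; apply: ler_pM => //; rewrite ?norm_le_mnorm_cplx //.
  by rewrite mulr_ge0 // ltW // divr_gt0.
by rewrite mulrCA ler_piMr ?(ltW e0) // ler_pdivrMr // mul1r /k lerDl.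
Qed.

End DeriveOn.

(** * The Lyapunov-Perron integral *)

Section MultilinearBounds.
Variables (R : realType) (N k : nat) (Gk : ('I_k -> 'cV[R]_N) -> 'cV[R]_N).

Lemma cnorm_prod (I : Type) (r : seq I) (F : I -> R[i]) :
  cnorm (\prod_(i <- r) F i) <= \prod_(i <- r) cnorm (F i).
Proof.
elim: r => [|i r IH]; first by rewrite !big_nil /cnorm /= normr1 normr0 addr0.
rewrite !big_cons; apply: le_trans (cnormM _ _) _.
by rewrite ler_wpM2l ?cnorm_ge0.
Qed.

Lemma cplx_multilinear_bound : exists2 C, 0 <= C &
  forall z, mnorm (cplx_multilinear Gk z) <= C * \prod_(i < k) mnorm (z i).
Proof.
exists (\sum_(s : {ffun 'I_k -> 'I_N}) mnorm (cplx (Gk (fun i => delta_mx (s i) 0)))).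
  by apply: sumr_ge0 => s _; exact: mnorm_ge0.
move=> z; apply: le_trans (mnorm_sum _ _ _) _; rewrite mulr_suml; apply: ler_sum => s _.
apply: le_trans (mnormZ _ _) _; rewrite mulrC ler_wpM2l ?mnorm_ge0 //.
apply: le_trans (cnorm_prod _ _) _; apply: ler_prod => i _.
by rewrite cnorm_ge0 cnorm_le_mnorm.
Qed.

Lemma cplx_multilinear_deriv (Z : 'I_k -> R -> 'cV[R[i]]_N) s :
  (forall i, exists L, mderiv (Z i) s L) ->
  exists L, mderiv (fun t => cplx_multilinear Gk (fun i => Z i t)) s L.
Proof.
move=> Z'; pose g (f : {ffun 'I_k -> 'I_N}) := cplx (Gk (fun i => delta_mx (f i) 0)).
have h (f : {ffun 'I_k -> 'I_N}) : exists L,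
    mderiv (fun t => (\prod_(i < k) Z i t (f i) 0) *: g f) s L.
  have [l hl] : exists l, cderiv (fun t => \prod_(i < k) Z i t (f i) 0) s l.
    by apply: cderiv_prod => i; have [L ZL] := Z' i; exists (L (f i) 0); exact: ZL.
  exists (l *: g f) => i j; rewrite mxE.
  rewrite (_ : (fun _ => _) = (fun t => (\prod_(i < k) Z i t (f i) 0) * g f i j)).
    by have := cderivM hl (cderiv_cst (g f i j) s); rewrite mulr0 addr0.
  by apply/funext => t; rewrite mxE.
have /boolp.choice[L LP] := h.
by exists (\sum_f L f); apply: mderiv_sum => f _; exact: LP.
Qed.

(** Expanding each of the k factors M v over the basis vectors and distributing the product. *)
Lemma cplx_multilinear_expand (M : 'M[R[i]]_N) (v : 'cV[R[i]]_N) :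
  cplx_multilinear Gk (fun=> M *m v) =
  \sum_(f : {ffun 'I_k -> 'I_N}) (\prod_(i < k) v (f i) 0) *:
    cplx_multilinear Gk (fun i => M *m delta_mx (f i) 0).
Proof.
rewrite /cplx_multilinear.
under [in RHS]eq_bigr do rewrite scaler_sumr.
rewrite exchange_big; apply: eq_bigr => s _ /=.
under [in RHS]eq_bigr do rewrite scalerA.
rewrite -scaler_suml; congr (_ *: _).
under [LHS]eq_bigr do rewrite mxE.
rewrite bigA_distr_bigA /=; apply: eq_bigr => f _.
rewrite -big_split /=; apply: eq_bigr => i _.
by rewrite -colE mxE mulrC.
Qed.

End MultilinearBounds.

Section LyapunovPerron.
Variables (R : realType) (N m k : nat) (A : 'M[R]_N)
  (Gk : ('I_k -> 'cV[R]_N) -> 'cV[R]_N) (beta : nat -> R[i]) (e : nat -> 'cV[R[i]]_N).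
Hypothesis spectrum : spectral_data A beta e.
Hypotheses (m_ge1 : (1 <= m)%N) (m_ltN : (m < N)%N).
Hypothesis spectral_gap : Re (beta m.+1) < Re (beta m).
Variables a b : R.
Hypotheses (ha : - Re (beta m) < a) (hb : b < - Re (beta m.+1)) (hab : k%:R * a < b).

Local Notation Ec := (Ec e m).
Local Notation Es := (Es e m).
Local Notation Pic := (Pic e m).
Local Notation Pis := (Pis e m).
Local Notation Ac := (Ac A e m).
Local Notation As := (As A e m).
Local Notation c := (b - k%:R * a).

Lemma decay_rate_gt0 : 0 < c. Proof. by rewrite subr_gt0. Qed.

(** The integrand with k independent arguments in place of xi. By multilinearity the integrand
at xi is a combination of its values at basis vectors, with coefficients that are monomials in
the coordinates of xi. *)
Definition LP_polar (z : 'I_k -> 'cV[R[i]]_N) (s : R) : 'cV[R[i]]_N :=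
  mexp As (- s) *m (Pis *m cplx_multilinear Gk (fun i => mexp Ac s *m z i)).

Lemma LP_integrand_polar xi s : LP_integrand A e m Gk xi s = LP_polar (fun=> xi) s.
Proof. by rewrite /LP_integrand /LP_polar !mexpE. Qed.

Lemma LP_polar_deriv z s : exists L, mderiv (LP_polar z) s L.
Proof.
have [|L hL] := @cplx_multilinear_deriv R N k Gk (fun i t => mexp Ac t *m z i) s.
  by move=> i; eexists; apply: mderivMr; exact: mexp_deriv.
eexists; apply: mderivM; first exact: mexpN_deriv.
by apply: mderivMl; exact: hL.
Qed.

(** The k factors grow backward like e^(-as) and the outer exponential contracts like e^(bs), so
the integrand is O(e^((b - ka)s)) as s tends to -oo. *)
Lemma LP_polar_decays z : (forall i, Ec (z i)) -> decays c (LP_polar z).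
Proof.
move=> zc.
have [Ca Ca0 boundA] := Ec_backward_bound spectrum m_ge1 m_ltN spectral_gap ha.
have [Cb Cb0 boundB] := Es_forward_bound spectrum m_ge1 m_ltN spectral_gap hb.
have [Cg Cg0 boundG] := cplx_multilinear_bound Gk.
exists (Cb * (mnorm Pis * (Cg * \prod_(i < k) (Ca * mnorm (z i))))) => s s0.
have ns0 : 0 <= - s by rewrite oppr_ge0.
apply: le_trans (boundB _ _ ns0 _) _; first exact: (Es_im spectrum m_ltN).
have E : expR (c * s) = expR (- b * - s) * \prod_(i < k) expR (a * - s).
  rewrite prodr_const card_ord -expRM_natl -expRD; congr expR; ring.
apply: (@le_trans _ _ (Cb * expR (- b * - s) *
    (mnorm Pis * (Cg * \prod_(i < k) (Ca * expR (a * - s) * mnorm (z i)))))).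
  apply: ler_wpM2l; first by rewrite mulr_ge0 ?expR_ge0 // ltW.
  apply: le_trans (mnormM _ _) _; rewrite ler_wpM2l ?mnorm_ge0 //.
  apply: le_trans (boundG _) _; rewrite ler_wpM2l //.
  apply: ler_prod => i _; rewrite mnorm_ge0 /= -{1}[s]opprK.
  exact: boundA _ _ ns0 (zc i).
rewrite E le_eqVlt; apply/orP; left; apply/eqP.
under eq_bigr do rewrite mulrAC.
rewrite big_split /=; ring.
Qed.

(* The basis vectors are projected because the decay holds only for arguments in Ec. *)
Let zc (f : {ffun 'I_k -> 'I_N}) (i : 'I_k) : 'cV[R[i]]_N := Pic *m delta_mx (f i) 0.

Lemma LP_integrand_expand xi s : Ec xi ->
  LP_integrand A e m Gk xi s =
  \sum_(f : {ffun 'I_k -> 'I_N}) (\prod_(i < k) xi (f i) 0) *: LP_polar (zc f) s.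
Proof.
move=> /(EcP spectrum m_ltN) xic.
rewrite LP_integrand_polar [LHS]/LP_polar -{1}xic.
have -> : (fun=> mexp Ac s *m (Pic *m xi)) = (fun _ : 'I_k => (mexp Ac s *m Pic) *m xi).
  by apply/funext => _; rewrite mulmxA.
rewrite cplx_multilinear_expand mulmx_sumr mulmx_sumr; apply: eq_bigr => f _.
rewrite -!scalemxAr /LP_polar /zc; congr (_ *: (_ *m (_ *m cplx_multilinear _ _))).
by apply/funext => i; rewrite mulmxA.
Qed.

(** Being linear in the integrand, the primitive that vanishes at -oo depends polynomially on xi;
its value at 0 is the Lyapunov-Perron integral, which is therefore a polynomial map on Ec. *)
Lemma LP_primitives : exists Fs : {ffun 'I_k -> 'I_N} -> R -> 'cV[R[i]]_N,
  forall xi, Ec xi ->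
  [/\ tail_primitive c (LP_integrand A e m Gk xi) (fun s => poly_map (Fs ^~ s) xi),
      cvec_integrable `]-oo, 0] (LP_integrand A e m Gk xi) &
      LP_integral A e m Gk xi = poly_map (Fs ^~ 0) xi].
Proof.
have prims f : exists F, tail_primitive c (LP_polar (zc f)) F.
  have [|F [hF _]] := tail_primitive_exists decay_rate_gt0 (LP_polar_deriv (zc f)).
    by apply: LP_polar_decays => i; exact: (Ec_im spectrum m_ltN).
  by exists F.
have /boolp.choice[Fs FsP] := prims.
exists Fs => xi xic; have tp : tail_primitive c (LP_integrand A e m Gk xi) (fun s => poly_map (Fs ^~ s) xi).
  rewrite (_ : LP_integrand A e m Gk xi =
    fun s => \sum_(f : {ffun 'I_k -> 'I_N}) (\prod_(i < k) xi (f i) 0) *: LP_polar (zc f) s).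
    by apply: tail_primitive_sum => f; apply: tail_primitiveZ.
  by apply/funext => s; exact: LP_integrand_expand.
have [|F [hF hint]] := tail_primitive_exists decay_rate_gt0 (LP_polar_deriv (fun=> xi)).
  exact: LP_polar_decays.
have fE : LP_integrand A e m Gk xi = LP_polar (fun=> xi).
  by apply/funext => s; exact: LP_integrand_polar.
split => //; first by rewrite fE => i; have [] := hint i 0.
rewrite fE in tp.
rewrite -[RHS]/((fun s => poly_map (Fs ^~ s) xi) 0) -(tail_primitive_unique decay_rate_gt0 hF tp).
by apply/colP => i; rewrite /LP_integral fE mxE; have [_ _ ->] := hint i 0.
Qed.

End LyapunovPerron.

(** * The equation for the Lyapunov-Perron integral, and the backward-forward system *)

Section CurveDeriv.
Variables (R : realType) (N : nat).
Implicit Types y : R -> 'cV[R[i]]_N.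

Lemma curve_deriv_epsd (J : set R) y s l : curve_deriv J y s l ->
  forall e, 0 < e -> exists2 d, 0 < d & forall t, J t -> `|t - s| < d ->
    mnorm (y t - y s - (t - s)%:C *: l) <= e * `|t - s|.
Proof.
move=> /cvg_mnormP yl e e0; have := yl e e0.
rewrite /within /dnbhs /within /= => /nbhs_ballP[d /= d0 hd]; exists d => // t Jt ts.
have [->|tns] := eqVneq t s; first by rewrite !subrr scale0r subr0 mnorm0 normr0 mulr0.
have := hd t; rewrite /ball /= distrC => /(_ ts tns Jt) h.
have ts0 : t - s != 0 by rewrite subr_eq0.
have -> : y t - y s - (t - s)%:C *: l = (t - s)%:C *: (((t - s)^-1)%:C *: (y t - y s) - l).
  by rewrite scalerBr scalerA -rmorphM mulfV // scale1r.
by rewrite mnormZr mulrC ler_wpM2r.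
Qed.

Lemma mderiv_curve_deriv (J : set R) y s l : mderiv y s l -> curve_deriv J y s l.
Proof.
move=> /mderiv_epsd yl; apply/cvg_mnormP => e e0; have [d d0 hd] := yl e e0.
rewrite /within /dnbhs /within /=; apply/nbhs_ballP; exists d => //= t.
rewrite /ball /= distrC => ts tns _; have ts0 : t - s != 0 by rewrite subr_eq0.
have -> : ((t - s)^-1)%:C *: (y t - y s) - l =
    ((t - s)^-1)%:C *: (y t - y s - (t - s)%:C *: l).
  by rewrite [RHS]scalerBr scalerA -rmorphM mulVf // scale1r.
rewrite mnormZr normfV mulrC ler_pdivrMr ?normr_gt0 //; exact: hd.
Qed.

(** A curve with one-sided derivatives at the endpoints of an interval extends, by its tangents,
to a curve with genuine derivatives there. *)
Lemma curve_deriv_extend (a b : R) y (l : R -> 'cV[R[i]]_N) : a < b ->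
  (forall s, a <= s <= b -> curve_deriv `[a, b] y s (l s)) ->
  exists2 z, forall s, a <= s <= b -> z s = y s & forall s, a <= s <= b -> mderiv z s (l s).
Proof.
move=> ab y'.
pose z t := if t < a then y a + (t - a)%:C *: l a
            else if b < t then y b + (t - b)%:C *: l b else y t.
have zy s : a <= s <= b -> z s = y s.
  by move=> /andP[sa sb]; rewrite /z !ltNge sa sb.
exists z => // s sab; apply/mderiv_epsd => e e0.
have [d d0 hd] := curve_deriv_epsd (y' s sab) e0.
pose da := if s == a then 1 else s - a; pose db := if s == b then 1 else b - s.
have da0 : 0 < da.
  by rewrite /da; case: eqVneq => // sa; rewrite subr_gt0 lt_neqAle eq_sym sa; case/andP: sab.
have db0 : 0 < db.
  by rewrite /db; case: eqVneq => // sb; rewrite subr_gt0 lt_neqAle sb; case/andP: sab.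
exists (Num.min d (Num.min da db)) => [|t]; first by rewrite !lt_min d0 da0 db0.
rewrite !lt_min => /and3P[td tda tdb]; rewrite (zy s sab).
have [ta|ta] := ltP t a.
  have sa : s = a.
    move: tda; rewrite /da; case: eqVneq => // sa; rewrite ltr_norml => /andP[+ _].
    by rewrite opprB ltrBDr subrK => /(lt_trans ta); rewrite ltxx.
  rewrite /z ta sa -addrA -opprD subrr mnorm0.
  by rewrite mulr_ge0 // ltW.
have [tb|tb] := ltP b t.
  have sb : s = b.
    move: tdb; rewrite /db; case: eqVneq => // sb; rewrite ltr_norml => /andP[_].
    by rewrite ltrBDr subrK => /(lt_trans tb); rewrite ltxx.
  rewrite /z ltNge ta tb /= sb -addrA -opprD subrr mnorm0.
  by rewrite mulr_ge0 // ltW.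
by rewrite zy ?ta //; apply: hd => //=; rewrite in_itv /= ta.
Qed.

End CurveDeriv.

Lemma derive_on_congr (R : realType) N (E : set 'cV[R[i]]_N) f g x (L : 'M[R[i]]_N) :
  (forall y, E y -> f y = g y) -> E x -> derive_on E g x L -> derive_on E f x L.
Proof.
move=> fg Ex /eqoP h; apply/eqoP => e e0.
have /nbhs_ballP[d /= d0 hd] := h e e0.
rewrite /within /=; apply/nbhs_ballP; exists d => //= y yx Ey.
by rewrite (fg y Ey) (fg x Ex); exact: hd yx Ey.
Qed.

Section LyapunovPerronFlow.
Variables (R : realType) (N m k : nat) (A : 'M[R]_N)
  (Gk : ('I_k -> 'cV[R]_N) -> 'cV[R]_N) (beta : nat -> R[i]) (e : nat -> 'cV[R[i]]_N).
Hypothesis spectrum : spectral_data A beta e.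
Hypotheses (m_ge1 : (1 <= m)%N) (m_ltN : (m < N)%N).
Hypothesis spectral_gap : Re (beta m.+1) < Re (beta m).
Variables (c : R) (F : 'cV[R[i]]_N -> R -> 'cV[R[i]]_N).
Hypothesis c0 : 0 < c.

Local Notation Ec := (Ec e m).
Local Notation Es := (Es e m).
Local Notation Pic := (Pic e m).
Local Notation Pis := (Pis e m).
Local Notation Ac := (Ac A e m).
Local Notation As := (As A e m).
Local Notation f := (LP_integrand A e m Gk).

Hypothesis FP : forall xi, Ec xi -> tail_primitive c (f xi) (F xi).

Let Ec_fl s v : Ec v -> Ec (mexp Ac s *m v).
Proof. exact: (Ec_flow spectrum m_ge1 m_ltN spectral_gap). Qed.
Let Es_fl s v : Es v -> Es (mexp As s *m v).
Proof. exact: (Es_flow spectrum m_ge1 m_ltN spectral_gap). Qed.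

Lemma LP_integrandE xi s : f xi s = mexp As (- s) *m (Pis *m GkC Gk (mexp Ac s *m xi)).
Proof. by rewrite /LP_integrand !mexpE. Qed.

Lemma LP_integrand_Es xi s : Es (f xi s).
Proof. by rewrite LP_integrandE; apply: Es_fl; exact: (Es_im spectrum m_ltN). Qed.

Lemma LP_integrand0 xi : f xi 0 = Pis *m GkC Gk xi.
Proof. by rewrite LP_integrandE oppr0 !mexp0 !mul1mx. Qed.

(** The group law of the two flows. *)
Lemma LP_integrand_flow xi t s : f (mexp Ac t *m xi) s = mexp As t *m f xi (s + t).
Proof.
rewrite (LP_integrandE (mexp Ac t *m xi) s) (LP_integrandE xi (s + t)).
move: (Ac) (As) (Pis) => B B' P.
by rewrite (mulmxA (mexp B s)) (mulmxA (mexp B' t)) -!mexpD opprD addrCA subrr addr0.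
Qed.

Lemma LP_primitive_Es xi s : Ec xi -> Es (F xi s).
Proof.
move=> xic; apply/(Es_Pic spectrum).
have h := tail_primitiveMl Pic (FP xic).
have h0 : tail_primitive c (fun s => Pic *m f xi s) (fun=> 0 : 'cV[R[i]]_N).
  rewrite (_ : (fun s => _) = fun=> 0); first exact: tail_primitive0.
  by apply/funext => t; apply/(Es_Pic spectrum); exact: LP_integrand_Es.
have := tail_primitive_unique c0 h h0.
by move=> /(congr1 (fun g => g s)).
Qed.

(** By uniqueness the primitives inherit the translation property of the integrands; this
works for t <= 0, when the translate still decays, and the case t > 0 follows by inverting. *)
Lemma LP_primitive_flow xi t s : Ec xi -> F (mexp Ac t *m xi) s = mexp As t *m F xi (s + t).
Proof.
move=> xic.
have back u xi' r : u <= 0 -> Ec xi' -> F (mexp Ac u *m xi') r = mexp As u *m F xi' (r + u).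
  move=> u0 xic'; have h := tail_primitiveMl (mexp As u) (tail_primitive_shift u0 (FP xic')).
  rewrite (_ : (fun s => _) = f (mexp Ac u *m xi')) in h.
    by rewrite (tail_primitive_unique c0 (FP (Ec_fl u xic')) h).
  by apply/funext => v; rewrite LP_integrand_flow.
have [t0|/ltW t0] := leP t 0; first exact: back.
have nt0 : - t <= 0 by rewrite oppr_le0.
have := back (- t) (mexp Ac t *m xi) (s + t) nt0 (Ec_fl t xic).
by rewrite mulmxA mexpNK mul1mx addrK => ->; rewrite mulmxA mexpKN mul1mx.
Qed.

(** Both sides of I(e^(t Ac) xi) = e^(t As) F xi t are differentiated at t = 0: the left one by
the chain rule, the right one by the product rule. *)
Lemma LP_equation xi (frI : 'cV[R[i]]_N -> 'cV[R[i]]_N) (D : 'M[R[i]]_N) :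
  (forall z, Ec z -> frI z = F z 0) -> Ec xi -> derive_on Ec frI xi D ->
  D *m (Ac *m xi) - As *m frI xi = Pis *m GkC Gk xi.
Proof.
move=> frIE xic /derive_on_eps_cplx hD.
pose Y t := mexp Ac t *m xi; pose Z t := frI (Y t).
have Yc t : Ec (Y t) by exact: Ec_fl.
have Y0 : Y 0 = xi by rewrite /Y mexp0 mul1mx.
have Y' : mderiv Y 0 (Ac *m xi).
  by have := mderivMr xi (@mexp_deriv R N Ac 0); rewrite -mulmxA mexp0 mul1mx.
have Z1 : mderiv Z 0 (D *m (Ac *m xi)).
  apply: (mderiv_chain Y') => r r0; have [d d0 hd] := hD r r0.
  by exists d => // t; rewrite /Z Y0 => td; exact: hd.
have Z2 : mderiv Z 0 (As *m frI xi + Pis *m GkC Gk xi).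
  rewrite (_ : Z = fun t => mexp As t *m F xi t); last first.
    by apply/funext => t; rewrite /Z frIE // /Y LP_primitive_flow // add0r.
  have := mderivM (@mexp_deriv R N As 0) ((FP xic).1 0).
  by rewrite !mexp0 mulmx1 mul1mx LP_integrand0 frIE.
by rewrite (mderiv_uniq Z1 Z2) addrC addKr.
Qed.

(** Variation of constants: the first equation forces yc s = e^(s Ac) xi, and then
e^(-s As) ys s is a primitive of the integrand, as F xi is. *)
Lemma bf_value xi tau yc ys : Ec xi -> 0 < tau ->
  backward_forward_solution A e m Gk xi tau yc ys -> ys 0 = F xi 0 - F xi (- tau).
Proof.
move=> xic tau0 [sp bc fs yc0 ystau].
have tau0' : - tau < 0 by rewrite oppr_lt0.
have i0 : - tau <= (0 : R) <= 0 by apply/andP; split; [exact: ltW tau0'|exact: lexx].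
have [zc zcE zc'] := curve_deriv_extend tau0' bc.
have [zs zsE zs'] := curve_deriv_extend tau0' fs.
have ycE s : - tau <= s <= 0 -> yc s = mexp Ac s *m xi.
  move=> /andP[ts s0]; have : mexp Ac (- 0) *m zc 0 = mexp Ac (- s) *m zc s.
    apply: linear_ode_uniq_itv => // u /andP[su u0].
    have ui : - tau <= u <= 0 by rewrite u0 (le_trans ts su).
    by rewrite zcE //; exact: zc'.
  rewrite !zcE ?ts // yc0 oppr0 mexp0 mul1mx => ->.
  by rewrite mulmxA mexpKN mul1mx.
pose u s := mexp As (- s) *m zs s - F xi s.
have : u 0 = u (- tau).
  apply: (mderiv0_cst (ltW tau0')) => s si; rewrite -(subrr (f xi s)).
  apply: mderivB; last exact: (FP xic).1.
  have := mderivM (@mexpN_deriv R N As s) (zs' s si).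
  by rewrite zsE // mulmxDr mulNmx -(mulmxA _ As) addKr ycE // -LP_integrandE.
rewrite /u oppr0 mexp0 mul1mx !zsE ?lexx ?ltW // ystau mulmx0 sub0r => /eqP.
by rewrite subr_eq addrC => /eqP.
Qed.

Lemma bf_exists xi tau : Ec xi -> 0 < tau ->
  exists yc ys, backward_forward_solution A e m Gk xi tau yc ys.
Proof.
move=> xic tau0; exists (fun s => mexp Ac s *m xi).
exists (fun s => mexp As s *m (F xi s - F xi (- tau))); split.
- move=> s _; split; first exact: Ec_fl.
  apply: Es_fl; apply/(Es_Pic spectrum); rewrite mulmxBr.
  by rewrite !((Es_Pic spectrum _).1 (LP_primitive_Es _ xic)) subrr.
- move=> s _; apply: mderiv_curve_deriv; rewrite mulmxA.
  by apply: mderivMr; exact: mexp_deriv.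
- move=> s _; apply: mderiv_curve_deriv.
  have h : mderiv (fun s => F xi s - F xi (- tau)) s (f xi s).
    by rewrite -[f xi s]subr0; apply: mderivB; [exact: (FP xic).1|exact: mderiv_cst].
  have := mderivM (@mexp_deriv R N As s) h.
  by rewrite -(mulmxA As) LP_integrandE (mulmxA (mexp As s) (mexp As _)) mexpKN mul1mx.
- by rewrite mexp0 mul1mx.
- by rewrite subrr mulmx0.
Qed.

Lemma bf_limit xi : Ec xi -> (fun tau => F xi 0 - F xi (- tau)) @ +oo --> F xi 0.
Proof.
move=> xic; have [_ [K FK]] := FP xic.
apply/cvg_mnormP => r r0; near=> tau.
have tau0 : 0 <= tau by near: tau; exact: nbhs_pinfty_ge.
rewrite addrC addKr mnormN; apply: le_trans (FK _ _) _; first by rewrite oppr_le0.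
rewrite mulrN expRN ler_pdivrMr ?expR_gt0 //.
have : K / (c * r) <= tau by near: tau; apply: nbhs_pinfty_ge; exact: num_real.
rewrite ler_pdivrMr ?mulr_gt0 // => h; apply: le_trans h _.
apply: (@le_trans _ _ (r * (1 + c * tau))); first by lra.
by rewrite ler_wpM2l ?(ltW r0) // expR_ge1Dx.
Unshelve. all: by end_near. Qed.

End LyapunovPerronFlow.

(** * Picard's theorem *)

Section GeometricCauchy.
Variable R : realType.

Lemma geometric_small (D r : R) : 0 <= D -> 0 < r -> exists n : nat, D / 2 ^+ n <= r.
Proof.
move=> D0 r0; exists (Num.bound (D / r)).
rewrite ler_pdivrMr ?exprn_gt0 // -ler_pdivrMl // mulrC.
apply: le_trans (ltW (archi_boundP _)) _; first by rewrite divr_ge0 // ltW.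
by rewrite -natrX ler_nat ltnW // ltn_expl.
Qed.

Lemma le_geometric (x y D : R) : 0 <= D -> (forall n, x <= y + D / 2 ^+ n) -> x <= y.
Proof.
move=> D0 h; apply/ler_addgt0Pr => r r0; have [n hn] := geometric_small D0 r0.
by apply: le_trans (h n) _; rewrite lerD2l.
Qed.

(** The intervals of radius 2 D / 2^n about the u n are nested; the limit is the supremum of their
left ends. *)
Lemma geometric_cauchy (u : nat -> R) (D : R) : 0 <= D ->
  (forall n, `|u n.+1 - u n| <= D / 2 ^+ n) ->
  exists l, forall n, `|l - u n| <= 2 * D / 2 ^+ n.
Proof.
move=> D0 uD; pose a n := 2 * D / 2 ^+ n.
have aS n : a n = 2 * a n.+1.
  by rewrite /a exprS; field; rewrite expf_neq0.
have a0 n : 0 <= a n by rewrite /a divr_ge0 ?mulr_ge0 // exprn_ge0.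
have uD' n : `|u n.+1 - u n| <= a n.+1.
  apply: le_trans (uD n) _; rewrite /a exprS le_eqVlt; apply/orP; left; apply/eqP.
  by field; rewrite expf_neq0.
have lo n p : u n - a n <= u (n + p)%N - a (n + p)%N.
  elim: p => [|p IH]; first by rewrite addn0.
  apply: le_trans IH _; rewrite addnS (aS (n + p)%N).
  by have := uD' (n + p)%N; rewrite ler_norml => /andP[]; have := a0 (n + p).+1; lra.
have hi n p : u (n + p)%N + a (n + p)%N <= u n + a n.
  elim: p => [|p IH]; first by rewrite addn0.
  apply: le_trans _ IH; rewrite addnS (aS (n + p)%N).
  by have := uD' (n + p)%N; rewrite ler_norml => /andP[]; have := a0 (n + p).+1; lra.
pose E := [set u n - a n | n in [set: nat]].
have ubE n : ubound E (u n + a n).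
  move=> _ [p _ <-]; apply: le_trans (lo p n) _; apply: le_trans _ (hi n p).
  by rewrite addnC; have := a0 (n + p)%N; lra.
have supE : has_sup E by split; [exists (u 0%N - a 0%N); exists 0%N|exists (u 0%N + a 0%N)].
exists (sup E) => n; rewrite ler_norml; apply/andP; split.
  rewrite lerBrDr addrC; apply: ub_le_sup; first by case: supE.
  by exists n.
rewrite lerBlDr addrC; apply: ge_sup; [by case: supE|exact: ubE].
Qed.

End GeometricCauchy.

Section Picard.
Variables (R : realType) (N : nat).
Implicit Types (x : 'cV[R]_N) (y w : R -> 'cV[R]_N).

Definition vderiv y (t : R) (l : 'cV[R]_N) := forall i, is_derive t 1 (fun s => y s i 0) (l i 0).

Lemma vderivP y (t : R) (l : 'cV[R]_N) : is_derive t 1 y l <-> vderiv y t l.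
Proof.
split=> [[yd <-] i|h].
  by split; [have /derivable_mxP := yd; exact|rewrite derive_mx // mxE].
have yd : derivable y t 1 by apply/derivable_mxP => i j; rewrite ord1; have [] := h i.
split=> //; rewrite derive_mx //; apply/matrixP => i j; rewrite mxE ord1.
by have [_ <-] := h i.
Qed.

Lemma vderiv_lipschitz y w (a b K : R) : a <= b ->
  (forall t, a <= t <= b -> vderiv y t (w t)) -> (forall t, a <= t <= b -> `|w t| <= K) ->
  `|y b - y a| <= K * (b - a).
Proof.
move=> ab y' wK; have K0 : 0 <= K.
  by apply: le_trans (wK a _) => //; rewrite lexx.
apply: mx_norm_le => [|i j]; first by rewrite mulr_ge0 // subr_ge0.
have wi t : a <= t <= b -> `|w t i j| <= K.
  by move=> tab; apply: le_trans (mx_norm_entry _ _ _) (wK t tab).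
have dK (t : R) : is_derive t 1 (fun t => K * t) K.
  by have := @derZ _ id t K 1 (is_derive_id _ _); rewrite mulr1.
rewrite !mxE ord1 ler_norml; apply/andP; split.
  rewrite lerNl opprB mulrBr.
  have : K * b - K * a >= - y b i 0 - - y a i 0.
    apply: (@MVT_le _ (fun t => - y t i 0) (fun t => - w t i 0) _ (fun=> K)) => // t tab.
      by have ? := y' t tab i; exact: is_deriveN.
    by have := wi t tab; rewrite ord1 ler_norml => /andP[]; lra.
  by lra.
rewrite mulrBr; apply: (@MVT_le _ (fun t => y t i 0) (fun t => w t i 0) _ (fun=> K)) => // t tab.
  exact: y'.
by have := wi t tab; rewrite ord1 ler_norml => /andP[].
Qed.

Definition lipschitz_curve (M : R) y := forall s t, `|y t - y s| <= M * `|t - s|.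

Lemma lipschitz_curve_continuous (M : R) y i : lipschitz_curve M y ->
  forall t, {for t, continuous (fun s => y s i 0)}.
Proof.
move=> yM t; apply/cvgrPdist_le => r r0.
have M1 : 0 < `|M| + 1 by rewrite ltr_wpDl.
apply/nbhs_ballP; exists (r / (`|M| + 1)) => /=; first by rewrite divr_gt0.
move=> s; rewrite /ball /= => ts.
have := mx_norm_entry (y t - y s) i 0; rewrite !mxE => /le_trans; apply.
apply: le_trans (yM s t) _; apply: (@le_trans _ _ ((`|M| + 1) * `|t - s|)).
  by rewrite ler_wpM2r //; apply: le_trans (ler_norm _) _; rewrite lerDl.
by rewrite mulrC -ler_pdivlMr // ltW.
Qed.

(** Choosing the primitives once and for all makes the Picard iteration an operator on curves. *)
Lemma primitive_choice : exists Prim : (R -> 'cV[R]_N) -> (R -> 'cV[R]_N),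
  forall w, (forall i t, {for t, continuous (fun s => w s i 0)}) ->
    Prim w 0 = 0 /\ forall t, -1 < t -> vderiv (Prim w) t (w t).
Proof.
suff /boolp.choice[Prim PrimP] : forall w, exists W : R -> 'cV[R]_N,
    (forall i t, {for t, continuous (fun s => w s i 0)}) ->
    W 0 = 0 /\ forall t, -1 < t -> vderiv W t (w t) by exists Prim.
move=> w.
have [wc|nwc] := pselect (forall i t, {for t, continuous (fun s => w s i 0)}); last first.
  by exists w.
have /boolp.choice[W WP] : forall i, exists F : R -> R,
    F 0 = 0 /\ forall t : R, - 1 < t -> is_derive t 1 F (w t i 0).
  by move=> i; have [F F0 F'] := primitive_exists ltr01 (wc i); exists F.
exists (fun t => \col_i W i t) => _; split.
  by apply/colP => i; rewrite !mxE; have [] := WP i.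
move=> t t1 i; have [_ /(_ t t1)] := WP i; congr (is_derive _ _ _ _).
by apply/funext => s; rewrite mxE.
Qed.

(** Successive approximations y |-> x0 + primitive of F(y), on a time interval [-T, T] so short
that they keep the closed ball of radius d and contract distances by 1/2. Time is clipped to
[-T, T], so that all curves are defined, continuous and M-Lipschitz on the whole line. *)
Lemma picard (F : 'cV[R]_N -> 'cV[R]_N) (x0 : 'cV[R]_N) (L d : R) : 0 < d -> 0 <= L ->
  (forall x z, `|x - x0| <= d -> `|z - x0| <= d -> `|F x - F z| <= L * `|x - z|) ->
  exists2 T : R, 0 < T & exists2 y, y 0 = x0 &
    forall t : R, - T < t < T -> is_derive t 1 y (F (y t)).
Proof.
move=> d0 L0 FL; have [Prim PrimP] := primitive_choice.
pose M := `|F x0| + L * d + 1.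
have M0 : 0 < M by rewrite ltr_wpDl // addr_ge0 // mulr_ge0 // ltW.
have FM x : `|x - x0| <= d -> `|F x| <= M.
  move=> xd; rewrite -[F x](subrK (F x0)).
  apply: le_trans (ler_normD _ _) _; rewrite /M addrC -addrA lerD //.
  apply: le_trans (FL x x0 xd _) _; first by rewrite subrr normr0 ltW.
  by rewrite ler_wpDr // ler_wpM2l.
(* T < 1 for the primitives to exist, M T <= d to stay in the ball, L T <= 1/2 to contract. *)
pose T := Num.min (1 / 2) (Num.min (d / M) (1 / (2 * (L + 1)))).
have L1 : 0 < L + 1 by rewrite ltr_wpDl.
have T0 : 0 < T by rewrite !lt_min !divr_gt0 // mulr_gt0.
have T1 : T < 1 by apply: (@le_lt_trans _ _ (1 / 2)); [rewrite !ge_min lexx|lra].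
have TM : M * T <= d by rewrite mulrC -ler_pdivlMr // !ge_min lexx orbT.
have TL : L * T <= 1 / 2.
  apply: (@le_trans _ _ ((L + 1) * T)); first by rewrite ler_wpM2r ?lerDl // ltW.
  rewrite mulrC -ler_pdivlMr //; apply: (@le_trans _ _ (1 / (2 * (L + 1)))).
    by rewrite !ge_min lexx !orbT.
  by rewrite invfM mulrA.
pose clip (t : R) := Num.max (- T) (Num.min t T).
have clip_itv (t : R) : - T <= clip t <= T.
  by rewrite /clip le_max lexx /= ge_max ge_min lexx orbT andbT; lra.
have clip_id (t : R) : - T <= t <= T -> clip t = t.
  by move=> /andP[h1 h2]; rewrite /clip min_l // max_r.
have clip_lip (s t : R) : `|clip t - clip s| <= `|t - s|.
  have cases (u : R) : [\/ u < - T /\ clip u = - T, - T <= u <= T /\ clip u = u | T < u /\ clip u = T].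
    have [uT|uT] := ltP u (- T).
      by apply: Or31; split=> //; rewrite /clip min_l ?max_l; lra.
    have [Tu|Tu] := ltP T u; first by apply: Or33; split=> //; rewrite /clip min_r ?max_r; lra.
    by apply: Or32; rewrite clip_id ?uT ?Tu.
  have h1 := ler_norm (t - s); have h2 := ler_norm (s - t); rewrite distrC in h2.
  rewrite ler_norml; apply/andP.
  by case: (cases s) => -[c1 ->]; case: (cases t) => -[c2 ->]; split; lra.
have clip0 : clip 0 = 0 by rewrite clip_id //; lra.
(* The curves on which the iteration acts; F is Lipschitz along each of them. *)
pose good y := (forall t, `|y t - x0| <= d) /\ lipschitz_curve M y.
have Fy_cont y : good y -> forall i t, {for t, continuous (fun s => F (y s) i 0)}.
  move=> [yd yM] i; apply: (@lipschitz_curve_continuous (L * M) (fun s => F (y s))) => s t.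
  by apply: le_trans (FL _ _ (yd t) (yd s)) _; rewrite -mulrA ler_wpM2l.
have Prim_lip w K s t : (forall i t, {for t, continuous (fun s => w s i 0)}) ->
    (forall t, - T <= t <= T -> `|w t| <= K) -> - T <= s <= T -> - T <= t <= T ->
    `|Prim w t - Prim w s| <= K * `|t - s|.
  move=> wc wK; have [_ W'] := PrimP w wc.
  wlog st : s t / s <= t => [hw sT tT|sT tT].
    have [st|/ltW ts] := leP s t; first exact: hw.
    by rewrite distrC (distrC t); exact: hw.
  rewrite (ger0_norm (_ : 0 <= t - s)) ?subr_ge0 //.
  apply: vderiv_lipschitz => // r /andP[sr rt].
    by apply: W'; move: sT => /andP[sT _]; apply: lt_le_trans sr; apply: lt_le_trans sT; rewrite ltrN2.
  by apply: wK; move: sT tT => /andP[sT _] /andP[_ tT]; rewrite (le_trans sT) ?(le_trans rt).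
pose step y (t : R) := x0 + Prim (F \o y) (clip t).
have step_good y : good y -> good (step y).
  move=> yg; have wc := Fy_cont y yg; have [W0 _] := PrimP _ wc.
  have WK t : - T <= t <= T -> `|F (y t)| <= M by move=> _; apply: FM; apply: yg.1.
  split=> [t|s t].
    rewrite /step addrAC subrr add0r -[Prim _ _]subr0 -W0.
    apply: le_trans (Prim_lip _ _ _ _ wc WK _ (clip_itv t)) _; first by lra.
    rewrite subr0; apply: le_trans TM; rewrite ler_wpM2l ?(ltW M0) // ler_norml.
    exact: clip_itv.
  rewrite /step opprD addrACA subrr add0r.
  apply: le_trans (Prim_lip _ _ _ _ wc WK (clip_itv s) (clip_itv t)) _.
  by rewrite ler_wpM2l // ltW.
have step_contr y z K : good y -> good z -> (forall t, `|y t - z t| <= K) ->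
    forall t, `|step y t - step z t| <= K / 2.
  move=> yg zg yz t; rewrite /step opprD addrACA subrr add0r.
  have yc := Fy_cont y yg; have zc := Fy_cont z zg.
  have [Y0 Y'] := PrimP _ yc; have [Z0 Z'] := PrimP _ zc.
  have K0 : 0 <= K by apply: le_trans (yz 0).
  pose D (s : R) := Prim (F \o y) s - Prim (F \o z) s.
  have D' (s : R) : -1 < s -> vderiv D s (F (y s) - F (z s)).
    move=> s1 i; rewrite !mxE (_ : (fun _ => _) = (fun s => Prim (F \o y) s i 0) - (fun s => Prim (F \o z) s i 0)).
      by have ? := Y' s s1 i; have ? := Z' s s1 i; exact: is_deriveB.
    by apply/funext => u; rewrite /D !mxE.
  have bnd s : `|F (y s) - F (z s)| <= L * K.
    by apply: le_trans (FL _ _ (yg.1 s) (zg.1 s)) _; rewrite ler_wpM2l.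
  have lip (u v : R) : - T <= u -> u <= v -> `|D v - D u| <= L * K * (v - u).
    move=> Tu uv; apply: (@vderiv_lipschitz D (fun s => F (y s) - F (z s)) u v (L * K) uv) => // r /andP[ur _].
    apply: D'.
    by apply: lt_le_trans ur; apply: lt_le_trans Tu; rewrite ltrN2.
  have D0 : D 0 = 0 by rewrite /D Y0 Z0 subrr.
  apply: (@le_trans _ _ (L * K * T)); last by have := ler_wpM2l K0 TL; lra.
  have /andP[c1 c2] := clip_itv t; have LK : 0 <= L * K by rewrite mulr_ge0.
  have [t0|/ltW t0] := leP 0 (clip t).
    have := lip 0 (clip t); rewrite D0 !subr0 => h; apply: le_trans (h _ t0) _; first lra.
    by rewrite ler_wpM2l.
  have := lip (clip t) 0 c1 t0; rewrite D0 !sub0r normrN => h; apply: le_trans h _.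
  by rewrite ler_wpM2l //; lra.
pose v n := iter n step (fun=> x0).
have vg n : good (v n).
  elim: n => [|n IH]; last exact: step_good.
  split=> [t|s t]; first by rewrite subrr normr0 ltW.
  by rewrite subrr normr0 mulr_ge0 // ltW.
have vS n t : `|v n.+1 t - v n t| <= d / 2 ^+ n.
  elim: n t => [|n IH] t; first by rewrite expr0 divr1; exact: (vg 1%N).1.
  rewrite exprS invfM mulrCA mulrC.
  exact: (step_contr (v n.+1) (v n) _ (vg _) (vg _) IH).
have /boolp.choice[y yP] : forall t, exists l : 'cV[R]_N, forall n, `|l - v n t| <= 2 * d / 2 ^+ n.
  move=> t; have /boolp.choice[l lP] : forall i, exists l, forall n, `|l - v n t i 0| <= 2 * d / 2 ^+ n.
    move=> i; apply: geometric_cauchy; first exact: ltW.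
    move=> n; apply: le_trans (vS n t); have := mx_norm_entry (v n.+1 t - v n t) i 0.
    by rewrite !mxE.
  exists (\col_i l i) => n; apply: mx_norm_le => [|i j].
    by rewrite divr_ge0 ?mulr_ge0 ?exprn_ge0 // ltW.
  by rewrite !mxE ord1.
have dd : 0 <= 2 * d by rewrite mulr_ge0 // ltW.
have yg : good y.
  split=> [t|s t].
    apply: (le_geometric dd) => n; rewrite -(subrKA (v n t)).
    by apply: le_trans (ler_normD _ _) _; rewrite addrC lerD ?yP ?(vg n).1.
  apply: (@le_geometric _ _ _ (2 * (2 * d))) => [|n]; first by rewrite mulr_ge0.
  have -> : y t - y s = (v n t - v n s) + ((y t - v n t) + (v n s - y s)).
    by apply/colP => i; rewrite !mxE; ring.
  apply: le_trans (ler_normD _ _) _; rewrite lerD ?(vg n).2 //.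
  apply: le_trans (ler_normD _ _) _; rewrite (distrC (v n s)).
  by have := yP t n; have := yP s n; lra.
have fix_y t : - T <= t <= T -> step y t = y t.
  move=> tT; apply/eqP; rewrite -subr_eq0 -normr_eq0 eq_le normr_ge0 andbT.
  apply: (@le_geometric _ _ _ (2 * (2 * d))) => [|n]; first by rewrite mulr_ge0.
  rewrite add0r -(subrKA (v n.+1 t)); apply: le_trans (ler_normD _ _) _.
  have h1 := step_contr y (v n) (2 * d / 2 ^+ n) yg (vg n) (fun t => yP t n) t.
  have h2 : `|v n.+1 t - y t| <= 2 * d / 2 ^+ n / 2.
    by rewrite distrC; apply: le_trans (yP t n.+1) _; rewrite exprS invfM mulrCA mulrC.
  have h3 : 0 <= 2 * d / 2 ^+ n by rewrite divr_ge0 // exprn_ge0.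
  by apply: le_trans (lerD h1 h2) _; lra.
have wc := Fy_cont y yg; have [W0 W'] := PrimP _ wc.
exists T => //; exists (fun t => x0 + Prim (F \o y) t); first by rewrite W0 addr0.
move=> t /andP[t1 t2]; have tT : - T <= t <= T by rewrite !ltW.
have -> : x0 + Prim (F \o y) t = y t by rewrite -(fix_y t tT) /step clip_id.
apply/vderivP => i.
rewrite (_ : (fun _ => _) = cst (x0 i 0) + (fun s => Prim (F \o y) s i 0)).
  have ? : is_derive t 1 (fun s => Prim (F \o y) s i 0) (F (y t) i 0).
    by apply: W'; apply: lt_trans t1; rewrite ltrN2.
  by apply: is_derive_eq; rewrite add0r.
by apply/funext => s; rewrite mxE.
Qed.

End Picard.

(** * Local solutions of the differential equation *)

Section LocalSolutions.
Variables (R : realType) (N : nat).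

Lemma smooth_continuous (V W : normedModType R) n (f : V -> W) : smooth n f -> continuous f.
Proof. by case: n => [//|n] [fd _] x; exact: differentiable_continuous. Qed.

Lemma mulmx_norm_bound (A : 'M[R]_N) : exists2 C, 0 <= C & forall v : 'cV[R]_N, `|A *m v| <= C * `|v|.
Proof.
exists (mnorm (cplx A) * (N * 1)%:R) => [|v]; first by rewrite mulr_ge0 // mnorm_ge0.
apply: le_trans (norm_le_mnorm_cplx _) _; rewrite /cplx map_mxM.
apply: le_trans (mnormM _ _) _; rewrite -mulrA ler_wpM2l ?mnorm_ge0 //.
exact: mnorm_cplx_le.
Qed.

Lemma vderiv_line (G : 'cV[R]_N -> 'cV[R]_N) (z v : 'cV[R]_N) (t : R) :
  differentiable G (z + t *: v) ->
  is_derive t 1 (fun s : R => G (z + s *: v)) ('d G (z + t *: v) v).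
Proof.
move=> Gd; rewrite -deriveE //.
have E : (fun h : R => h^-1 *: ((fun s : R => G (z + s *: v)) (h *: 1 + t) - G (z + t *: v))) =
    (fun h : R => h^-1 *: (G (h *: v + (z + t *: v)) - G (z + t *: v))).
  apply/funext => h; congr (_ *: (G _ - _)).
  by rewrite [h *: 1]mulr1 scalerDl addrCA.
split; last by rewrite /derive E.
by rewrite /derivable E; exact: diff_derivable.
Qed.

(** The derivatives in the finitely many basis directions are bounded near x0, so the derivative
along segments is bounded there, and balls are convex. *)
Lemma C1_locally_lipschitz (G : 'cV[R]_N -> 'cV[R]_N) (x0 : 'cV[R]_N) :
  (forall x, differentiable G x) -> (forall v, continuous (fun x => 'd G x v)) ->
  exists2 d : R, 0 < d & exists2 L : R, 0 <= L &
    forall x z, `|x - x0| <= d -> `|z - x0| <= d -> `|G x - G z| <= L * `|x - z|.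
Proof.
move=> Gd Gc; pose dl (j : 'I_N) : 'cV[R]_N := delta_mx j 0.
pose B : R := \sum_j `|'d G x0 (dl j)| + 1.
have : nbhs x0 [set x | forall j, `|'d G x0 (dl j) - 'd G x (dl j)| <= 1].
  apply: (@filter_forall _ _ _ (nbhs x0) (nbhs_filter x0)) => j.
  by have /cvgrPdist_le/(_ 1 ltr01) := Gc (dl j) x0.
move=> /nbhs_ballP[d /= d0 hd]; exists (d / 2); first by rewrite divr_gt0.
have B0 : 0 <= B by rewrite addr_ge0 // sumr_ge0.
exists (N%:R * B); first by rewrite mulr_ge0.
have dB x v : `|x - x0| <= d / 2 -> `|'d G x v| <= N%:R * B * `|v|.
  move=> xd; rewrite {1}(matrix_sum_delta v) linear_sum.
  apply: le_trans (ler_norm_sum _ _ _) _.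
  apply: (@le_trans _ _ (\sum_(i < N) B * `|v|)); last first.
    by rewrite sumr_const card_ord -mulrA mulr_natl.
  apply: ler_sum => j _; rewrite big_ord1 linearZ normrZ mulrC.
  apply: ler_pM => //; last exact: mx_norm_entry.
  have -> : 'd G x (dl j) = 'd G x0 (dl j) - ('d G x0 (dl j) - 'd G x (dl j)) by rewrite opprB addrC subrK.
  apply: le_trans (ler_normB _ _) _; rewrite lerD //.
    by rewrite (bigD1 j) //= lerDl sumr_ge0.
  apply: hd; rewrite -ball_normE /= distrC; apply: le_lt_trans xd _.
  by rewrite ltr_pdivrMr // ltr_pMr // ltr1n.
move=> x z xd zd; have := @vderiv_lipschitz R N (fun s => G (z + s *: (x - z)))
  (fun s => 'd G (z + s *: (x - z)) (x - z)) 0 1 (N%:R * B * `|x - z|) ler01.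
have E : z + (x - z) = x by rewrite addrC subrK.
rewrite scale1r scale0r addr0 E subr0 mulr1; apply=> t /andP[t0 t1].
  by apply/vderivP; exact: vderiv_line.
apply: dB; have -> : z + t *: (x - z) - x0 = (1 - t) *: (z - x0) + t *: (x - x0).
  by apply/colP => i; rewrite !mxE; ring.
apply: le_trans (ler_normD _ _) _; rewrite !normrZ (ger0_norm t0) ger0_norm ?subr_ge0 //.
have t1' : 0 <= 1 - t by rewrite subr_ge0.
have := ler_wpM2l t1' zd; have := ler_wpM2l t0 xd; lra.
Qed.

Lemma local_solution (A : 'M[R]_N) (G : 'cV[R]_N -> 'cV[R]_N) n (x0 : 'cV[R]_N) :
  smooth n.+1 G ->
  exists2 T : R, 0 < T & exists2 y, y 0 = x0 & solution_on A G (- T) T y.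
Proof.
move=> [Gd Gs].
have [d d0 [L L0 GL]] := C1_locally_lipschitz x0 Gd (fun v => smooth_continuous (Gs v)).
have [C C0 AC] := mulmx_norm_bound A.
apply: (@picard R N (fun y => A *m y + G y) x0 (C + L) d d0); first exact: addr_ge0.
move=> x z xd zd; rewrite opprD addrACA -mulmxBr mulrDl.
by apply: le_trans (ler_normD _ _) _; rewrite lerD // GL.
Qed.

End LocalSolutions.

(** * Tangency of the vector field to an invariant graph *)

Section RealCurves.
Variable R : realType.

Lemma cplxM p q r (M : 'M[R]_(p, q)) (M' : 'M[R]_(q, r)) : cplx (M *m M') = cplx M *m cplx M'.
Proof. exact: map_mxM. Qed.
Lemma cplxD p q (M M' : 'M[R]_(p, q)) : cplx (M + M') = cplx M + cplx M'.
Proof. exact: map_mxD. Qed.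
Lemma cplxB p q (M M' : 'M[R]_(p, q)) : cplx (M - M') = cplx M - cplx M'.
Proof. exact: map_mxB. Qed.
Lemma cplx1 n : cplx (1%:M : 'M[R]_n) = 1%:M.
Proof. exact: map_mx1. Qed.
Lemma cplx0 p q : cplx (0 : 'M[R]_(p, q)) = 0.
Proof. exact: map_mx0. Qed.
Lemma cplx_inj p q : injective (@cplx R p q).
Proof. by move=> M M' /matrixP h; apply/matrixP => i j; have := h i j; rewrite !mxE => -[]. Qed.

Lemma is_derive_mderiv N (y : R -> 'cV[R]_N) (t : R) (l : 'cV[R]_N) :
  is_derive t 1 y l -> mderiv (fun s => cplx (y s)) t (cplx l).
Proof.
move=> /vderivP y' i j; rewrite ord1 mxE; split => /=.
  have := y' i; congr (is_derive _ _ _ _).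
  by apply/funext => s; rewrite mxE.
rewrite (_ : (fun _ => _) = cst 0); first exact: is_derive_cst.
by apply/funext => s; rewrite mxE.
Qed.

End RealCurves.

Section Invariance.
Variables (R : realType) (N m : nat) (A : 'M[R]_N) (beta : nat -> R[i])
  (e : nat -> 'cV[R[i]]_N).
Hypothesis spectrum : spectral_data A beta e.
Hypotheses (m_ge1 : (1 <= m)%N) (m_ltN : (m < N)%N).
Hypothesis spectral_gap : Re (beta m.+1) < Re (beta m).

Local Notation P := (PcR m e).
Local Notation Q := (1%:M - PcR m e).

Let PicE : Pic e m = cplx P := Pic_real spectrum m_ge1 m_ltN spectral_gap.

Lemma PisE : Pis e m = cplx Q.
Proof. by rewrite cplxB cplx1 -PicE. Qed.

Lemma EcRP x : EcR e m x <-> P *m x = x.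
Proof.
rewrite /EcR /= (EcP spectrum m_ltN) PicE -cplxM; split=> [/cplx_inj//|->//].
Qed.

Lemma EsRP x : EsR e m x <-> P *m x = 0.
Proof.
rewrite /EsR /= (Es_Pic spectrum) PicE -cplxM -cplx0; split=> [/cplx_inj//|->//].
Qed.

Lemma PcR_commute : P *m A = A *m P.
Proof.
by apply: cplx_inj; rewrite !cplxM -PicE (splitting_commute spectrum m_ge1 m_ltN spectral_gap).
Qed.

Lemma PcR_idem : P *m P = P.
Proof. by apply: cplx_inj; rewrite cplxM -PicE (Pic_idem spectrum m_ltN). Qed.

(** The solution y through a point of the graph satisfies Q y = h (P y) for a short time, and
differentiating at 0 gives the equation. The graph is invariant only forward in time, so this
relation is compared with first-order expansions at a single small t > 0, which suffices because
y itself is differentiable at 0. *)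
Lemma invariance_equation n (G h : 'cV[R]_N -> 'cV[R]_N) (Dh : 'cV[R]_N -> 'M[R]_N) (r : R) :
  smooth n.+1 G ->
  (forall xi, EcR e m xi -> EsR e m (h xi)) ->
  (forall xi, EcR e m xi -> derive_on (EcR e m) h xi (Dh xi)) ->
  locally_invariant A G [set xi + h xi | xi in EcR e m `&` ball 0 r] ->
  forall xi, EcR e m xi -> ball 0 r xi ->
  Dh xi *m (A *m xi + P *m G (xi + h xi)) = A *m h xi + Q *m G (xi + h xi).
Proof.
move=> Gs hs hD inv xi xic xir; set x0 := xi + h xi.
have [T T0 [y y0 ysol]] := local_solution A x0 Gs.
have T0' : - T < 0 < T by rewrite oppr_lt0 T0.
have My0 : [set xi + h xi | xi in EcR e m `&` ball 0 r] (y 0).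
  by rewrite y0; exists xi.
have [alpha alpha0 [_ Myt]] := inv _ _ _ _ T0' ysol My0.
have Px z : EcR e m z -> P *m (z + h z) = z.
  by move=> zc; rewrite mulmxDr ((EcRP z).1 zc) ((EsRP _).1 (hs z zc)) addr0.
have graph t : 0 <= t -> t < alpha -> EcR e m (P *m y t) /\ Q *m y t = h (P *m y t).
  move=> t0 ta; have [|z [zc _] <-] := Myt t; first by rewrite t0 add0r.
  by rewrite Px //; split=> //; rewrite mulmxBl mul1mx Px // addrC addKr.
set v := A *m x0 + G x0; set L := Dh xi.
have Pv : P *m v = A *m xi + P *m G x0.
  by rewrite mulmxDr mulmxA PcR_commute -mulmxA Px.
have Qv : Q *m v = A *m h xi + Q *m G x0.
  rewrite [LHS]mulmxBl mul1mx Pv [Q *m _]mulmxBl mul1mx /v /x0 mulmxDr.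
  by apply/colP => i; rewrite !mxE; ring.
rewrite -Pv -Qv; apply/esym/eqP; rewrite -subr_eq0; apply/eqP/cplx_inj; rewrite cplx0.
have y' : mderiv (fun s => cplx (y s)) 0 (cplx v).
  by apply: is_derive_mderiv; have := ysol 0 T0'; rewrite y0.
have [C [C0 [d1 d10 PYlip]]] := mderiv_lipschitz (mderivMl (cplx P) y').
have W' := mderivMl (cplx (Q - L *m P)) y'.
apply: mnorm_le0; apply/ler_addgt0Pr => eps eps0; rewrite add0r.
have k0 : 0 < eps / (C + 1) by rewrite divr_gt0 // addr_gt0.
have [d2 d20 hd] := derive_on_eps_real (hD xi xic) k0.
have /mderiv_epsd/(_ _ k0)[d3 d30 Wd] := W'.
(* Small enough for the three expansions and for y t to lie on the graph. *)
pose t := Num.min (Num.min (d1 / 2) (alpha / 2)) (Num.min (d2 / C) (d3 / 2)).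
have t0 : 0 < t by rewrite !lt_min !divr_gt0.
have half (z : R) : 0 < z -> z / 2 < z by move=> z0; lra.
have td1 : `|t - 0| < d1.
  by rewrite subr0 gtr0_norm // (le_lt_trans _ (half _ d10)) // !ge_min lexx.
have td3 : `|t - 0| < d3.
  by rewrite subr0 gtr0_norm // (le_lt_trans _ (half _ d30)) // !ge_min lexx !orbT.
have ta : t < alpha.
  by rewrite (le_lt_trans _ (half _ alpha0)) // !ge_min lexx orbT.
have tC : C * t <= d2 by rewrite mulrC -ler_pdivlMr // !ge_min lexx !orbT.
have [ytc yth] := graph t (ltW t0) ta; have [_ y0h] := graph 0 (lexx _) alpha0.
have Py0 : P *m y 0 = xi by rewrite y0 Px.
have lip : mnorm (cplx (P *m y t - xi)) <= C * t.
  have := PYlip t td1; rewrite subr0 (gtr0_norm t0); apply: le_trans.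
  by rewrite -!cplxM -cplxB Py0.
have h1 := hd _ ytc (le_trans lip tC).
have h2 := Wd t td3.
have E : cplx (Q - L *m P) *m cplx (y t) - cplx (Q - L *m P) *m cplx (y 0) =
    cplx (h (P *m y t) - h xi - L *m (P *m y t - xi)).
  rewrite -!cplxM -cplxB; congr cplx; rewrite mulmxBl [(Q - L *m P) *m y 0]mulmxBl yth y0h Py0.
  by rewrite -!mulmxA Py0 mulmxBr; apply/colP => i; rewrite !mxE; ring.
rewrite E subr0 (gtr0_norm t0) in h2.
have -> : cplx (Q *m v - L *m (P *m v)) = cplx (Q - L *m P) *m cplx v.
  by rewrite -cplxM [(Q - L *m P) *m v]mulmxBl mulmxA.
rewrite -(ler_pM2l t0) -{1}(gtr0_norm t0) -mnormZr.
set X := cplx (h _ - _ - _) in h1 h2.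
have -> : t%:C *: (cplx (Q - L *m P) *m cplx v) = X - (X - t%:C *: (cplx (Q - L *m P) *m cplx v)).
  by rewrite subKr.
apply: le_trans (mnormB _ _) _; apply: le_trans (lerD h1 h2) _.
apply: (@le_trans _ _ (eps / (C + 1) * (C * t) + eps / (C + 1) * t)).
  by rewrite lerD2r ler_wpM2l // ltW.
rewrite le_eqVlt; apply/orP; left; apply/eqP; field.
by rewrite gt_eqF // addr_gt0.
Qed.

End Invariance.

(** * Estimates for homogeneous maps *)

Section HomogeneousEstimates.
Variables (R : realType) (N k : nat).
Implicit Types x y z v : 'cV[R]_N.

(** Telescoping: one factor is exchanged at a time. *)
Lemma prod_diff_bound (I : Type) (r : seq I) (y z : I -> R[i]) (M eps : R) :
  0 <= M -> 0 <= eps -> (forall i, cnorm (y i) <= M) -> (forall i, cnorm (z i) <= M) ->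
  (forall i, cnorm (y i - z i) <= eps * M) ->
  cnorm (\prod_(i <- r) y i - \prod_(i <- r) z i) <= eps * (size r)%:R * M ^+ size r.
Proof.
move=> M0 eps0 yM zM yz; elim: r => [|i r IH].
  by rewrite !big_nil subrr cnorm0 mulr0 mul0r.
have PM : cnorm (\prod_(i <- r) y i) <= M ^+ size r.
  apply: le_trans (cnorm_prod _ _) _; elim: (r) => [|j s IHs]; first by rewrite big_nil expr0.
  rewrite big_cons exprS ler_pM ?cnorm_ge0 //.
  by apply: prodr_ge0 => l _; exact: cnorm_ge0.
rewrite !big_cons /= exprS -natr1.
have -> : forall p q p' q' : R[i], p * q - p' * q' = (p - p') * q + p' * (q - q').
  by move=> *; ring.
apply: le_trans (cnormD _ _) _.
have -> : eps * ((size r)%:R + 1) * (M * M ^+ size r) =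
   eps * M * M ^+ size r + M * (eps * (size r)%:R * M ^+ size r) by ring.
apply: lerD; apply: le_trans (cnormM _ _) _; apply: ler_pM => //; exact: cnorm_ge0.
Qed.

Variable Gk : ('I_k -> 'cV[R]_N) -> 'cV[R]_N.

Lemma GkC_poly_map (z : 'cV[R[i]]_N) : GkC Gk z =
  poly_map (fun s : {ffun 'I_k -> 'I_N} => cplx (Gk (fun i => delta_mx (s i) 0))) z.
Proof. by []. Qed.

Lemma poly_map_bound (J : {ffun 'I_k -> 'I_N} -> 'cV[R[i]]_N) :
  exists2 C, 0 <= C & forall z : 'cV[R[i]]_N, mnorm (poly_map J z) <= C * mnorm z ^+ k.
Proof.
exists (\sum_s mnorm (J s)); first by apply: sumr_ge0 => s _; exact: mnorm_ge0.
move=> z; apply: le_trans (mnorm_sum _ _ _) _; rewrite mulr_suml; apply: ler_sum => s _.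
apply: le_trans (mnormZ _ _) _; rewrite mulrC ler_wpM2l ?mnorm_ge0 //.
apply: le_trans (cnorm_prod _ _) _; rewrite -[k in _ ^+ k]card_ord -prodr_const.
by apply: ler_prod => i _; rewrite cnorm_ge0 cnorm_le_mnorm.
Qed.

Lemma poly_map_diff_bound (J : {ffun 'I_k -> 'I_N} -> 'cV[R[i]]_N) :
  exists2 C, 0 <= C & forall (y z : 'cV[R[i]]_N) (M eps : R), 0 <= eps ->
    mnorm y <= M -> mnorm z <= M -> mnorm (y - z) <= eps * M ->
    mnorm (poly_map J y - poly_map J z) <= C * (eps * M ^+ k).
Proof.
exists (k%:R * \sum_s mnorm (J s)).
  by rewrite mulr_ge0 // sumr_ge0 // => s _; exact: mnorm_ge0.
move=> y z M eps eps0 yM zM yz; have M0 := le_trans (mnorm_ge0 y) yM.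
rewrite /poly_map -sumrB; apply: le_trans (mnorm_sum _ _ _) _.
rewrite mulrAC mulr_sumr; apply: ler_sum => s _; rewrite -scalerBl.
apply: le_trans (mnormZ _ _) _; rewrite ler_wpM2r ?mnorm_ge0 //.
have := @prod_diff_bound _ (index_enum 'I_k) (fun i => y (s i) 0) (fun i => z (s i) 0) M eps M0 eps0.
rewrite -[index_enum _]enumT size_enum_ord => h.
have E : k%:R * (eps * M ^+ k) = eps * k%:R * M ^+ k by ring.
rewrite E; apply: h => i.
- by apply: le_trans (cnorm_le_mnorm _ _ _) yM.
- by apply: le_trans (cnorm_le_mnorm _ _ _) zM.
- by apply: le_trans yz; have := cnorm_le_mnorm (y - z) (s i) 0; rewrite !mxE.
Qed.

Hypothesis Gk_multilinear : multilinear Gk.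

(** The arguments are replaced by basis vectors one position at a time. *)
Lemma multilinear_basis0 (F : ('I_k -> 'cV[R]_N) -> 'cV[R]_N) : multilinear F ->
  (forall s : 'I_k -> 'I_N, F (fun i => delta_mx (s i) 0) = 0) -> forall v : 'I_k -> 'cV[R]_N, F v = 0.
Proof.
move=> Fm F0; have F00 (v : 'I_k -> 'cV[R]_N) i : F [eta v with i |-> 0] = 0.
  have := Fm v i 1 0 0; rewrite !scale1r addr0 => /eqP; rewrite -subr_eq0 opprD.
  by rewrite addrA subrr sub0r oppr_eq0 => /eqP.
have Fsum (v : 'I_k -> 'cV[R]_N) i (I : finType) (a : I -> R) (u : I -> 'cV[R]_N) :
    F [eta v with i |-> \sum_j a j *: u j] = \sum_j a j *: F [eta v with i |-> u j].
  elim: (index_enum I) => [|j r IH]; first by rewrite !big_nil.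
  by rewrite !big_cons Fm IH.
suff H n : (n <= k)%N -> forall v : 'I_k -> 'cV[R]_N,
    (forall i : 'I_k, (n <= i)%N -> exists j, v i = delta_mx j 0) -> F v = 0.
  by move=> v; apply: (H k) => // i; rewrite leqNgt ltn_ord.
elim: n => [_ v vb|n IH nk v vb].
  have /boolp.choice[s sP] : forall i, exists j, v i = delta_mx j 0 by move=> i; exact: vb.
  by rewrite (_ : v = fun i => delta_mx (s i) 0) //; apply/funext.
pose i0 := Ordinal nk.
have -> : v = [eta v with i0 |-> \sum_j v i0 j 0 *: delta_mx j 0].
  apply/funext => i /=; case: eqP => [->|//].
  by rewrite [LHS]matrix_sum_delta; apply: eq_bigr => j _; rewrite big_ord1.
rewrite Fsum big1 // => j _; rewrite IH ?scaler0 //; first exact: ltnW.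
move=> i ni /=; case: eqP => [_|/eqP ii0]; first by exists j.
by apply: vb; rewrite ltn_neqAle ni andbT; apply: contra ii0 => /eqP E; apply/eqP/val_inj.
Qed.

Lemma multilinear_expansion (v : 'I_k -> 'cV[R]_N) :
  Gk v = \sum_(s : {ffun 'I_k -> 'I_N}) (\prod_(i < k) v i (s i) 0) *: Gk (fun i => delta_mx (s i) 0).
Proof.
pose F (v : 'I_k -> 'cV[R]_N) := Gk v -
  \sum_(s : {ffun 'I_k -> 'I_N}) (\prod_(i < k) v i (s i) 0) *: Gk (fun i => delta_mx (s i) 0).
suff : F v = 0 by move=> /eqP; rewrite subr_eq0 => /eqP.
apply: multilinear_basis0 => [w i a u u'|s].
  rewrite /F Gk_multilinear scalerBr addrACA -opprD; congr (_ - _).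
  rewrite scaler_sumr -big_split /=; apply: eq_bigr => s _; rewrite scalerA -scalerDl.
  congr (_ *: _); rewrite (bigD1 i) //= [X in _ = a * X + _](bigD1 i) //=.
  rewrite [X in _ = _ + X](bigD1 i) //= eqxx !mxE.
  have E (x : 'cV[R]_N) : \prod_(j < k | j != i) [eta w with i |-> x] j (s j) 0 = \prod_(j < k | j != i) w j (s j) 0.
    by apply: eq_bigr => j /negPf ji /=; rewrite ji.
  by rewrite !E; ring.
rewrite /F (bigD1 (finfun s)) //= [X in _ - (_ + X)]big1 => [|s' ss']; last first.
  have [i si] : exists i, s' i != s i.
    apply/existsP; rewrite -negb_forall; apply: contra ss' => /forallP h.
    by apply/eqP/ffunP => i; rewrite ffunE; apply/eqP.
  by rewrite (bigD1 i) //= mxE (negPf si) mul0r scale0r.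
rewrite addr0 big1 => [|i _]; last by rewrite ffunE mxE !eqxx.
rewrite scale1r (_ : (fun i => delta_mx (finfun s i) 0) = (fun i => delta_mx (s i) 0)) ?subrr //.
by apply/funext => i; rewrite ffunE.
Qed.

(** Both sides have the same expansion over the standard basis. *)
Lemma GkC_real z : GkC Gk (cplx z) = cplx (Gk (fun=> z)).
Proof.
rewrite multilinear_expansion /cplx raddf_sum /=; apply: eq_bigr => s _.
apply/colP => i; rewrite !mxE rmorphM rmorph_prod; congr (_ * _).
by apply: eq_bigr => j _; rewrite mxE.
Qed.

End HomogeneousEstimates.

(** * The defect of an invariant graph in the leading-order equation *)

Section RemainderEstimates.
Variables (R : realType) (N k : nat).
Local Notation nr v := (mnorm (cplx v)).

Lemma nbhs_mnorm (x : 'cV[R]_N) (S : set 'cV[R]_N) : nbhs x S ->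
  exists2 d, 0 < d & forall y, nr (y - x) <= d -> S y.
Proof.
move=> /nbhs_ballP[d /= d0 hd]; exists (d / 2) => [|y yx]; first by rewrite divr_gt0.
apply: hd; rewrite -ball_normE /= distrC; apply: le_lt_trans (norm_le_mnorm_cplx _) _.
by apply: le_lt_trans yx _; rewrite ltr_pdivrMr // ltr_pMr // ltr1n.
Qed.

Lemma flat_small (E : set 'cV[R]_N) (h : 'cV[R]_N -> 'cV[R]_N) (L : 'M[R]_N) :
  derive_on E h 0 L -> h 0 = 0 -> (forall v, E v -> L *m v = 0) ->
  forall eps, 0 < eps -> exists2 d, 0 < d & forall x, E x -> nr x <= d -> nr (h x) <= eps * nr x.
Proof.
move=> hD h0 L0 eps eps0; have [d d0 hd] := derive_on_eps_real hD eps0.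
exists d => // x Ex xd; have := hd x Ex; rewrite subr0 h0 subr0 L0 // subr0; exact.
Qed.

(** Pointwise continuity of x |-> Dh x v for the finitely many projected basis vectors v gives
smallness in operator norm. *)
Lemma flat_derivative_small (E : set 'cV[R]_N) (Dh : 'cV[R]_N -> 'M[R]_N) (P : 'M[R]_N) :
  (forall v : 'cV[R]_N, E (P *m v)) -> E 0 ->
  (forall v, E v -> {within E, continuous (fun x => Dh x *m v)}) ->
  (forall v, E v -> Dh 0 *m v = 0) ->
  forall eps, 0 < eps -> exists2 d, 0 < d & forall x, E x -> nr x <= d ->
    forall v : 'cV[R]_N, nr (Dh x *m (P *m v)) <= eps * nr v.
Proof.
move=> EP E0 Dc D0 eps eps0.
have k0 : 0 < (N * 1)%:R + 1 :> R by rewrite ltr_wpDl.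
have ek : 0 < eps / ((N * 1)%:R + 1) by rewrite divr_gt0.
pose p (j : 'I_N) : 'cV[R]_N := P *m delta_mx j 0.
have : nbhs (0 : 'cV[R]_N) [set x | forall j, E x -> `|Dh x *m p j| <= eps / ((N * 1)%:R + 1)].
  apply: (@filter_forall _ _ (fun j x => E x -> `|Dh x *m p j| <= eps / ((N * 1)%:R + 1))
    (nbhs (0 : 'cV[R]_N)) (nbhs_filter (0 : 'cV[R]_N))) => j.
  have /subspace_continuousP/(_ 0 E0)/cvgrPdist_le/(_ _ ek) := Dc _ (EP (delta_mx j 0)).
  move=> /nbhs_ballP[d /= d0 hd]; apply/nbhs_ballP; exists d => //= x xd Ex.
  by have := hd x xd Ex; rewrite /from_subspace /= D0 // sub0r normrN.
move=> /nbhs_mnorm[d d0 hd]; exists d => // x Ex xd v.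
have {}hd j : nr (Dh x *m p j) <= eps.
  apply: le_trans (mnorm_cplx_le _) _.
  apply: le_trans (ler_wpM2l _ (hd x _ j Ex)) _ => //; first by rewrite subr0.
  by rewrite mulrCA ler_piMr ?(ltW eps0) // ler_pdivrMr // mul1r lerDl.
rewrite [in leLHS](matrix_sum_delta v) !mulmx_sumr /cplx raddf_sum /=.
apply: le_trans (mnorm_sum _ _ _) _; rewrite mnorm_cplx mulr_sumr; apply: ler_sum => j _.
rewrite !big_ord1 -!scalemxAr map_mxZ -[map_mx _ _]/(cplx _) mnormZr mulrC.
by apply: ler_wpM2r => //; exact: hd.
Qed.

Variables (G : 'cV[R]_N -> 'cV[R]_N) (Gk : ('I_k -> 'cV[R]_N) -> 'cV[R]_N).
Hypothesis Gk_multilinear : multilinear Gk.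
Hypothesis G_expansion : (fun y => G y - Gk (fun=> y))
                   =O_ (nbhs (0 : 'cV[R]_N)) (fun y => `|y| ^+ k.+1).

Lemma expansion_bound : exists2 C, 0 < C & exists2 d, 0 < d &
  forall y, nr y <= d -> nr (G y - Gk (fun=> y)) <= C * nr y ^+ k.+1.
Proof.
have /eqO_exP[C C0 /nbhs_mnorm[d d0 hd]] := G_expansion.
exists ((N * 1)%:R * C + 1); first by rewrite ltr_wpDl // mulr_ge0 // ltW.
exists d => // y yd; have := hd y; rewrite subr0 => /(_ yd) h.
apply: le_trans (mnorm_cplx_le _) _; apply: le_trans (ler_wpM2l _ h) _ => //.
rewrite mulrA; apply: ler_pM => //; first by rewrite mulr_ge0 // ltW.
  by rewrite lerDl.
by rewrite ger0_norm ?exprn_ge0 // lerXn2r ?nnegrE ?mnorm_ge0 // norm_le_mnorm_cplx.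
Qed.

(** Three terms of order o(|x|^k): Gk x - Gk z with z = x + h x, since h x = o(|x|) and Gk is
homogeneous of degree k; Gk z - G z, which is O(|z|^(k+1)); and Dh x (P G z), since Dh x tends to
0 and G z = O(|z|^k). *)
Lemma defect_small (E : set 'cV[R]_N) (h : 'cV[R]_N -> 'cV[R]_N)
    (Dh : 'cV[R]_N -> 'M[R]_N) (P : 'M[R]_N) :
  (forall v : 'cV[R]_N, E (P *m v)) -> E 0 -> h 0 = 0 -> derive_on E h 0 (Dh 0) ->
  (forall v, E v -> {within E, continuous (fun x => Dh x *m v)}) ->
  (forall v, E v -> Dh 0 *m v = 0) ->
  forall eta, 0 < eta -> exists2 d, 0 < d & forall x, E x -> nr x <= d ->
    nr (Gk (fun=> x) - G (x + h x) + Dh x *m (P *m G (x + h x))) <= eta * nr x ^+ k.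
Proof.
move=> EP E0 h0 hD Dc D0 eta eta0.
have [C1 C10 Gdiff] := poly_map_diff_bound (fun s : {ffun 'I_k -> 'I_N} => cplx (Gk (fun i => delta_mx (s i) 0))).
have [C3 C30 Gbnd] := poly_map_bound (fun s : {ffun 'I_k -> 'I_N} => cplx (Gk (fun i => delta_mx (s i) 0))).
have [C2 C20 [d1 d10 Gexp]] := expansion_bound.
have two0 : 0 < 2 ^+ k :> R by rewrite exprn_gt0.
(* Each of the three terms gets a third of eta, and |z| <= M = 2 |x|, which explains 2 ^+ k. *)
pose e1 := Num.min 1 (eta / 3 / ((C1 + 1) * 2 ^+ k)).
pose e2 := eta / 3 / ((C2 + C3 + 1) * 2 ^+ k).
have e10 : 0 < e1 by rewrite lt_min ltr01 !divr_gt0 // mulr_gt0 // ltr_wpDl.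
have e20 : 0 < e2 by rewrite !divr_gt0 // mulr_gt0 // ltr_wpDl // addr_ge0 // ltW.
have [d2 d20 hsmall] := flat_small hD h0 D0 e10.
have [d3 d30 Dhsmall] := flat_derivative_small EP E0 Dc D0 e20.
exists (Num.min (Num.min d2 d3) (Num.min (1 / 2) (Num.min (d1 / 2) (eta / 3 / (C2 * 2 ^+ k * 2))))).
  by rewrite !lt_min d20 d30 !divr_gt0 // mulr_gt0 // mulr_gt0.
move=> x Ex; rewrite !le_min => /andP[/andP[xd2 xd3] /and3P[x1 xd1 xe]].
have n0 : 0 <= nr x by exact: mnorm_ge0.
set M := 2 * nr x; set z := x + h x.
have M1 : M <= 1 by rewrite /M; lra.
have M0 : 0 <= M by rewrite /M; lra.
have hx := hsmall x Ex xd2.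
have e11 : e1 <= 1 by rewrite ge_min lexx.
have hx1 : nr (h x) <= nr x by apply: le_trans hx _; rewrite ler_piMl.
have zM : nr z <= M.
  by rewrite /z cplxD; apply: le_trans (mnormD _ _) _; rewrite /M; lra.
have xM : nr x <= M by rewrite /M; lra.
have zd1 : nr z <= d1 by apply: le_trans zM _; rewrite /M; lra.
have Mk : M ^+ k = 2 ^+ k * nr x ^+ k by rewrite /M exprMn.
have b1 : nr (Gk (fun=> x) - Gk (fun=> z)) <= eta / 3 * nr x ^+ k.
  rewrite cplxB -!GkC_real // !GkC_poly_map.
  apply: le_trans (Gdiff _ _ M e1 _ xM zM _) _; first exact: ltW.
    rewrite -cplxB /z opprD addNKr; rewrite /cplx map_mxN mnormN.
    by apply: le_trans hx _; rewrite ler_wpM2l // ltW.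
  rewrite Mk; have : e1 <= eta / 3 / ((C1 + 1) * 2 ^+ k) by rewrite ge_min lexx orbT.
  rewrite ler_pdivlMr ?mulr_gt0 // ?ltr_wpDl // => h1.
  rewrite !mulrA ler_wpM2r ?exprn_ge0 //; apply: le_trans h1.
  rewrite (_ : C1 * e1 * 2 ^+ k = e1 * (C1 * 2 ^+ k)); last by ring.
  by rewrite ler_wpM2l ?(ltW e10) // ler_wpM2r ?(ltW two0) // lerDl.
have b2 : nr (Gk (fun=> z) - G z) <= eta / 3 * nr x ^+ k.
  rewrite -opprB /cplx map_mxN mnormN; apply: le_trans (Gexp z zd1) _.
  apply: (@le_trans _ _ (C2 * M ^+ k.+1)).
    by rewrite ler_wpM2l ?(ltW C20) // lerXn2r ?nnegrE ?mnorm_ge0.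
  rewrite exprS Mk; move: xe; rewrite ler_pdivlMr ?mulr_gt0 // => xe.
  rewrite (_ : C2 * (M * (2 ^+ k * nr x ^+ k)) = nr x * (C2 * 2 ^+ k * 2) * nr x ^+ k); last first.
    by rewrite /M; ring.
  by rewrite ler_wpM2r ?exprn_ge0.
have b3 : nr (Dh x *m (P *m G z)) <= eta / 3 * nr x ^+ k.
  have Gz : nr (G z) <= (C2 + C3) * M ^+ k.
    rewrite -[G z](subrK (Gk (fun=> z))) cplxD; apply: le_trans (mnormD _ _) _.
    rewrite mulrDl; apply: lerD.
      apply: le_trans (Gexp z zd1) _; rewrite ler_wpM2l ?(ltW C20) //.
      rewrite exprS; apply: (@le_trans _ _ (1 * M ^+ k)); last by rewrite mul1r.
      apply: ler_pM; rewrite ?mnorm_ge0 ?exprn_ge0 ?mnorm_ge0 //; first exact: le_trans zM M1.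
      by rewrite lerXn2r ?nnegrE ?mnorm_ge0.
    rewrite -GkC_real // GkC_poly_map; apply: le_trans (Gbnd _) _.
    by rewrite ler_wpM2l // lerXn2r ?nnegrE ?mnorm_ge0.
  apply: le_trans (Dhsmall x Ex xd3 _) _.
  apply: le_trans (ler_wpM2l (ltW e20) Gz) _; rewrite Mk !mulrA ler_wpM2r ?exprn_ge0 //.
  rewrite /e2 -mulrA -[leRHS]mulr1 -!mulrA ler_pM2l // ler_pM2l ?invr_gt0 //.
  rewrite mulrC ler_pdivrMr ?mul1r ?mulr_gt0 // ?ler_wpM2r ?(ltW two0) ?lerDl //.
  by rewrite ltr_wpDl // addr_ge0 // ltW.
rewrite (_ : eta * _ = eta / 3 * nr x ^+ k + eta / 3 * nr x ^+ k + eta / 3 * nr x ^+ k); last by field.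
rewrite cplxD; apply: le_trans (mnormD _ _) _; apply: lerD => //.
rewrite (_ : Gk (fun=> x) - G z = (Gk (fun=> x) - Gk (fun=> z)) + (Gk (fun=> z) - G z)); last first.
  by rewrite addrA subrK.
by rewrite cplxD; apply: le_trans (mnormD _ _) _; exact: lerD.
Qed.

End RemainderEstimates.

(** * Distance of the Lyapunov-Perron integral to an invariant graph *)

Section RealExponential.
Variables (R : realType) (N : nat) (B : 'M[R]_N).

Lemma mderiv_conj p q (Y : R -> 'M[R[i]]_(p, q)) s L :
  mderiv Y s L -> mderiv (fun t => map_mx (@conjc R) (Y t)) s (map_mx (@conjc R) L).
Proof.
move=> YL i j; have [h1 h2] := YL i j; rewrite mxE; split.
  rewrite (_ : Re (L i j)^* = Re (L i j)); last by case: (L i j).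
  by move: h1; congr (is_derive _ _ _ _); apply/funext => t; rewrite mxE; case: (Y t i j).
rewrite (_ : Im (L i j)^* = - Im (L i j)); last by case: (L i j).
rewrite (_ : (fun _ => _) = - (fun t => Im (Y t i j))); first exact: is_deriveN.
by apply/funext => t; rewrite mxE -[RHS]/(- Im (Y t i j)); case: (Y t i j).
Qed.

Definition real_mexp (s : R) : 'M[R]_N := map_mx (@Re R) (mexp (cplx B) s).

(** The conjugate of the exponential of a real matrix solves the same linear equation. *)
Lemma real_mexpE s : cplx (real_mexp s) = mexp (cplx B) s.
Proof.
have h t : mderiv (fun t => map_mx (@conjc R) (mexp (cplx B) t)) t
    (cplx B *m map_mx (@conjc R) (mexp (cplx B) t)).
  by have := mderiv_conj (@mexp_deriv R N (cplx B) t); rewrite map_mxM conj_cplx.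
have := linear_ode_uniq h s; rewrite mexp0 map_mx1 mulmx1 => E.
apply/matrixP => i j; have /matrixP/(_ i j) := E; rewrite !mxE.
by case: (mexp _ _ i j) => x y [] yy; apply: complex_eq => //=; lra.
Qed.

End RealExponential.

Section LeadingOrder.
Variables (R : realType) (N m k : nat) (A : 'M[R]_N)
  (G : 'cV[R]_N -> 'cV[R]_N)
  (Gk : ('I_k -> 'cV[R]_N) -> 'cV[R]_N) (beta : nat -> R[i]) (e : nat -> 'cV[R[i]]_N).
Hypothesis spectrum : spectral_data A beta e.
Hypotheses (k_gt0 : (0 < k)%N) (m_ge1 : (1 <= m)%N) (m_ltN : (m < N)%N).
Hypothesis spectral_gap : Re (beta m.+1) < Re (beta m).
Variables a b : R.
Hypotheses (a0 : 0 < a) (ha : - Re (beta m) < a) (hb : b < - Re (beta m.+1)) (hab : k%:R * a < b).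
Hypothesis Gk_multilinear : multilinear Gk.
Hypothesis G_expansion : (fun y => G y - Gk (fun=> y))
                   =O_ (nbhs (0 : 'cV[R]_N)) (fun y => `|y| ^+ k.+1).

Local Notation Ec := (Ec e m).
Local Notation Es := (Es e m).
Local Notation Pis := (Pis e m).
Local Notation Ac := (Ac A e m).
Local Notation As := (As A e m).
Local Notation P := (PcR m e).
Local Notation c := (b - k%:R * a).
Local Notation nr v := (mnorm (cplx v)).

Variables (J : {ffun 'I_k -> 'I_N} -> 'cV[R[i]]_N) (F : 'cV[R[i]]_N -> R -> 'cV[R[i]]_N).
Hypothesis FP : forall xi, Ec xi -> tail_primitive c (LP_integrand A e m Gk xi) (F xi).
Hypothesis F0 : forall xi, Ec xi -> F xi 0 = poly_map J xi.

Variables (h : 'cV[R]_N -> 'cV[R]_N) (Dh : 'cV[R]_N -> 'M[R]_N) (r : R).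
Hypothesis r0 : 0 < r.
Hypothesis h_range : forall xi, EcR e m xi -> EsR e m (h xi).
Hypothesis h0 : h 0 = 0.
Hypothesis hD : forall xi, EcR e m xi -> derive_on (EcR e m) h xi (Dh xi).
Hypothesis Dh_continuous :
  forall v, EcR e m v -> {within EcR e m, continuous (fun xi => Dh xi *m v)}.
Hypothesis Dh0 : forall v, EcR e m v -> Dh 0 *m v = 0.
Hypothesis tangency : forall xi, EcR e m xi -> ball 0 r xi ->
  Dh xi *m (A *m xi + P *m G (xi + h xi)) = A *m h xi + (1%:M - P) *m G (xi + h xi).

Let c0 : 0 < c. Proof. by rewrite subr_gt0. Qed.
Let EcRPm x := EcRP spectrum m_ge1 m_ltN spectral_gap x.

Lemma EcR_im v : EcR e m (P *m v).
Proof. by apply/EcRPm; rewrite mulmxA (PcR_idem spectrum m_ge1 m_ltN spectral_gap). Qed.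

Let EcR0 : EcR e m 0. Proof. by rewrite -(mulmx0 _ P); exact: EcR_im. Qed.

Definition linear_orbit (xi : 'cV[R]_N) (s : R) : 'cV[R]_N := real_mexp (P *m A) s *m xi.
Local Notation orbit := linear_orbit.

Lemma orbitE xi s : cplx (orbit xi s) = mexp Ac s *m cplx xi.
Proof.
rewrite /orbit cplxM real_mexpE cplxM -(Pic_real spectrum m_ge1 m_ltN spectral_gap).
by [].
Qed.

Lemma orbit_EcR xi s : EcR e m xi -> EcR e m (orbit xi s).
Proof.
by move=> xic; rewrite /EcR /= orbitE; exact: (Ec_flow spectrum m_ge1 m_ltN spectral_gap).
Qed.

(** By tangency, this is, up to terms in Ec, the residual of h in the equation satisfied by the
Lyapunov-Perron integral. *)
Definition defect (x : 'cV[R]_N) : 'cV[R]_N :=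
  Gk (fun=> x) - G (x + h x) + Dh x *m (P *m G (x + h x)).

(** Along the linear flow the difference of the Lyapunov-Perron integral and h, transported
back by e^(-s A_s), changes at a rate given by the defect: the tangency of the vector field to
the graph of h removes all terms of lower order. *)
Lemma difference_deriv xi s : EcR e m xi -> ball 0 r (orbit xi s) ->
  mderiv (fun s => F (cplx xi) s - mexp As (- s) *m cplx (h (orbit xi s))) s
    (mexp As (- s) *m (Pis *m cplx (defect (orbit xi s)))).
Proof.
move=> xic xr; set x := orbit xi s.
have xc : EcR e m x by exact: orbit_EcR.
have Y' : mderiv (fun t => cplx (orbit xi t)) s (cplx (A *m x)).
  rewrite (_ : (fun t => _) = fun t => mexp Ac t *m cplx xi); last first.
    by apply/funext => t; exact: orbitE.
  have := mderivMr (cplx xi) (@mexp_deriv R N Ac s).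
  rewrite -(mulmxA Ac) -orbitE -/x (Ac_Ec spectrum m_ge1 m_ltN spectral_gap) // -cplxM.
  exact.
have Z' : mderiv (fun t => cplx (h (orbit xi t))) s (cplx (Dh x) *m cplx (A *m x)).
  apply: (mderiv_chain Y') => eps eps0; have [d d0 hd] := derive_on_eps_real (hD xc) eps0.
  exists d => // t; rewrite -!cplxB -cplxM -cplxB; apply: hd; exact: orbit_EcR.
have D := mderivB ((FP xic).1 s) (mderivM (@mexpN_deriv R N As s) Z').
set phi := (fun s => _ - _) in D *.
(* The difference lies in Es, so its derivative may be projected, and the components of the
   defect in Ec do not matter. *)
have phiE t : Pis *m phi t = phi t.
  apply/(EsP spectrum); apply/(Es_Pic spectrum); rewrite /phi mulmxBr.
  have F1 := LP_primitive_Es spectrum m_ge1 m_ltN spectral_gap c0 FP t xic.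
  have h1 : Es (mexp As (- t) *m cplx (h (orbit xi t))).
    apply: (Es_flow spectrum m_ge1 m_ltN spectral_gap); apply: h_range; exact: orbit_EcR.
  by rewrite !((Es_Pic spectrum _).1 _) ?subrr.
have := mderivMl Pis D; rewrite (_ : (fun t => Pis *m phi t) = phi); last first.
  by apply/funext => t; exact: phiE.
congr (mderiv _ _ _).
rewrite LP_integrandE -orbitE -/x mulNmx -(mulmxA _ As) (As_Es spectrum m_ge1 m_ltN spectral_gap); last first.
  exact: h_range.
rewrite -!cplxM (GkC_real Gk_multilinear).
have Pf := Pis_flow spectrum m_ge1 m_ltN spectral_gap (- s).
have PP := Pis_idem spectrum m_ltN.
have PE := PisE spectrum m_ge1 m_ltN spectral_gap.
have -> : Pis *m cplx (defect x) =
    Pis *m (cplx (Gk (fun=> x)) + cplx (A *m h x) - cplx (Dh x *m (A *m x))).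
  have T := tangency xc xr.
  rewrite -cplxD -cplxB PE -!cplxM; congr cplx.
  have QQ : (1%:M - P) *m (1%:M - P) = 1%:M - P by apply: cplx_inj; rewrite cplxM -PE PP.
  have -> : defect x = (Gk (fun=> x) + A *m h x - Dh x *m (A *m x)) - (G (x + h x) - (1%:M - P) *m G (x + h x)).
    move: T; rewrite mulmxDr /defect => T.
    have -> : Dh x *m (P *m G (x + h x)) = A *m h x + (1%:M - P) *m G (x + h x) - Dh x *m (A *m x).
      by rewrite -T [RHS]addrC addKr.
    by apply/colP => i; rewrite !mxE; ring.
  rewrite [LHS]mulmxBr [(1%:M - P) *m (G _ - _)]mulmxBr (mulmxA _ (1%:M - P)) QQ subrr subr0.
  by [].
move: Pf PP {PE D phiE phi}; move: (Pis) (mexp As (- s)) => S U SU SS.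
move: (cplx (Gk _)) (cplx (A *m h x)) (cplx (Dh x *m _)) => u v w.
have -> : U *m (S *m u) - (- (U *m v) + U *m w) = U *m (S *m u + v - w).
  by rewrite opprD opprK addrA mulmxBr mulmxDr.
by rewrite mulmxA SU -mulmxA; congr (U *m _); rewrite !mulmxBr !mulmxDr mulmxA SS.
Qed.

(** I - h = o(|xi|^k): follow the linear flow backward from xi until it leaves a small ball,
at the time -tau with Ca e^(a tau) |xi| = delta, which exists as a > 0. The defect contributes a small multiple of
|xi|^k, and the contraction e^(tau A_s) makes the value at time -tau negligible since b > k a. *)
Lemma leading_order eps : 0 < eps -> exists2 d, 0 < d & forall xi, EcR e m xi -> nr xi <= d ->
  mnorm (F (cplx xi) 0 - cplx (h xi)) <= eps * nr xi ^+ k.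
Proof.
move=> eps0.
have [Ca Ca0 boundA] := Ec_backward_bound spectrum m_ge1 m_ltN spectral_gap ha.
have [Cb Cb0 boundB] := Es_forward_bound spectrum m_ge1 m_ltN spectral_gap hb.
have [CI CI0 boundI] := poly_map_bound J.
pose p := mnorm Pis; have p0 : 0 <= p by exact: mnorm_ge0.
pose K1 := (N * 1)%:R * (2 * (Cb * p * Ca ^+ k / c)).
have K10 : 0 <= K1.
  rewrite !mulr_ge0 // ?invr_ge0 ?exprn_ge0 //; by apply: ltW.
pose eta := eps / 2 / (K1 + 1).
have K11 : 0 < K1 + 1 by rewrite ltr_wpDl.
have eta0 : 0 < eta by rewrite !divr_gt0.
have [d1 d10 small] := defect_small Gk_multilinear G_expansion EcR_im EcR0 h0 (hD EcR0)
  Dh_continuous Dh0 eta0.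
have [d2 d20 hsmall] := flat_small (hD EcR0) h0 Dh0 ltr01.
pose delta := Num.min (Num.min d1 d2) (Num.min (r / 2) 1).
have delta0 : 0 < delta by rewrite !lt_min d10 d20 ltr01 divr_gt0.
have [dd1 dd2] : delta <= d1 /\ delta <= d2 by split; rewrite !ge_min lexx ?orbT.
have [ddr dd3] : delta <= r / 2 /\ delta <= 1 by split; rewrite !ge_min lexx ?orbT.
pose K2 := Cb * (CI + 1) * (Ca / delta) ^+ k.
have K20 : 0 <= K2.
  by rewrite !mulr_ge0 ?exprn_ge0 ?divr_ge0 ?addr_ge0 // ltW.
(* A lower bound for the exit time, which makes the contribution of the value at -tau small;
   it is reached once |xi| is small enough. *)
pose tau0 := K2 / (c * (eps / 2)).
have ce0 : 0 < c * (eps / 2) by rewrite mulr_gt0 // divr_gt0.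
have tau00 : 0 <= tau0 by rewrite divr_ge0 // ltW.
have K2e : K2 * expR (- c * tau0) <= eps / 2.
  rewrite mulNr expRN ler_pdivrMr ?expR_gt0 //.
  apply: (@le_trans _ _ (eps / 2 * (1 + c * tau0))).
    rewrite mulrDr mulr1 (_ : eps / 2 * (c * tau0) = K2) ?lerDr; first by rewrite ltW // divr_gt0.
    by rewrite /tau0; field; rewrite !gt_eqF.
  by rewrite ler_wpM2l ?expR_ge1Dx // ltW // divr_gt0.
exists (delta * expR (- a * tau0) / Ca); first by rewrite !divr_gt0 // mulr_gt0 // expR_gt0.
move=> xi xic xid.
have n0 : 0 <= nr xi by exact: mnorm_ge0.
have [xi0|xin0] := eqVneq (nr xi) 0.
  have -> : xi = 0 by apply: cplx_inj; rewrite cplx0; apply: mnorm_le0; rewrite xi0.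
  rewrite h0 F0; last exact: EcR0.
  rewrite !cplx0 subr0 mnorm0 expr0n (gtn_eqF k_gt0) mulr0; apply: le_trans (boundI _) _.
  by rewrite mnorm0 expr0n (gtn_eqF k_gt0) mulr0.
have xigt0 : 0 < nr xi by rewrite lt_neqAle eq_sym xin0.
pose q := Ca * nr xi / delta.
have q0 : 0 < q by rewrite divr_gt0 // mulr_gt0.
pose tau := - ln q / a.
have qE : expR (- a * tau) = q.
  rewrite (_ : - a * tau = ln q) ?lnK ?posrE //.
  by rewrite /tau; field; rewrite gt_eqF.
have qle : q <= expR (- a * tau0).
  by rewrite /q ler_pdivrMr // [Ca * _]mulrC [leRHS]mulrC -ler_pdivlMr.
have tau_ge : tau0 <= tau.
  by move: qle; rewrite -qE ler_expR !mulNr lerN2 ler_pM2l.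
have tau1 : 0 <= tau by exact: le_trans tau_ge.
have ntau : - tau <= 0 by rewrite oppr_le0.
have orbit_le s : s <= 0 -> nr (orbit xi s) <= Ca * expR (- a * s) * nr xi.
  move=> s0; rewrite orbitE -{1}[s]opprK.
  have s0' : 0 <= - s by rewrite oppr_ge0.
  by apply: le_trans (boundA _ _ s0' xic) _; rewrite mulrN mulNr.
have orbit_delta s : - tau <= s <= 0 -> nr (orbit xi s) <= delta.
  move=> /andP[ts s0]; apply: le_trans (orbit_le s s0) _.
  apply: (@le_trans _ _ (Ca * expR (a * tau) * nr xi)).
    rewrite ler_wpM2r // ler_wpM2l ?(ltW Ca0) // ler_expR mulNr -mulrN ler_wpM2l ?(ltW a0) //.
    by rewrite lerNl.
  rewrite (_ : a * tau = - (- a * tau)) ?expRN ?qE; last by ring.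
  rewrite /q le_eqVlt; apply/orP; left; apply/eqP; field.
  by rewrite !gt_eqF.
have orbit_ball s : - tau <= s <= 0 -> ball 0 r (orbit xi s).
  move=> si; rewrite -ball_normE /= sub0r normrN.
  apply: le_lt_trans (norm_le_mnorm_cplx _) _.
  apply: le_lt_trans (orbit_delta s si) _; apply: le_lt_trans ddr _.
  by rewrite ltr_pdivrMr // ltr_pMr // ltr1n.
pose phi s := F (cplx xi) s - mexp As (- s) *m cplx (h (orbit xi s)).
have phi0 : phi 0 = F (cplx xi) 0 - cplx (h xi).
  rewrite /phi oppr0 mexp0 mul1mx; congr (_ - cplx (h _)).
  by apply: cplx_inj; rewrite orbitE mexp0 mul1mx.
pose K' := Cb * p * eta * Ca ^+ k * nr xi ^+ k.
have K'0 : 0 <= K'.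
  rewrite /K' mulr_ge0 ?exprn_ge0 // mulr_ge0 ?exprn_ge0 ?(ltW Ca0) //.
  by rewrite mulr_ge0 ?(ltW eta0) // mulr_ge0 // ltW.
(* The accumulated defect: Ca |xi| e^(-as) bounds the orbit, and e^((b - ka)s) is integrable. *)
have diff : mnorm (phi 0 - phi (- tau)) <= eps / 2 * nr xi ^+ k.
  have := @mderiv_bound R N 1 phi (fun s => mexp As (- s) *m (Pis *m cplx (defect (orbit xi s))))
    (fun s => K' / c * expR (c * s)) (fun s => K' * expR (c * s)) (- tau) 0 ntau.
  move=> bnd; apply: le_trans (bnd _ _ _) _.
  - by move=> s si; apply: difference_deriv => //; exact: orbit_ball.
  - move=> s si; have := derZ (K' / c) (der_expRM c s).
    by rewrite mulrA divfK // gt_eqF.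
  - move=> s si; have /andP[_ s0] := si.
    have s0' : 0 <= - s by rewrite oppr_ge0.
    apply: le_trans (boundB _ _ s0' (Es_im spectrum m_ltN _)) _.
    have dle : mnorm (Pis *m cplx (defect (orbit xi s))) <=
        p * (eta * (Ca * expR (- a * s) * nr xi) ^+ k).
      apply: le_trans (mnormM _ _) _; rewrite ler_wpM2l //.
      apply: le_trans (small _ (orbit_EcR s xic) (le_trans (orbit_delta s si) dd1)) _.
      by rewrite ler_wpM2l ?(ltW eta0) // lerXn2r ?nnegrE ?mnorm_ge0 ?(le_trans _ (orbit_le s s0)) ?mnorm_ge0 ?orbit_le.
    apply: le_trans (ler_wpM2l _ dle) _; first by rewrite mulr_ge0 ?expR_ge0 // ltW.
    rewrite !exprMn -expRM_natl.
    have -> : expR (c * s) = expR (- b * - s) * expR (k%:R * (- a * s)).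
      by rewrite -expRD; congr expR; ring.
    rewrite le_eqVlt; apply/orP; left; apply/eqP; rewrite /K'; ring.
  rewrite mulr0 expR0 mulr1.
  apply: (@le_trans _ _ ((N * 1)%:R * (2 * (K' / c)))).
    rewrite ler_wpM2l // ler_wpM2l // lerBlDr lerDl mulr_ge0 ?expR_ge0 //.
    by rewrite divr_ge0 // ltW.
  rewrite (_ : _ * (2 * (K' / c)) = K1 * eta * nr xi ^+ k); last first.
    by rewrite /K1 /K'; ring.
  rewrite ler_wpM2r ?exprn_ge0 // /eta mulrCA ler_piMr //; first by rewrite ltW // divr_gt0.
  by rewrite ler_pdivrMr // mul1r lerDl.
(* At the exit time both terms are merely bounded, by CI and 1, but e^(tau As) contributes
   e^(-b tau) = e^(-c tau) (Ca |xi| / delta)^k. *)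
have start : mnorm (phi (- tau)) <= eps / 2 * nr xi ^+ k.
  set x := orbit xi (- tau).
  have xc : EcR e m x by exact: orbit_EcR.
  have xdelta : nr x <= delta by apply: orbit_delta; rewrite lexx.
  have x0 : 0 <= nr x by exact: mnorm_ge0.
  have FE : F (cplx xi) (- tau) = mexp As tau *m F (cplx x) 0.
    rewrite /x orbitE (LP_primitive_flow spectrum m_ge1 m_ltN spectral_gap c0 FP) // add0r.
    by rewrite mulmxA mexpKN mul1mx.
  have -> : phi (- tau) = mexp As tau *m (F (cplx x) 0 - cplx (h x)).
    by rewrite /phi FE opprK mulmxBr.
  apply: le_trans (boundB _ _ tau1 _) _.
    apply/(Es_Pic spectrum); rewrite mulmxBr.
    have F1 := LP_primitive_Es spectrum m_ge1 m_ltN spectral_gap c0 FP 0 xc.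
    have h1 : Es (cplx (h x)) by exact: h_range.
    by rewrite !((Es_Pic spectrum _).1 _) ?subrr.
  have w : mnorm (F (cplx x) 0 - cplx (h x)) <= CI + 1.
    apply: le_trans (mnormB _ _) _; apply: lerD.
      rewrite F0 //; apply: le_trans (boundI _) _; rewrite ler_piMr //.
      by rewrite exprn_ile1 // (le_trans xdelta).
    apply: le_trans (hsmall x xc (le_trans xdelta dd2)) _.
    by rewrite mul1r (le_trans xdelta).
  apply: le_trans (ler_wpM2l _ w) _; first by rewrite mulr_ge0 ?expR_ge0 // ltW.
  have -> : expR (- b * tau) = expR (- c * tau) * q ^+ k.
    by rewrite -qE -expRM_natl -expRD; congr expR; ring.
  rewrite (_ : _ * (CI + 1) = K2 * expR (- c * tau) * nr xi ^+ k); last first.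
    by rewrite /K2 /q !exprMn; ring.
  rewrite ler_wpM2r ?exprn_ge0 //; apply: le_trans K2e.
  by rewrite ler_wpM2l // ler_expR !mulNr lerN2 ler_wpM2l // ltW.
rewrite -phi0 -[phi 0](subrK (phi (- tau))); apply: le_trans (mnormD _ _) _.
by apply: le_trans (lerD diff start) _; rewrite -mulrDl -splitr.
Qed.

End LeadingOrder.

(** * Lyapunov-Perron integrals and invariant graphs *)

(** As L < u / k, take a halfway between these, and then b halfway between k a and u. *)
Lemma rates_exist (R : realType) (k : nat) (L u : R) : (0 < k)%N -> k%:R * L < u ->
  exists a b, [/\ L < a, b < u & k%:R * a < b].
Proof.
move=> k0 Lu; have k0' : 0 < k%:R :> R by rewrite ltr0n.
pose a := (L + u / k%:R) / 2.
have La : L < u / k%:R by rewrite ltr_pdivlMr // mulrC.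
have ka : k%:R * a = (k%:R * L + u) / 2.
  by rewrite /a; field; rewrite gt_eqF.
by exists a, ((k%:R * a + u) / 2); split; rewrite ?ka /a; lra.
Qed.

Theorem theorem1 (R : realType) (N m k : nat)
    (A : 'M[R]_N) (G : 'cV[R]_N -> 'cV[R]_N)
    (Gk : ('I_k -> 'cV[R]_N) -> 'cV[R]_N)
    (beta : nat -> R[i]) (e : nat -> 'cV[R[i]]_N)
    (k_ge2 : (2 <= k)%N)
    (G_smooth : smooth k.+1 G)
    (G_0 : G 0 = 0)
    (DG_0 : forall v, 'd G 0 v = 0)
    (Gk_multilinear : multilinear Gk)
    (G_expansion : (fun y => G y - Gk (fun=> y))
                   =O_ (nbhs (0 : 'cV[R]_N)) (fun y => `|y| ^+ k.+1))
    (spectrum : spectral_data A beta e)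
    (m_ge1 : (1 <= m)%N) (m_ltN : (m < N)%N)
    (spectral_gap : complex.Re (beta m.+1) < complex.Re (beta m))
    (gap_k : complex.Re (beta m.+1) < k%:R * complex.Re (beta m)) :
  let frI := LP_integral A e m Gk in
  [/\ forall xi, Ec e m xi ->
        cvec_integrable `]-oo, 0] (LP_integrand A e m Gk xi) /\
        Es e m (frI xi),
      forall xi, Ec e m xi ->
        exists2 D : 'M[R[i]]_N, derive_on (Ec e m) frI xi D &
          D *m (Ac A e m *m xi) - As A e m *m frI xi = Pis e m *m GkC Gk xi,
      forall xi, Ec e m xi ->
        exists2 y0 : R -> 'cV[R[i]]_N,
          (forall tau, 0 < tau ->
             (exists yc ys, backward_forward_solution A e m Gk xi tau yc ys) /\
             (forall yc ys, backward_forward_solution A e m Gk xi tau yc ys ->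
                ys 0 = y0 tau)) &
          y0 @ +oo --> frI xi
    & complex.Re (beta m.+1) < Num.min ((2 * k)%:R * complex.Re (beta m)) 0 ->
      forall h, local_invariant_manifold_function A e m G h ->
        (fun xi : 'cV[R]_N => frI (cplx xi) - cplx (h xi))
        =o_ (within (EcR e m) (nbhs (0 : 'cV[R]_N)))
        (fun xi => `|cplx xi| ^+ k)].
Proof.
move=> frI; have k_gt0 : (0 < k)%N by apply: leq_trans k_ge2.
have [|a [b [ha hb hab]]] := @rates_exist R k (- Re (beta m)) (- Re (beta m.+1)) k_gt0.
  by rewrite mulrN ltrN2.
have c0 := decay_rate_gt0 hab.
have [Fs FsP] := LP_primitives Gk spectrum m_ge1 m_ltN spectral_gap ha hb hab.
pose F xi s := poly_map (Fs ^~ s) xi.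
have FP xi : Ec e m xi -> tail_primitive (b - k%:R * a) (LP_integrand A e m Gk xi) (F xi).
  by move=> /FsP[].
have frIE xi : Ec e m xi -> frI xi = F xi 0 by move=> /FsP[].
split.
- move=> xi xic; split; first by have [] := FsP xi xic.
  by rewrite frIE //; exact: (LP_primitive_Es spectrum m_ge1 m_ltN spectral_gap c0 FP).
- move=> xi xic; have [D /(_ (Ec e m)) hD] := poly_map_derive_on (Fs ^~ 0) xi.
  have {}hD := derive_on_congr frIE xic hD.
  by exists D => //; exact: (LP_equation spectrum m_ge1 m_ltN spectral_gap c0 FP frIE).
- move=> xi xic; exists (fun tau => F xi 0 - F xi (- tau)).
    move=> tau tau0; split.
      exact: (bf_exists spectrum m_ge1 m_ltN spectral_gap c0 FP).
    by move=> yc ys; exact: (bf_value FP).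
  by rewrite frIE //; exact: (bf_limit c0 FP).
move=> gap2 h [h_range h0 [Dh [hD Dhc Dh0]] [r r0 inv]].
(* The comparison with h needs in addition a growth rate a' > 0; such a rate with k a' < b'
   exists because Re (beta m.+1) < 0. *)
have [|a' [b' [La' hb' hab']]] :=
    @rates_exist R k (Num.max 0 (- Re (beta m))) (- Re (beta m.+1)) k_gt0.
  move: gap2; rewrite lt_min => /andP[_ s0].
  have [_|_] := leP 0 (- Re (beta m)); first by rewrite mulrN ltrN2.
  by rewrite mulr0 oppr_gt0.
move: La'; rewrite gt_max => /andP[a0' ha'].
have [Fs' FsP'] := LP_primitives Gk spectrum m_ge1 m_ltN spectral_gap ha' hb' hab'.
pose F' xi s := poly_map (Fs' ^~ s) xi.
have FP' xi : Ec e m xi -> tail_primitive (b' - k%:R * a') (LP_integrand A e m Gk xi) (F' xi).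
  by move=> /FsP'[].
have tang := invariance_equation spectrum m_ge1 m_ltN spectral_gap G_smooth h_range hD inv.
have main := leading_order spectrum k_gt0 m_ge1 m_ltN spectral_gap a0' ha' hb' hab'
  Gk_multilinear G_expansion FP' (fun xi _ => erefl) r0 h_range h0 hD Dhc Dh0 tang.
apply/eqoP => eps eps0.
(* What remains is the passage between the maximum norms and the l^1 norm. *)
have epsE : eps = (Re eps)%:C by apply: complex_eq => //=; exact: ger0_Im (ltW eps0).
have eps0' : 0 < Re eps by rewrite -ltcR -epsE.
pose q : R := 2 * (N * 1)%:R + 1.
have q0 : 0 < q by rewrite ltr_wpDl // mulr_ge0.
have [d d0 hd] := main (Re eps / q ^+ k) (divr_gt0 eps0' (exprn_gt0 _ q0)).
pose q' : R := (N * 1)%:R + 1; have q0' : 0 < q' by rewrite ltr_wpDl.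
rewrite /within /=; apply/nbhs_ballP; exists (d / q') => /=; first by rewrite divr_gt0.
move=> xi; rewrite -ball_normE /= sub0r normrN => xid xic.
have xid' : mnorm (cplx xi) <= d.
  apply: le_trans (mnorm_cplx_le _) _; apply: (@le_trans _ _ (q' * `|xi|)).
    by rewrite ler_wpM2r // lerDl.
  by rewrite mulrC -ler_pdivlMr // ltW.
have frI' : frI (cplx xi) = F' (cplx xi) 0 by have [] := FsP' _ xic.
rewrite frI'; apply: le_trans (norm_le_mnorm _) _.
have [x x0 xE] : exists2 x : R, 0 <= x & `|cplx xi| = x%:C.
  have := normr_ge0 (cplx xi); move: (`|cplx xi|) => z z0.
  have zE : z = (Re z)%:C by apply: complex_eq => //=; exact: ger0_Im z0.
  by exists (Re z) => //; rewrite -ler0c -zE.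
have xle : mnorm (cplx xi) <= q * x.
  rewrite -lecR; apply: le_trans (mnorm_le_norm _) _; rewrite xE.
  rewrite [in leLHS](natC R 2) [in leLHS](natC R (N * 1)) -!rmorphM lecR.
  by rewrite ler_wpM2r // /q; lra.
rewrite xE epsE -rmorphXn ger0_norm ?ler0c ?exprn_ge0 // -rmorphM lecR.
apply: le_trans (hd xi xic xid') _.
rewrite mulrAC ler_pdivrMr ?exprn_gt0 // -mulrA ler_wpM2l ?(ltW eps0') //.
by rewrite -exprMn mulrC lerXn2r ?nnegrE ?mnorm_ge0 // mulr_ge0 // ltW.
Qed.
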